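(* Let $T>0$ and $h>0$, and let $F(u)=\sum_{m=-\infty}^\infty(-1)^m e^{-2m^2u^2}$, $u>0$, be the Kolmogorov distribution function. (i) For the Brownian bridge from $0$ to $y$ of length $T$ with $|y|\ge h$, $$\mathbb{E}_{0,T,y}[\mathcal{T}_{(-h,h)}]=h\int_0^T\frac{p_{T-t}(0,y)}{p_T(0,y)}\,\frac{F(h/\sqrt t)}{\sqrt{2\pi t}}\,dt.$$ (ii) For the 3-dimensional Bessel bridge from $x$ to $y$ of length $T$ with $x>h$ and positive $y\notin(x-h,x+h)$, $$\mathbb{E}^{(3)}_{x,T,y}[\mathcal{T}_{(x-h,x+h)}]=h\int_0^T\frac{r^{(3)}_{T-t}(x,y)}{r^{(3)}_T(x,y)}\,\frac{F(h/\sqrt t)}{\sqrt{2\pi t}}\,dt.$$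
   Context: $p_t(x,y)=\frac{1}{\sqrt{2\pi t}}e^{-(x-y)^2/(2t)}$ is the transition density (with respect to Lebesgue measure) of standard Brownian motion. For $x,y>0$, $$r^{(3)}_t(x,y)=\frac{y}{x}\big(p_t(x,y)-p_t(x,-y)\big)$$ is the transition density (with respect to Lebesgue measure) of the 3-dimensional Bessel process. The Brownian bridge from $x$ to $y$ of length $T$ has expectation $\mathbb{E}_{x,T,y}$; the 3-dimensional Bessel bridge from $x>0$ to $y>0$ of length $T$ has expectation $\mathbb{E}^{(3)}_{x,T,y}$. Each is the underlying process (Brownian motion, resp. 3-dimensional Bessel process) started at $x$ and conditioned to be at $y$ at time $T$: with $X$ the underlying process, $\mathbb{E}_x^X$ its expectation from $x$ and $q$ its transition density ($p$, resp. $r^{(3)}$), the bridge law of an event $A_t$ depending on the path up to time $t<T$ is $\mathbb{E}^X_x\big[\frac{q_{T-t}(X_t,y)}{q_T(x,y)};A_t\big]$, and the bridge takes the value $y$ at time $T$. For a continuous process $X$ (for a bridge, on the time interval $[0,T]$), $\mathcal{T}_{(a,b)}:=\inf\{t>0:X_t\notin(a,b)\}$, with $\mathcal{T}_{(a,b)}:=\infty$ if this set is empty. *)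

(* Defs.v *)
From HB Require Import structures.
From mathcomp Require Import all_boot all_order all_algebra.
From mathcomp Require Import all_classical all_reals all_analysis.

Set Implicit Arguments.
Unset Strict Implicit.
Unset Printing Implicit Defensive.

Import Order.TTheory GRing.Theory Num.Theory.
Import numFieldNormedType.Exports.

Local Open Scope classical_set_scope.
Local Open Scope ring_scope.

Definition brownian_density {R : realType} (t x y : R) : R :=
  (Num.sqrt (2 * pi * t))^-1 * expR (- ((x - y) ^+ 2 / (2 * t))).

(* Only meaningful for x, y > 0. *)
Definition bessel3_density {R : realType} (t x y : R) : R :=
  y / x * (brownian_density t x y - brownian_density t x (- y)).

(* The sum over all integers is the limit of its symmetric partial sums; for
   u > 0 it converges absolutely, so the order of summation is immaterial. *)
Definition kolmogorov_cdf {R : realType} (u : R) : R :=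
  limn (fun N : nat => \sum_(k < N.*2.+1)
    let m : int := (k : nat)%:Z - N%:Z in
    (-1) ^ m * expR (- (2 * m%:~R ^+ 2 * u ^+ 2))).

(* Path-space events depending on the path up to time t only. *)
Definition past_events {R : realType} (t : R) : set (set (R -> R)) :=
  <<s [set A | exists s B, [/\ 0 <= s <= t, measurable B &
                              A = [set f : R -> R | B (f s)]]] >>.

Definition path_event {R : realType} {Omega : Type} (X : R -> Omega -> R)
  (A : set (R -> R)) : set Omega := [set w | A (X ^~ w)].

(* A continuous process (X_t), t >= 0, started at x, that is Markov (with
   respect to its natural filtration) on the state space S, with transition
   density q with respect to Lebesgue measure.  Taking B to be the complement of
   S in the Markov property shows that each X_t lies in S almost surely, so the
   values of q outside S are irrelevant.  X_t at t < 0 is unconstrained. *)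
Record markov_process {R : realType} (q : R -> R -> R -> R) (S : set R) (x : R)
    {d : measure_display} {Omega : measurableType d} (P : probability Omega R)
    (X : R -> Omega -> R) : Prop := MarkovProcess {
  markov_measurable : forall t, 0 <= t -> measurable_fun setT (X t) ;
  markov_continuous : forall w, {within `[0, +oo[, continuous (X ^~ w)} ;
  markov_start : forall w, X 0 w = x ;
  markov_transition : forall (s t : R) (A : set (R -> R)) (B : set R),
    0 <= s -> 0 < t -> past_events s A -> measurable B ->
    P (path_event X A `&` X (s + t) @^-1` B) =
    (\int[P]_(w in path_event X A)
       \int[lebesgue_measure]_(z in S `&` B) (q t (X s w) z)%:E)%E }.

Definition brownian_motion {R : realType} (x : R) {d : measure_display}
    {Omega : measurableType d} (P : probability Omega R)
    (X : R -> Omega -> R) : Prop :=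
  markov_process brownian_density setT x P X.

Definition bessel3_process {R : realType} (x : R) {d : measure_display}
    {Omega : measurableType d} (P : probability Omega R)
    (X : R -> Omega -> R) : Prop :=
  markov_process bessel3_density `]0, +oo[ x P X.

(* Y, on (Omega', Q), is the bridge from x to y of length T of the process X, on
   (Omega, P), with transition density q and X_0 = x.  Only the times in [0, T]
   matter for Y. *)
Record bridge {R : realType} (q : R -> R -> R -> R) (x T y : R)
    {d : measure_display} {Omega : measurableType d} (P : probability Omega R)
    (X : R -> Omega -> R)
    {d' : measure_display} {Omega' : measurableType d'}
    (Q : probability Omega' R) (Y : R -> Omega' -> R) : Prop := Bridge {
  bridge_measurable : forall t, 0 <= t <= T -> measurable_fun setT (Y t) ;
  bridge_continuous : forall w, {within `[0, T], continuous (Y ^~ w)} ;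
  bridge_law : forall (t : R) (A : set (R -> R)),
    0 <= t < T -> past_events t A ->
    Q (path_event Y A) =
    (\int[P]_(w in path_event X A) (q (T - t) (X t w) y / q T x y)%:E)%E ;
  bridge_end : forall w, Y T w = y }.

(* Exit time from (a, b) of the path f on the time set I; it is +oo when the set
   is empty, by the convention of ereal_inf. *)
Definition exit_time {R : realType} (I : set R) (a b : R) (f : R -> R) : \bar R :=
  ereal_inf [set t%:E | t in [set t | [/\ I t, 0 < t & ~ (a < f t < b)]]].

(* Main.v *)
Require Import Defs.
From HB Require Import structures.
From mathcomp Require Import all_boot all_order all_algebra.
From mathcomp Require Import all_classical all_reals all_analysis.
From mathcomp Require Import measurable_realfun zify ring lra.

Set Implicit Arguments.
Unset Strict Implicit.
Unset Printing Implicit Defensive.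

Import Order.TTheory GRing.Theory Num.Theory.
Import numFieldNormedType.Exports.
Local Open Scope classical_set_scope.
Local Open Scope ring_scope.

(** Write [p_t] for the heat kernel. Both parts concern a bridge from [x] to [y]
    of a Markov process whose transition density is
    [q_t(z, u) = phi u / phi z * k_t(z, u)] with
    [k_t(z, u) = p_t(z, u) - kap * p_t(z, - u)]: Brownian motion is [kap = 0],
    [phi = 1], and the 3-dimensional Bessel process, a Doob transform of Brownian
    motion killed at the origin, is [kap = 1], [phi z = z]. The factors [phi]
    cancel in the bridge law, so [k_T(x, y)] times the expected exit time is
    [\int_0^T E_x[k_(T-t)(B_t, y); B stays in (x-h, x+h) up to t] dt] for a
    Brownian motion [B], where the killing is invisible because the interval is
    contained in the state space. As a function of the length [r] and of the
    starting point [z] this quantity is the solution [v] of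
    [dv/dr = v''/2 + k_r(z, y)] on the interval that vanishes on its boundary and
    at [r = 0].

    That solution is explicit, because [y] and [- y] lie outside the interval.
    If [b] is the distance from [x] to the target and [s] the position relative
    to [x], counted towards the target, then
    [(h - s) * gaussian_tail r (b - s)] solves the inhomogeneous equation and
    vanishes at [s = h]; reflecting it repeatedly in both endpoints adds a series
    of Gaussian tails ([barrier]), whose truncation is exact at [s = h] and off
    by one small tail at [s = - h]. At the centre it is an alternating sum of
    [h * gaussian_tail T (b + 2 m h)]. Since
    [\int_0^T p_t(0, a) p_(T-t)(0, b) dt = gaussian_tail T (a + b)]
    ([brownian_density_convolution]), this is [h] times the integral over [t] of
    [p_(T-t)(0, b)] against [\sum_m (-1)^m p_t(0, 2 m h)], the value at the centre
    of the kernel killed at the endpoints, and that value is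
    [F(h / sqrt t) / sqrt (2 pi t)]. The two targets [y] and [- y] recombine
    into [k_(T-t)(x, y)].

    To show that the expected exit time is given by [v] without differentiating
    [v] in [z] and without a killed semigroup in continuous time, time is
    discretized. On a mesh of size [d] the time spent before the path is first
    seen at distance more than [a < h] from [x] has a mean that the bridge law and
    the Markov property express as a finite sum over the steps. The heat equation
    for [v] is the Gaussian mean identity [gaussian_mean_barrier]; together with
    the smallness of [v] at the boundary and at small times it makes
    [v] plus or minus a constant, corrected by [O(d^2)] at each step, a super- and
    a subsolution of the discrete problem ([fixed_mesh_upper],
    [fixed_mesh_lower]). Letting [d] tend to [0], then [a] to [h]
    ([bridge_exit_time_approx]), and finally the number of reflections to infinity
    ([bridge_exit_time_formula]) gives the theorem. *)

(** * Integrable real functions *)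

Section real_integrable.
Context d (T : measurableType d) (R : realType).
Variables (m : {measure set T -> \bar R}) (D : set T).
Hypothesis mD : measurable D.
Implicit Types (f g : T -> R) (k : R).
Local Notation int f := (m.-integrable D (fun x => (f x)%:E)).

Lemma integrable_realZl k f : int f -> int (fun x => k * f x).
Proof. by move=> /(integrableZl mD k); apply: eq_integrable. Qed.

Lemma integrable_realD f g : int f -> int g -> int (fun x => f x + g x).
Proof. by move=> intf /(integrableD mD intf); apply: eq_integrable. Qed.

Lemma integrable_realB f g : int f -> int g -> int (fun x => f x - g x).
Proof. by move=> intf /(integrableB mD intf); apply: eq_integrable. Qed.

Lemma integrable_real_norm f : int f -> int (fun x => `|f x|).
Proof. by move=> /integrable_abse; apply: eq_integrable. Qed.

Lemma le_integrable_real f g : measurable_fun D f ->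
  (forall x, D x -> `|f x| <= g x) -> int g -> int f.
Proof.
move=> mf fg; apply: le_integrable => //; first exact/measurable_EFinP.
by move=> x Dx; rewrite /= lee_fin (le_trans (fg x Dx))// ler_norm.
Qed.

End real_integrable.

(** * The heat kernel *)

Section heat_kernel.
Variable R : realType.
Local Notation mu := (@lebesgue_measure R).
Local Notation p := (@brownian_density R).
Implicit Types (t r s x y z c : R).

Lemma brownian_density_ge0 t x y : 0 <= p t x y.
Proof. by rewrite /brownian_density mulr_ge0 ?invr_ge0 ?sqrtr_ge0 ?expR_ge0. Qed.

Lemma brownian_density_gt0 t x y : 0 < t -> 0 < p t x y.
Proof.
move=> t0; rewrite /brownian_density mulr_gt0 ?expR_gt0// invr_gt0 sqrtr_gt0.
by rewrite !mulr_gt0// pi_gt0.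
Qed.

Lemma brownian_densityE t x y : p t x y = p t 0 (y - x).
Proof. by rewrite /brownian_density sub0r sqrrN -sqrrN opprB. Qed.

Lemma brownian_density_sym t x y : p t x y = p t y x.
Proof. by rewrite /brownian_density -sqrrN opprB. Qed.

Lemma brownian_densityN t c : p t 0 (- c) = p t 0 c.
Proof. by rewrite /brownian_density !sub0r opprK sqrrN. Qed.

Lemma brownian_density_normal t x y : 0 < t ->
  p t x y = normal_pdf x (Num.sqrt t) y.
Proof.
move=> t0; have st0 : Num.sqrt t != 0 by rewrite gt_eqF ?sqrtr_gt0.
rewrite normal_pdfE// /normal_peak /normal_fun /brownian_density sqr_sqrtr ?ltW//.
congr (_^-1 * expR _); first by congr Num.sqrt; rewrite -mulr_natl; ring.
by rewrite mulNr -(sqrrN (x - y)) opprB -[t *+ 2]mulr_natl.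
Qed.

Lemma measurable_brownian_density t x : measurable_fun setT (p t x).
Proof.
apply: measurable_funM => //; apply: measurableT_comp => //.
apply: measurableT_comp => //; apply: measurable_funM => //.
by apply: measurable_funX; apply: measurable_funB.
Qed.

Lemma integral_brownian_density t x : 0 < t ->
  (\int[mu]_y (p t x y)%:E = 1)%E.
Proof.
move=> t0; rewrite -(integral_normal_pdf x (Num.sqrt t)).
by apply: eq_integral => y _; rewrite brownian_density_normal.
Qed.

Lemma integrable_brownian_density t x : 0 < t ->
  mu.-integrable setT (fun y => (p t x y)%:E).
Proof.
move=> t0; have := integrable_normal_pdf x (Num.sqrt t).
by apply: eq_integrable => // y _; rewrite brownian_density_normal.
Qed.

(** Completing the square: the Brownian bridge is Gaussian. *)
Lemma brownian_density_mul s t x y z : 0 < s -> 0 < t ->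
  p s x z * p t z y =
  p (s + t) x y * p (s * t / (s + t)) ((t * x + s * y) / (s + t)) z.
Proof.
move=> s0 t0; rewrite /brownian_density.
have st0 : 0 < s + t by rewrite addr_gt0.
have pi0 := pi_gt0 R.
rewrite [LHS]mulrACA [RHS]mulrACA.
rewrite -!invfM -!sqrtrM ?mulr_ge0 ?ltW// -!expRD.
congr (_^-1 * expR _).
  by congr Num.sqrt; field; rewrite gt_eqF.
by field; rewrite ?gt_eqF.
Qed.

Lemma chapman_kolmogorov s t x y : 0 < s -> 0 < t ->
  (\int[mu]_z (p s x z * p t z y)%:E = (p (s + t) x y)%:E)%E.
Proof.
move=> s0 t0; under eq_integral do rewrite brownian_density_mul//.
under eq_integral do rewrite EFinM.
have q0 : 0 < s * t / (s + t) by rewrite divr_gt0 ?mulr_gt0 ?addr_gt0.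
rewrite integralZl//; last exact: integrable_brownian_density.
by rewrite integral_brownian_density// mule1.
Qed.

Lemma expRN_le (u : R) : 0 <= u -> expR (- u) <= (1 + u)^-1.
Proof.
move=> u0; rewrite expRN lef_pV2 ?posrE ?expR_gt0 ?ltr_wpDr//.
exact: expR_ge1Dx.
Qed.

Lemma pi_ge1 : 1 <= pi :> R.
Proof. by rewrite (le_trans _ (pi_ge2 R))// ler1n. Qed.

(** The bound is uniform in [t], since the kernel at distance [c] is largest for
    [t] of order [c ^+ 2]. *)
Lemma ler_dist_brownian_density t c : 0 < t -> c * p t 0 c <= 1.
Proof.
move=> t0; rewrite /brownian_density sub0r sqrrN.
have pit : 0 < 2 * pi * t by rewrite !mulr_gt0 ?pi_gt0.
have [c0|c0] := leP c 0.
  by rewrite (@le_trans _ _ 0)// mulr_le0_ge0// mulr_ge0 ?invr_ge0 ?expR_ge0 ?sqrtr_ge0.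
have u0 : 0 <= c ^+ 2 / (2 * t) by rewrite divr_ge0 ?sqr_ge0// mulr_ge0// ltW.
rewrite mulrCA ler_pdivrMl ?sqrtr_gt0// mulr1.
apply: (@le_trans _ _ (c * (1 + c ^+ 2 / (2 * t))^-1)).
  by rewrite ler_pM2l// expRN_le.
rewrite ler_pdivrMr ?ltr_wpDr//.
have t2 : 0 < Num.sqrt (2 * t) by rewrite sqrtr_gt0 mulr_gt0.
apply: (@le_trans _ _ (Num.sqrt (2 * t) * (1 + c ^+ 2 / (2 * t)))); last first.
  rewrite ler_wpM2r ?addr_ge0// ler_sqrt; last by rewrite ltW.
  have := pi_ge1; nra.
have -> : c ^+ 2 / (2 * t) = (c / Num.sqrt (2 * t)) ^+ 2.
  by rewrite exprMn exprVn sqr_sqrtr// mulr_ge0// ltW.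
have {1}-> : c = Num.sqrt (2 * t) * (c / Num.sqrt (2 * t)).
  by rewrite mulrCA divff ?mulr1// gt_eqF.
rewrite ler_pM2l//; set w := c / _; have : 0 <= w by rewrite divr_ge0 ?ltW.
by move=> ?; have := sqr_ge0 (w - 2^-1); nra.
Qed.

(** A fourth power is absorbed by doubling the time; four is enough for the
    resulting factor [t ^+ 2] to remain negligible after summation over [T / t]
    steps. *)
Lemma brownian_density_pow4 t x y : 0 < t ->
  (x - y) ^+ 4 * p t x y <= 32 * t ^+ 2 * p (2 * t) x y.
Proof.
move=> t0; rewrite /brownian_density.
have pi0 := pi_gt0 R.
set w := (x - y) ^+ 2 / (4 * t).
have w0 : 0 <= w by rewrite divr_ge0 ?sqr_ge0// mulr_ge0// ltW.
have -> : (x - y) ^+ 2 / (2 * t) = w + w by rewrite /w; field; rewrite gt_eqF.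
have -> : (x - y) ^+ 2 / (2 * (2 * t)) = w by rewrite /w; field; rewrite gt_eqF.
have -> : (x - y) ^+ 4 = 16 * t ^+ 2 * w ^+ 2 by rewrite /w; field; rewrite gt_eqF.
have -> : Num.sqrt (2 * pi * (2 * t)) = Num.sqrt 2 * Num.sqrt (2 * pi * t).
  by rewrite -sqrtrM//; congr Num.sqrt; ring.
(* The square roots reduce this to [1 + w / 4 <= expR (w / 4)]. *)
have e1 : w ^+ 2 * expR (- w) <= 1.
  rewrite expRN; have -> : expR w = expR (w / 2) ^+ 2.
    by rewrite expr2 -expRD -splitr.
  rewrite -exprVn -exprMn expr_le1//; last first.
    by rewrite mulr_ge0// invr_ge0 expR_ge0.
  rewrite ler_pdivrMr ?expR_gt0// mul1r.
  have -> : expR (w / 2) = expR (w / 4) ^+ 2.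
    by rewrite expr2 -expRD; congr expR; lra.
  have : 1 + w / 4 <= expR (w / 4) by exact: expR_ge1Dx.
  move=> H; rewrite (@le_trans _ _ ((1 + w / 4) ^+ 2))//; last first.
    by rewrite ler_pXn2r// ?nnegrE ?expR_ge0// addr_ge0// divr_ge0.
  by have := sqr_ge0 (w / 4 - 1); nra.
have s20 : 0 < Num.sqrt (2 : R) by rewrite sqrtr_gt0.
have s2 : Num.sqrt (2 : R) <= 2.
  by rewrite -[leRHS]ger0_norm// -sqrtr_sqr ler_sqrt// ?exprn_ge0//; lra.
have S0 : 0 < Num.sqrt (2 * pi * t) by rewrite sqrtr_gt0 !mulr_gt0.
rewrite opprD expRD invfM.
set A := (Num.sqrt (2 * pi * t))^-1; set E := expR (- w) in e1 *.
have A0 : 0 < A by rewrite invr_gt0.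
have E0 : 0 < E by exact: expR_gt0.
have -> : 16 * t ^+ 2 * w ^+ 2 * (A * (E * E)) =
  (16 * t ^+ 2 * (A * E)) * (w ^+ 2 * E) by ring.
have -> : 32 * t ^+ 2 * ((Num.sqrt 2)^-1 * A * E) =
  (16 * t ^+ 2 * (A * E)) * (2 / Num.sqrt 2) by ring.
rewrite ler_pM2l ?mulr_gt0// ?exprn_gt0//.
by rewrite (le_trans e1)// ler_pdivlMr// mul1r.
Qed.

End heat_kernel.

(** * Gaussian tails *)

Definition gaussian_tail {R : realType} (r c : R) : R :=
  \int[lebesgue_measure]_(u in `[c, +oo[) brownian_density r 0 u.

Section gaussian_tail.
Variable R : realType.
Local Notation mu := (@lebesgue_measure R).
Local Notation p := (@brownian_density R).
Local Notation tail := (@gaussian_tail R).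
Implicit Types (t r s x y z c : R).

Lemma is_derive_brownian_density t c : 0 < t ->
  is_derive c 1 (p t 0) (- (c / t) * p t 0 c).
Proof.
move=> t0; set k := (Num.sqrt (2 * pi * t))^-1.
have E y : p t 0 y = k * expR (- (2 * t)^-1 * y ^+ 2).
  by rewrite /brownian_density; congr (_ * expR _); rewrite sub0r sqrrN; ring.
rewrite E; have -> : p t 0 = k \*: (expR \o (fun y => (- (2 * t)^-1) * y ^+ 2)).
  by apply/funext => y; rewrite E.
apply: is_derive_eq.
rewrite /GRing.scale/= !mulr1; field.
by rewrite gt_eqF.
Qed.

Lemma continuous_brownian_density t x : 0 < t -> continuous (p t x).
Proof.
move=> t0 y; have -> : p t x = normal_pdf x (Num.sqrt t).
  by apply/funext => u; rewrite brownian_density_normal.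
by apply: continuous_normal_pdf; rewrite gt_eqF ?sqrtr_gt0.
Qed.

Lemma EFin_gaussian_tail r c : 0 < r ->
  (gaussian_tail r c)%:E = (\int[mu]_(u in `[c, +oo[) (p r 0 u)%:E)%E.
Proof.
move=> r0; rewrite /gaussian_tail /Rintegral fineK//.
apply: integrable_fin_num => //.
by apply: (integrableS _ _ (@subsetT _ _)) => //; exact: integrable_brownian_density.
Qed.

Lemma gaussian_tail_ge0 r c : 0 <= tail r c.
Proof. by apply: Rintegral_ge0 => u _; exact: brownian_density_ge0. Qed.

Lemma gaussian_tailE r c : 0 < r ->
  tail r c = 1 - \int[mu]_(u in `]-oo, c]) p r 0 u.
Proof.
move=> r0; have ip := integrable_brownian_density 0 r0.
have : \int[mu]_u p r 0 u = 1 by rewrite /Rintegral integral_brownian_density.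
have -> : [set: R] = `]-oo, c] `|` `]c, +oo[.
  by rewrite -setCitvl setUv.
rewrite Rintegral_setU//=; last first.
- by rewrite -setCitvl; apply/disj_setPS; rewrite setICr.
- by rewrite -setCitvl setUv.
rewrite Rintegral_itv_obnd_cbnd; last first.
  exact: (integrableS _ _ (@subsetT _ _) ip).
by move=> <-; rewrite /gaussian_tail; ring.
Qed.

Lemma gaussian_tail_le1 r c : 0 < r -> tail r c <= 1.
Proof.
move=> r0; rewrite gaussian_tailE// gerBl.
by apply: Rintegral_ge0 => u _; exact: brownian_density_ge0.
Qed.

Lemma is_derive_gaussian_tail r c : 0 < r ->
  is_derive c 1 (tail r) (- p r 0 c).
Proof.
move=> r0; have -> : tail r = (cst 1) - (fun c => \int[mu]_(u in `]-oo, c]) p r 0 u).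
  by apply/funext => u; rewrite gaussian_tailE.
have [||||d e] := @continuous_FTC1 R (p r 0) -oo%O c (c + 1).
- by rewrite ltrDl.
- by apply: (integrableS _ _ (@subsetT _ _)) => //; exact: integrable_brownian_density.
- by rewrite ltNyr.
- exact: continuous_brownian_density.
have ? : is_derive c 1 (fun c => \int[mu]_(u in `]-oo, c]) p r 0 u) (p r 0 c).
  by apply: DeriveDef; [exact: d|rewrite -derive1E; exact: e].
by apply: is_derive_eq; rewrite sub0r.
Qed.

Lemma gaussian_tailN r c : 0 < r -> tail r (- c) = 1 - tail r c.
Proof.
move=> r0; rewrite gaussian_tailE//; congr (1 - _).
apply: EFin_inj.
rewrite [RHS](EFin_gaussian_tail c r0).
rewrite {1}/Rintegral.
rewrite [LHS]fineK; last first.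
  apply: integrable_fin_num => //; apply: (integrableS _ _ (@subsetT _ _)) => //.
  exact: integrable_brownian_density.
rewrite ge0_integration_by_substitutionNy.
- by apply: eq_integral => u _ /=; rewrite brownian_densityN.
- by apply: continuous_subspaceT; exact: continuous_brownian_density.
- by move=> u _; exact: brownian_density_ge0.
Qed.

Lemma gaussian_tail_shift r c z : 0 < r ->
  ((tail r (c - z))%:E = \int[mu]_(u in `[c, +oo[) (p r z u)%:E)%E.
Proof.
move=> r0; rewrite (EFin_gaussian_tail _ r0).
have dF : (fun u : R => u - z)^`()%classic = cst 1.
  by apply/funext => u; rewrite derive1E derive_val subr0.
rewrite (@increasing_ge0_integration_by_substitutiony R (fun u => u - z) (p r 0) c).
- apply: eq_integral => u _ /=.
  by rewrite dF [in RHS]brownian_densityE fctE/= mulr1.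
- by move=> u v _ _; rewrite ltrD2r.
- by rewrite dF => u _; exact: cvg_cst.
- by rewrite dF; exact: is_cvg_cst.
- by rewrite dF; exact: is_cvg_cst.
- split; first by [].
  by apply: cvg_at_right_filter; apply: cvgB => //; exact: cvg_cst.
- exact: cvg_addrr.
- by apply: continuous_subspaceT; exact: continuous_brownian_density.
- by move=> u _; exact: brownian_density_ge0.
Qed.

Lemma gaussian_tail_le r c : 0 < r -> 0 < c -> tail r c <= 32 * r ^+ 2 / c ^+ 4.
Proof.
move=> r0 c0; have r20 : 0 < 2 * r by rewrite mulr_gt0.
apply: (@le_trans _ _ (\int[mu]_(u in `[c, +oo[) (32 * r ^+ 2 / c ^+ 4 * p (2 * r) 0 u))).
  apply: le_Rintegral => //.
  - apply: (integrableS _ _ (@subsetT _ _)) => //; exact: integrable_brownian_density.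
  - apply: integrable_realZl => //.
    apply: (integrableS _ _ (@subsetT _ _)) => //; exact: integrable_brownian_density.
  - move=> u; rewrite /= in_itv/= andbT => cu.
    rewrite mulrAC ler_pdivlMr ?exprn_gt0// mulrC.
    apply: le_trans (@brownian_density_pow4 R r 0 u r0).
    rewrite ler_wpM2r ?brownian_density_ge0//.
    have -> : (0 - u) ^+ 4 = u ^+ 4 by ring.
    by rewrite ler_pXn2r// nnegrE ltW// (lt_le_trans c0).
rewrite RintegralZl//; last first.
  apply: (integrableS _ _ (@subsetT _ _)) => //; exact: integrable_brownian_density.
rewrite ler_piMr ?gaussian_tail_le1//.
by rewrite divr_ge0// ?exprn_ge0// ?mulr_ge0 ?exprn_ge0// ltW.
Qed.

(** The constant does not depend on [r], because the density at distance [c] from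
    its centre is at most [1 / c]. *)
Lemma gaussian_tail_lipschitz r a e : 0 < r -> 0 < a ->
  `|tail r (a - e) - tail r (a + e)| <= 4 * `|e| / a.
Proof.
move=> r0; wlog e0 : e / 0 <= e => [H a0|a0].
  have [/H|e0] := leP 0 e; first exact.
  by have := H (- e); rewrite opprK normrN distrC; apply => //; rewrite oppr_ge0 ltW.
have le1 u v : `|tail r u - tail r v| <= 1.
  rewrite ler_norml; have := gaussian_tail_ge0 r u; have := gaussian_tail_ge0 r v.
  have := gaussian_tail_le1 u r0; have := gaussian_tail_le1 v r0; lra.
rewrite (ger0_norm e0); have [ae|ea] := leP (a / 2) e.
  by rewrite (le_trans (le1 _ _))// ler_pdivlMr//; lra.
have [->|en0] := eqVneq e 0; first by rewrite subr0 addr0 subrr normr0 mulr0 mul0r.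
have {en0}e0 : 0 < e by rewrite lt_neqAle eq_sym en0.
have [|||c] := @MVT R (tail r) (fun u => - p r 0 u) (a - e) (a + e).
- by rewrite ltrD2l; lra.
- by move=> u _; exact: is_derive_gaussian_tail.
- apply: derivable_within_continuous => u _.
  by have /@ex_derive := is_derive_gaussian_tail u r0.
rewrite in_itv/= => /andP[ac ca] E.
rewrite distrC E.
have c0 : a / 2 < c by lra.
have pc : p r 0 c <= 2 / a.
  have := ler_dist_brownian_density c r0.
  have := brownian_density_ge0 r 0 c.
  rewrite ler_pdivlMr//; nra.
have -> : a + e - (a - e) = 2 * e by ring.
rewrite normrM normrN (ger0_norm (brownian_density_ge0 _ _ _)) ger0_norm; last lra.
have -> : 4 * e / a = 2 / a * (2 * e) by ring.
by rewrite ler_wpM2r//; lra.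
Qed.

Lemma continuous_gaussian_tail r : 0 < r -> continuous (tail r).
Proof.
move=> r0 c; apply: differentiable_continuous; apply/derivable1_diffP.
by have /@ex_derive := is_derive_gaussian_tail c r0.
Qed.

Lemma cvgy0_le_inv (f : R -> R) k : (forall u, 1 <= u -> `|f u| <= k / u) ->
  f u @[u --> +oo] --> 0.
Proof.
move=> fk; apply/cvgr0Pnorm_le => e e0; near=> u.
have u1 : 1 <= u by near: u; exact: nbhs_pinfty_ge.
rewrite (le_trans (fk u u1))// ler_pdivrMr ?(lt_le_trans ltr01)// mulrC.
by rewrite -ler_pdivrMr//; near: u; apply: nbhs_pinfty_ge; rewrite num_real.
Unshelve. all: by end_near. Qed.

(** By the antiderivative [v * tail r v - r * p r 0 v]. *)
Lemma integral_gaussian_tail r b z : 0 < r ->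
  (\int[mu]_(u in `[b, +oo[) (tail r (u - z))%:E =
   (r * p r 0 (b - z) - (b - z) * tail r (b - z))%:E)%E.
Proof.
move=> r0; pose F u := (u - z) * tail r (u - z) - r * p r 0 (u - z).
have sub1 (u : R) : is_derive u 1 (fun u : R => u - z) 1.
  by apply: is_derive_eq; rewrite subr0.
have dt (u : R) := @is_derive1_comp R (tail r) (fun u => u - z) u _ _
  (is_derive_gaussian_tail (u - z) r0) (sub1 u).
have dF (u : R) : is_derive u 1 F (tail r (u - z)).
  have ? := dt u.
  have dp := @is_derive1_comp R (p r 0) (fun u => u - z) u _ _
    (is_derive_brownian_density (u - z) r0) (sub1 u).
  have -> : F = (fun u : R => u - z) * (tail r \o (fun u => u - z)) -
     r \*: (p r 0 \o (fun u => u - z)) by [].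
  apply: is_derive_eq; rewrite /GRing.scale/=; field.
  by rewrite gt_eqF.
have bF c : 1 <= c -> `|c * tail r c - r * p r 0 c| <= (32 * r ^+ 2 + r) / c.
  move=> c1; have c0 : 0 < c by rewrite (lt_le_trans _ c1).
  have := gaussian_tail_le r0 c0; have := gaussian_tail_ge0 r c.
  have := brownian_density_ge0 r 0 c.
  have : p r 0 c <= c^-1 by rewrite -[leRHS]mul1r ler_pdivlMr// mulrC ler_dist_brownian_density.
  move=> /(ler_wpM2l (ltW r0)) /[swap] /(mulr_ge0 (ltW r0)) rp0 rp1.
  move=> /(mulr_ge0 (ltW c0)) t0 /(ler_wpM2l (ltW c0)) t1.
  have t2 : c * (32 * r ^+ 2 / c ^+ 4) <= 32 * r ^+ 2 / c.
    have -> : c * (32 * r ^+ 2 / c ^+ 4) = 32 * r ^+ 2 / c * (c ^- 2).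
      by field; rewrite gt_eqF.
    rewrite ler_piMr//; last by rewrite invf_le1 ?exprn_gt0// exprn_ege1.
    by rewrite divr_ge0 ?(ltW c0)// mulr_ge0 ?sqr_ge0.
  rewrite mulrDl ler_norml; lra.
rewrite (@ge0_continuous_FTC2y R (fun u => tail r (u - z)) F b 0).
- by rewrite /F -EFinB; congr (_ %:E); ring.
- by move=> u _; exact: gaussian_tail_ge0.
- apply: continuous_subspaceT => u; apply: differentiable_continuous.
  by apply/derivable1_diffP; have /@ex_derive := dt u.
- exact: (cvg_comp (fun u => u - z) _ (cvg_addrr _) (cvgy0_le_inv bF)).
- by move=> u _; have /@ex_derive := dF u.
- apply: cvg_at_right_filter.
  by apply: differentiable_continuous; apply/derivable1_diffP; have /@ex_derive := dF b.
- by move=> u _; rewrite derive1E; have /@derive_val := dF u.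
Qed.

End gaussian_tail.

(** * Gaussian means and the heat equation *)

Lemma tonelli_on d1 d2 (T1 : measurableType d1) (T2 : measurableType d2)
    (R : realType) (m1 : {sigma_finite_measure set T1 -> \bar R})
    (m2 : {sigma_finite_measure set T2 -> \bar R}) (A : set T1) (B : set T2)
    (f : T1 -> T2 -> \bar R) :
  measurable A -> measurable B ->
  measurable_fun (A `*` B) (fun q => f q.1 q.2) ->
  (forall x y, A x -> B y -> (0 <= f x y)%E) ->
  (\int[m1]_(x in A) \int[m2]_(y in B) f x y =
   \int[m2]_(y in B) \int[m1]_(x in A) f x y)%E.
Proof.
move=> mA mB mf f0; have mAB : measurable (A `*` B) by exact: measurableX.
pose g := (fun q : T1 * T2 => f q.1 q.2) \_ (A `*` B).
have mg : measurable_fun setT g by exact/(measurable_restrictT _ mAB).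
have g0 q : (0 <= g q)%E.
  rewrite /g patchE; case: ifPn => //; rewrite inE => -[? ?]; exact: f0.
transitivity (\int[m1]_x \int[m2]_y g (x, y))%E.
  rewrite integral_mkcond; apply: eq_integral => x _; rewrite patchE.
  case: ifPn => [|]; rewrite ?inE ?notin_setE => Ax.
    rewrite integral_mkcond; apply: eq_integral => y _.
    rewrite /g !patchE; congr (if _ then _ else _).
    by apply/idP/idP; rewrite !inE//=; tauto.
  rewrite integral0_eq// => y _; rewrite /g patchE ifF//.
  by apply/negbTE; rewrite notin_setE => -[].
rewrite fubini_tonelli//.
rewrite [in RHS]integral_mkcond; apply: eq_integral => y _; rewrite patchE.
case: ifPn => [|]; rewrite ?inE ?notin_setE => By.
  rewrite [in RHS]integral_mkcond; apply: eq_integral => x _.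
  rewrite /g !patchE; congr (if _ then _ else _).
  by apply/idP/idP; rewrite !inE//=; tauto.
rewrite integral0_eq// => x _; rewrite /g patchE ifF//.
by apply/negbTE; rewrite notin_setE => -[].
Qed.

Lemma measurable_integral_on d1 d2 (T1 : measurableType d1)
    (T2 : measurableType d2) (R : realType)
    (m1 : {sigma_finite_measure set T1 -> \bar R}) (A : set T1) (B : set T2)
    (f : T1 -> T2 -> \bar R) :
  measurable A -> measurable B ->
  measurable_fun (A `*` B) (fun q => f q.1 q.2) ->
  (forall x y, A x -> B y -> (0 <= f x y)%E) ->
  measurable_fun B (fun y => \int[m1]_(x in A) f x y)%E.
Proof.
move=> mA mB mf f0; have mAB : measurable (A `*` B) by exact: measurableX.
pose g := (fun q : T1 * T2 => f q.1 q.2) \_ (A `*` B).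
have mg : measurable_fun setT g by exact/(measurable_restrictT _ mAB).
have g0 q : (0 <= g q)%E.
  rewrite /g patchE; case: ifPn => //; rewrite inE => -[? ?]; exact: f0.
have := @measurable_fun_fubini_tonelli_G _ _ _ _ _ m1 g mg g0.
move=> /(measurable_funTS (D := B)); apply: eq_measurable_fun => y /[!inE] By.
rewrite /fubini_G [in RHS]integral_mkcond; apply: eq_integral => x _.
rewrite /g !patchE; congr (if _ then _ else _).
by apply/idP/idP; rewrite !inE//=; tauto.
Qed.

Section gaussian_mean.
Variable R : realType.
Local Notation mu := (@lebesgue_measure R).
Local Notation p := (@brownian_density R).
Local Notation tail := (@gaussian_tail R).
Implicit Types (t r s x y z c d a b : R) (f g : R -> R).

(** [f] is integrable with mean [l] under the Gaussian law of centre [z] and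
    variance [d]; for [f] the value at remaining time [r] of a solution of the
    backward heat equation, [l] is its value at remaining time [r + d]. *)
Definition gaussian_mean d z f l : Prop :=
  mu.-integrable setT (fun y => (p d z y * f y)%:E) /\
  \int[mu]_y (p d z y * f y) = l.

Lemma gaussian_mean_ge0 d z f l : measurable_fun setT f ->
  (forall y, 0 <= f y) -> (\int[mu]_y (p d z y * f y)%:E = l%:E)%E ->
  gaussian_mean d z f l.
Proof.
move=> mf f0 fl; split; last by rewrite /Rintegral fl.
apply/integrableP; split.
  by apply/measurable_EFinP/measurable_funM => //; exact: measurable_brownian_density.
under eq_integral do rewrite /= ger0_norm ?mulr_ge0 ?brownian_density_ge0//.
by rewrite fl ltry.
Qed.

Lemma gaussian_meanZ d z f l k :
  gaussian_mean d z f l -> gaussian_mean d z (fun y => k * f y) (k * l).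
Proof.
case=> intf <-; rewrite /gaussian_mean; under eq_fun do rewrite mulrCA.
split; first exact: integrable_realZl.
by under eq_Rintegral do rewrite mulrCA; rewrite RintegralZl.
Qed.

Lemma gaussian_meanD d z f g l m :
  gaussian_mean d z f l -> gaussian_mean d z g m ->
  gaussian_mean d z (fun y => f y + g y) (l + m).
Proof.
case=> intf <- [intg <-]; rewrite /gaussian_mean; under eq_fun do rewrite mulrDr.
split; first exact: integrable_realD.
by under eq_Rintegral do rewrite mulrDr; rewrite RintegralD.
Qed.

Lemma gaussian_meanB d z f g l m :
  gaussian_mean d z f l -> gaussian_mean d z g m ->
  gaussian_mean d z (fun y => f y - g y) (l - m).
Proof.
move=> fl /(gaussian_meanZ (-1)) gm; have := gaussian_meanD fl gm.
by rewrite mulN1r; under [X in gaussian_mean _ _ X _]eq_fun do rewrite mulN1r.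
Qed.

Lemma gaussian_mean_cst d z k : 0 < d -> gaussian_mean d z (cst k) k.
Proof.
move=> d0; rewrite -[X in gaussian_mean _ _ _ X]mulr1.
have -> : cst k = (fun y : R => k * cst 1 y) by apply/funext => y; rewrite mulr1.
apply: gaussian_meanZ; apply: gaussian_mean_ge0 => //.
by under eq_integral do rewrite mulr1; exact: integral_brownian_density.
Qed.

Lemma gaussian_mean_sum d z (F : nat -> R -> R) (l : nat -> R) n : 0 < d ->
  (forall j, gaussian_mean d z (F j) (l j)) ->
  gaussian_mean d z (fun y => \sum_(j < n) F j y) (\sum_(j < n) l j).
Proof.
move=> d0 Fl; elim: n => [|n IH].
  by rewrite big_ord0; under [X in gaussian_mean _ _ X _]eq_fun do rewrite big_ord0;
    exact: gaussian_mean_cst.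
rewrite big_ord_recr /=.
under [X in gaussian_mean _ _ X _]eq_fun do rewrite big_ord_recr /=.
exact: gaussian_meanD.
Qed.

Lemma measurable_brownian_density2 t :
  measurable_fun setT (fun q : R * R => p t q.1 q.2).
Proof.
apply: measurable_funM => //; apply: measurableT_comp => //.
apply: measurableT_comp => //; apply: measurable_funM => //.
by apply: measurable_funX; apply: measurable_funB.
Qed.

Lemma measurable_gaussian_tail r : 0 < r -> measurable_fun setT (tail r).
Proof. by move=> r0; apply: continuous_measurable_fun; exact: continuous_gaussian_tail. Qed.

(** A tail is an integral of kernels, to which the Chapman-Kolmogorov equation
    applies. *)
Lemma gaussian_mean_tail_sub d r z c : 0 < d -> 0 < r ->
  gaussian_mean d z (fun y => tail r (c - y)) (tail (r + d) (c - z)).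
Proof.
move=> d0 r0; apply: gaussian_mean_ge0.
- by apply: measurableT_comp; [exact: measurable_gaussian_tail|exact: measurable_funB].
- by move=> y; exact: gaussian_tail_ge0.
under eq_integral => y _.
  rewrite EFinM gaussian_tail_shift// -ge0_integralZl_EFin//; last 3 first.
  - by move=> u _; rewrite lee_fin brownian_density_ge0.
  - apply/measurable_EFinP; apply: measurable_funTS; exact: measurable_brownian_density.
  - exact: brownian_density_ge0.
  under eq_integral do rewrite -EFinM.
  over.
rewrite (@tonelli_on _ _ _ _ _ mu mu _ _ (fun y u => (p d z y * p r y u)%:E))//.
- rewrite gaussian_tail_shift ?addr_gt0//; apply: eq_integral => u _.
  by rewrite chapman_kolmogorov// addrC.
- apply: measurable_funTS; apply/measurable_EFinP/measurable_funM.
    apply: (@measurableT_comp _ _ _ _ _ _ (p d z) _ fst) => //.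
    exact: measurable_brownian_density.
  exact: measurable_brownian_density2.
- by move=> y u _ _; rewrite lee_fin mulr_ge0 ?brownian_density_ge0.
Qed.

Lemma gaussian_mean_tail d r z c e : 0 < d -> 0 < r -> e = 1 \/ e = -1 ->
  gaussian_mean d z (fun y => tail r (c + e * y)) (tail (r + d) (c + e * z)).
Proof.
move=> d0 r0 [->|->]; last first.
  rewrite mulN1r; under [X in gaussian_mean _ _ X _]eq_fun do rewrite mulN1r.
  exact: gaussian_mean_tail_sub.
have E s u : 0 < s -> tail s (c + 1 * u) = 1 - tail s (- c - u).
  by move=> s0; rewrite -gaussian_tailN// opprB opprK mul1r addrC.
rewrite E ?addr_gt0//; under [X in gaussian_mean _ _ X _]eq_fun do rewrite E//.
by apply: gaussian_meanB; [exact: gaussian_mean_cst|exact: gaussian_mean_tail_sub].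
Qed.

Lemma gaussian_mean_density d r z c : 0 < d -> 0 < r ->
  gaussian_mean d z (fun y => p r y c) (p (r + d) z c).
Proof.
move=> d0 r0; apply: gaussian_mean_ge0.
- under eq_fun do rewrite brownian_density_sym; exact: measurable_brownian_density.
- by move=> y; exact: brownian_density_ge0.
- by rewrite chapman_kolmogorov// addrC.
Qed.

(** Since [(b + e z) tail (b + e z)] is [r] times a heat kernel minus the
    integral of a tail, its Gaussian mean differs from that of a solution of the
    heat equation by [d] times the kernel. *)
Lemma gaussian_mean_mul_tail d r z b e : 0 < d -> 0 < r -> e = 1 \/ e = -1 ->
  gaussian_mean d z (fun y => (b + e * y) * tail r (b + e * y))
    ((b + e * z) * tail (r + d) (b + e * z) - d * p (r + d) 0 (b + e * z)).
Proof.
move=> d0 r0 e1; have rd0 : 0 < r + d by rewrite addr_gt0.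
pose H s u := s * p s 0 (b + e * u) - (b + e * u) * tail s (b + e * u).
have HE s u : 0 < s ->
    ((H s u)%:E = \int[mu]_(v in `[b, +oo[) (tail s (v + e * u))%:E)%E.
  move=> s0; have := integral_gaussian_tail b (- e * u) s0.
  by under eq_integral do rewrite mulNr opprK; rewrite mulNr opprK => ->.
have H0 s u : 0 < s -> 0 <= H s u.
  move=> s0; rewrite -lee_fin HE// integral_ge0// => v _.
  by rewrite lee_fin gaussian_tail_ge0.
have mlin : measurable_fun setT (fun y : R => b + e * y).
  by apply: measurable_funD => //; exact: measurable_funM.
have GH : gaussian_mean d z (H r) (H (r + d) z).
  apply: gaussian_mean_ge0.
  - apply: measurable_funB; apply: measurable_funM => //.
      by apply: measurableT_comp; [exact: measurable_brownian_density|].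
    by apply: measurableT_comp; [exact: measurable_gaussian_tail|].
  - by move=> y; exact: H0.
  under eq_integral => y _.
    rewrite EFinM HE// -ge0_integralZl_EFin//; last 3 first.
    - by move=> u _; rewrite lee_fin gaussian_tail_ge0.
    - apply/measurable_EFinP; apply: measurable_funTS.
      apply: measurableT_comp; [exact: measurable_gaussian_tail|].
      exact: measurable_funD.
    - exact: brownian_density_ge0.
    under eq_integral do rewrite -EFinM.
    over.
  rewrite (@tonelli_on _ _ _ _ _ mu mu _ _
    (fun y u => (p d z y * tail r (u + e * y))%:E))//.
  - rewrite HE//; apply: eq_integral => u _.
    have [intT <-] := gaussian_mean_tail z u d0 r0 e1.
    by rewrite /Rintegral fineK// integrable_fin_num.
  - apply: measurable_funTS; apply/measurable_EFinP/measurable_funM.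
      apply: (@measurableT_comp _ _ _ _ _ _ (p d z) _ fst) => //.
      exact: measurable_brownian_density.
    apply: (@measurableT_comp _ _ _ _ _ _ (tail r)); first exact: measurable_gaussian_tail.
    by apply: measurable_funD => //; exact: measurable_funM.
  - by move=> y u _ _; rewrite lee_fin mulr_ge0 ?brownian_density_ge0 ?gaussian_tail_ge0.
have pE s u : p s 0 (b + e * u) = p s u (- e * b).
  rewrite brownian_densityE [RHS]brownian_densityE subr0.
  case: e1 => ->; last by congr p; ring.
  by rewrite -brownian_densityN; congr p; ring.
have := gaussian_meanB (gaussian_meanZ r (gaussian_mean_density z (- e * b) d0 r0)) GH.
rewrite /H; under [X in gaussian_mean _ _ X _]eq_fun do rewrite -pE subKr.
by rewrite -pE; congr gaussian_mean; ring.
Qed.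

End gaussian_mean.

(** * The solution by images *)

(** Here [s] is the position relative to the centre of the interval [(-h, h)],
    and [b] the position of the target. The first term solves
    [dv/dr = v''/2 + p_r(s, b)] and vanishes at [s = h]; each term of the sum
    solves the heat equation, and is odd under reflection in [s = h]. *)
Definition barrier {R : realType} (h : R) (J : nat) (b r s : R) : R :=
  (h - s) * gaussian_tail r (b - s) -
  2 * h * \sum_(j < J) (gaussian_tail r (b + (4 * j%:R + 2) * h + s) -
                        gaussian_tail r (b + (4 * j%:R + 4) * h - s)).

Section barrier.
Variable R : realType.
Local Notation p := (@brownian_density R).
Local Notation tail := (@gaussian_tail R).
Implicit Types (t r s x y z a b c d e h : R) (J : nat).

Lemma gaussian_tail_nonincreasing r : 0 < r -> {homo tail r : a b / a <= b >-> b <= a}.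
Proof.
move=> r0 a b; rewrite le_eqVlt => /predU1P[->//|ab].
have [|||c] := @MVT R (tail r) (fun u => - p r 0 u) a b => //.
- by move=> u _; exact: is_derive_gaussian_tail.
- apply: derivable_within_continuous => u _.
  by have /@ex_derive := is_derive_gaussian_tail u r0.
move=> _ E; rewrite -subr_le0 E mulr_le0_ge0 ?oppr_le0 ?brownian_density_ge0//.
by rewrite subr_ge0 ltW.
Qed.

(** Duhamel's formula over a time step [d]. The mean of the source over the step
    does not depend on when it is emitted, hence the factor [d]. The sign [e]
    turns the axis so that the target [x + e * b] has coordinate [b]. *)
Lemma gaussian_mean_barrier h J b d r x z e : 0 < d -> 0 < r -> e = 1 \/ e = -1 ->
  gaussian_mean d z (fun y => barrier h J b r (e * (y - x)))
    (barrier h J b (r + d) (e * (z - x)) - d * p (r + d) z (x + e * b)).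
Proof.
move=> d0 r0 e1; have rd0 : 0 < r + d by rewrite addr_gt0.
have eN1 : - e = 1 \/ - e = -1 by case: e1 => ->; [right|left]; rewrite ?opprK.
have E1 u : b - e * (u - x) = b + e * x + (- e) * u by ring.
have E2 j u : b + (4 * j%:R + 2) * h + e * (u - x) =
  b + (4 * j%:R + 2) * h - e * x + e * u by ring.
have E3 j u : b + (4 * j%:R + 4) * h - e * (u - x) =
  b + (4 * j%:R + 4) * h + e * x + (- e) * u by ring.
have pE : p (r + d) z (x + e * b) = p (r + d) 0 (b + e * x + (- e) * z).
  rewrite brownian_densityE; case: e1 => ->; first by congr p; ring.
  by rewrite -brownian_densityN; congr p; ring.
have G1 := gaussian_meanB
  (gaussian_mean_mul_tail z (b + e * x) d0 r0 eN1)
  (gaussian_meanZ (b - h) (gaussian_mean_tail z (b + e * x) d0 r0 eN1)).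
pose F j u := tail r (b + (4 * (j%:R : R) + 2) * h - e * x + e * u) -
  tail r (b + (4 * j%:R + 4) * h + e * x + (- e) * u).
pose l (j : nat) := tail (r + d) (b + (4 * (j%:R : R) + 2) * h - e * x + e * z) -
  tail (r + d) (b + (4 * j%:R + 4) * h + e * x + (- e) * z).
have G2 : forall j, gaussian_mean d z (F j) (l j).
  by move=> j; apply: gaussian_meanB; exact: gaussian_mean_tail.
have := gaussian_meanB G1 (gaussian_meanZ (2 * h) (gaussian_mean_sum J d0 G2)).
congr gaussian_mean.
  apply/funext => u; rewrite /barrier.
  under [in RHS]eq_bigr do rewrite E2 E3.
  by rewrite E1 /F; congr (_ - _); ring.
rewrite /barrier pE; under [in RHS]eq_bigr do rewrite E2 E3.
by rewrite E1 /l; ring.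
Qed.

Lemma measurable_barrier h J b r : 0 < r -> measurable_fun setT (barrier h J b r).
Proof.
move=> r0; have mt (f : R -> R) : measurable_fun setT f -> measurable_fun setT (tail r \o f).
  by move=> ?; apply: measurableT_comp => //; exact: measurable_gaussian_tail.
apply: measurable_funB; apply: measurable_funM => //.
- exact: measurable_funB.
- by apply: mt; exact: measurable_funB.
- apply: measurable_sum => j; apply: measurable_funB; apply: mt.
    exact: measurable_funD.
  exact: measurable_funB.
Qed.

(** The barrier vanishes at [s = h] by symmetry of the summands, and at
    [s = - h] because the sum telescopes, up to its last term. *)
Lemma barrier_near_boundary h J b r s : 0 < h -> h <= b -> 0 < r ->
  `|barrier h J b r s| <= (9 + 8 * J%:R) * `| `|s| - h| +
    2 * h * tail r (b + (4 * J%:R + 1) * h).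
Proof.
move=> h0 hb r0; have h20 : 0 <= 2 * h by rewrite mulr_ge0// ltW.
have lip a u : h <= a -> `|tail r (a + u) - tail r (a - u)| <= 4 * `|u| / h.
  move=> ha; have a0 : 0 < a by rewrite (lt_le_trans h0).
  rewrite distrC (le_trans (gaussian_tail_lipschitz u r0 a0))//.
  by rewrite ler_wpM2l ?mulr_ge0// lef_pV2 ?posrE.
have sumlip (F : nat -> R) u : (forall j, h <= F j) ->
    `|2 * h * \sum_(j < J) (tail r (F j + u) - tail r (F j - u))| <= 8 * J%:R * `|u|.
  move=> hF; rewrite normrM (ger0_norm h20).
  have : `|\sum_(j < J) (tail r (F j + u) - tail r (F j - u))| <= J%:R * (4 * `|u| / h).
    rewrite (le_trans (ler_norm_sum _ _ _))//.
    apply: (@le_trans _ _ (\sum_(j < J) (4 * `|u| / h))); last first.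
      by rewrite sumr_const card_ord [leRHS]mulr_natl.
    by apply: ler_sum => j _; exact: (lip (F j) u (hF j)).
  move=> /(ler_wpM2l h20)/le_trans; apply.
  by rewrite le_eqVlt; apply/orP; left; apply/eqP; field; rewrite gt_eqF.
have t0 u := gaussian_tail_ge0 r u; have t1 u := gaussian_tail_le1 u r0.
have tn u e : `|e * tail r u| <= `|e|.
  by rewrite normrM ler_piMr// ger0_norm.
have J0 : 0 <= J%:R :> R by [].
have hk (k : nat) c : 0 <= c -> h <= b + (4 * k%:R + c) * h.
  by move=> c0; rewrite (le_trans hb)// lerDl mulr_ge0 ?(ltW h0)// addr_ge0// mulr_ge0.
have [s0|s0] := leP 0 s.
  (* Near [s = h] each summand is odd in [e]. *)
  set e := s - h.
  have -> : barrier h J b r s = (- e) * tail r (b - s) -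
      2 * h * \sum_(j < J) (tail r (b + (4 * j%:R + 3) * h + e) -
                            tail r (b + (4 * j%:R + 3) * h - e)).
    rewrite /barrier; congr (_ * _ - _ * _); first by rewrite /e; ring.
    by apply: eq_bigr => j _; congr (tail _ _ - tail _ _); rewrite /e; ring.
  rewrite (le_trans (ler_normB _ _))//.
  have := sumlip (fun j => b + (4 * j%:R + 3) * h) e (fun j => hk j 3 (ler0n _ _)).
  have := tn (b - s) (- e); rewrite normrN (ger0_norm s0) -/e.
  have := mulr_ge0 h20 (t0 (b + (4 * J%:R + 1) * h)); have := normr_ge0 e.
  by rewrite mulrDl; lra.
(* Near [s = - h] the sum is compared with its telescoping value at [e = 0]. *)
set e := s + h.
pose B j := b + (4 * (j%:R : R) + 1) * h.
have -> : barrier h J b r s = (- e) * tail r (b - s) -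
    2 * h * \sum_(j < J) (tail r (B j + e) - tail r (B j - e)) + 2 * h * tail r (B J - e).
  have : \sum_(j < J) (tail r (B j.+1 - e) - tail r (B j - e)) =
      tail r (B J - e) - tail r (B 0 - e).
    by rewrite -(big_mkord xpredT (fun j => tail r (B j.+1 - e) - tail r (B j - e)))
       telescope_sumr.
  rewrite sumrB => H.
  rewrite /barrier !sumrB.
  have -> : \sum_(j < J) tail r (b + (4 * j%:R + 2) * h + s) = \sum_(j < J) tail r (B j + e).
    by apply: eq_bigr => j _; congr tail; rewrite /B /e; ring.
  have -> : \sum_(j < J) tail r (b + (4 * j%:R + 4) * h - s) = \sum_(j < J) tail r (B j.+1 - e).
    by apply: eq_bigr => j _; congr tail; rewrite /B /e -natr1; ring.
  have -> : b - s = B 0 - e by rewrite /B /e; ring.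
  have -> : \sum_(j < J) tail r (B j.+1 - e) =
     \sum_(j < J) tail r (B j - e) + (tail r (B J - e) - tail r (B 0 - e)) by rewrite -H; ring.
  by rewrite /e; ring.
have -> : `| `|s| - h| = `|e| by rewrite (ltr0_norm s0) -opprD normrN.
have H1 := sumlip B e (fun j => hk j 1 ler01).
have H2 := tn (b - s) (- e); rewrite normrN in H2.
have H3 : 2 * h * tail r (B J - e) <= 2 * h * tail r (B J) + 8 * `|e|.
  have : tail r (B J - e) <= tail r (B J) + 4 * `|e| / h.
    have := lip (B J) e (hk J 1 ler01); rewrite ler_norml => /andP[+ _].
    have [e0|e0] := leP 0 e.
      have : tail r (B J + e) <= tail r (B J).
        by apply: gaussian_tail_nonincreasing => //; rewrite lerDl.
      lra.
    have : tail r (B J - e) <= tail r (B J).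
      by apply: gaussian_tail_nonincreasing => //; lra.
    have : 0 <= 4 * `|e| / h by rewrite divr_ge0 ?mulr_ge0// ltW.
    lra.
  move=> /(ler_wpM2l h20)/le_trans; apply.
  by rewrite le_eqVlt; apply/orP; left; apply/eqP; field; rewrite gt_eqF.
have H4 : 0 <= 2 * h * tail r (B J - e) by rewrite !mulr_ge0// ltW.
rewrite (le_trans (ler_normD _ _))//.
have H5 := ler_normB ((- e) * tail r (b - s)) 
  (2 * h * \sum_(j < J) (tail r (B j + e) - tail r (B j - e))).
rewrite (ger0_norm H4) -/(B J).
have := normr_ge0 e; rewrite (mulrDl 9). lra.
Qed.

(** Away from the endpoints every tail is taken at distance at least [h - a] from
    its centre. *)
Lemma barrier_small_time h J b r s a : 0 < r -> a < h -> h <= b -> `|s| <= a ->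
  `|barrier h J b r s| <= 2 * h * (1 + 2 * J%:R) * (32 / (h - a) ^+ 4) * r ^+ 2.
Proof.
move=> r0 ah hb; rewrite ler_norml => /andP[as1 sa].
have ha0 : 0 < h - a by rewrite subr_gt0.
have h0 : 0 < h by lra.
pose k := 32 / (h - a) ^+ 4 * r ^+ 2.
have t0 u := gaussian_tail_ge0 r u.
have tk u : h - a <= u -> tail r u <= k.
  move=> hu; have u0 : 0 < u by rewrite (lt_le_trans ha0).
  rewrite (le_trans (gaussian_tail_le r0 u0))// /k mulrAC.
  rewrite ler_wpM2r ?sqr_ge0// ler_pM2l// lef_pV2 ?posrE ?exprn_gt0//.
  by rewrite ler_pXn2r// nnegrE ltW.
have hk (j : nat) c : 0 <= c -> b <= b + (4 * j%:R + c) * h.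
  by move=> c0; rewrite lerDl mulr_ge0 ?(ltW h0)// addr_ge0// mulr_ge0.
have S : `|\sum_(j < J) (tail r (b + (4 * j%:R + 2) * h + s) -
    tail r (b + (4 * j%:R + 4) * h - s))| <= J%:R * (2 * k).
  rewrite (le_trans (ler_norm_sum _ _ _))//.
  apply: (@le_trans _ _ (\sum_(j < J) (2 * k))); last first.
    by rewrite sumr_const card_ord [leRHS]mulr_natl.
  apply: ler_sum => j _; rewrite (le_trans (ler_normB _ _))//.
  rewrite !ger0_norm//.
  have := @tk (b + (4 * j%:R + 2) * h + s); have := @tk (b + (4 * j%:R + 4) * h - s).
  have := hk j 2 (ler0n _ _); have := hk j 4 (ler0n _ _).
  move=> H1 H2 /(_ _)H3 /(_ _)H4.
  have {}H3 := H3 ltac:(lra); have {}H4 := H4 ltac:(lra); lra.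
have H : `|(h - s) * tail r (b - s)| <= 2 * h * k.
  rewrite normrM ger0_norm; last lra.
  rewrite ger0_norm//; apply: ler_pM => //; [lra|lra|].
  by apply: tk; lra.
rewrite /barrier (le_trans (ler_normB _ _))// [X in _ + X]normrM.
rewrite (@ger0_norm _ (2 * h)); last by rewrite mulr_ge0// ltW.
have -> : 2 * h * (1 + 2 * J%:R) * (32 / (h - a) ^+ 4) * r ^+ 2 =
  2 * h * k + 2 * h * (J%:R * (2 * k)) by rewrite /k; ring.
by rewrite lerD// ler_wpM2l// mulr_ge0// ltW.
Qed.

End barrier.

(** * The Markov property for functions of the position *)

Section density.
Local Open Scope ereal_scope.
Context d d' (Omega : measurableType d) (T : measurableType d') (R : realType).
Variables (P : {measure set Omega -> \bar R}) (E : set Omega) (Z : Omega -> T).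
Variables (m : {measure set T -> \bar R}) (D : set T) (rho : T -> \bar R).
Hypothesis mE : measurable E.
Hypothesis mZ : measurable_fun setT Z.
Hypothesis mD : measurable D.
Hypothesis mrho : measurable_fun D rho.
Hypothesis rho0 : forall x, D x -> 0 <= rho x.
Hypothesis rhoP : forall B, measurable B ->
  P (E `&` Z @^-1` B) = \int[m]_(x in D `&` B) rho x.

Import HBNNSimple.

Let integral_density_nnsfun (g : {nnsfun T >-> R}) :
  \int[P]_(w in E) (g (Z w))%:E = \int[m]_(x in D) (rho x * (g x)%:E).
Proof.
under eq_integral do rewrite fimfunE -fsumEFin//.
rewrite ge0_integral_fsum//; last 2 first.
  - move=> r; apply/measurable_EFinP/measurable_funM => //.
    apply: measurable_funTS; apply: (measurableT_comp _ mZ).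
    exact: measurable_indic.
  - by move=> r w _; rewrite EFinM nnfun_muleindic_ge0.
under [RHS]eq_integral => x _.
  rewrite fimfunE -fsumEFin// ge0_mule_fsumr; last first.
    by move=> r; rewrite EFinM nnfun_muleindic_ge0.
  over.
rewrite /= ge0_integral_fsum//; last 2 first.
  - move=> r; apply: emeasurable_funM => //.
    exact/measurable_EFinP/measurableT_comp.
  - by move=> r x Dx; rewrite mule_ge0 ?rho0// EFinM nnfun_muleindic_ge0.
apply: eq_fsbigr => r _.
have [r0|r0] := leP 0%R r; last first.
  rewrite preimage_nnfun0// integral0_eq => [|w _]; last by rewrite indic0 mulr0.
  by rewrite integral0_eq// => x _; rewrite indic0 mulr0 mule0.
under [LHS]eq_integral do rewrite EFinM.
rewrite ge0_integralZl_EFin//; last first.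
  apply/measurable_EFinP; apply: measurable_funTS; apply: (measurableT_comp _ mZ).
  exact: measurable_indic.
under [RHS]eq_integral do rewrite EFinM muleCA.
rewrite ge0_integralZl_EFin//; last 2 first.
- by move=> x Dx; rewrite mule_ge0 ?rho0// lee_fin.
- by apply: emeasurable_funM => //; exact/measurable_EFinP/measurable_funTS.
congr (_ * _).
have mB : measurable (g @^-1` [set r]) by [].
have -> : \int[P]_(w in E) (\1_(g @^-1` [set r]) (Z w))%:E =
    \int[P]_(w in E) (\1_(Z @^-1` (g @^-1` [set r])) w)%:E by [].
rewrite integral_indic//; last by rewrite -[X in measurable X]setTI; exact: mZ.
rewrite setIC rhoP// integral_mkcondr; apply: eq_integral => x _.
by rewrite epatch_indic.
Qed.

(** The change of variables to [Z], on the event [E] only: there the law of [Z] has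
    the density [rho], by [rhoP]. *)
Lemma integral_density (f : T -> R) : measurable_fun setT f ->
  (forall x, (0 <= f x)%R) ->
  \int[P]_(w in E) (f (Z w))%:E = \int[m]_(x in D) (rho x * (f x)%:E).
Proof.
move=> mf f0.
have mEf : measurable_fun setT (EFin \o f) by exact/measurable_EFinP.
pose g := nnsfun_approx measurableT mEf.
have gf x : EFin \o g ^~ x @ \oo --> (f x)%:E.
  by have := cvg_nnsfun_approx measurableT mEf (fun x _ => _ : 0 <= (EFin \o f) x)%E;
    apply => //; rewrite lee_fin.
have gnd x : {homo (fun n => (g n x)%:E) : a b / (a <= b)%N >-> a <= b}.
  by move=> a b ab; rewrite lee_fin; exact/lefP/nd_nnsfun_approx.
transitivity (limn (fun n => \int[P]_(w in E) (g n (Z w))%:E)).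
  rewrite -monotone_convergence//.
  - by apply: eq_integral => w _; apply/esym/cvg_lim => //; exact: gf.
  - move=> n; apply/measurable_EFinP; apply: measurable_funTS.
    by apply: measurableT_comp.
  - by move=> n x _; rewrite lee_fin.
transitivity (limn (fun n => \int[m]_(x in D) (rho x * (g n x)%:E))).
  by congr (lim (_ @ \oo)); apply/funext => n; exact: integral_density_nnsfun.
rewrite -monotone_convergence//; last 3 first.
- move=> n; apply: emeasurable_funM => //.
  by apply/measurable_EFinP; exact: measurable_funTS.
- by move=> n x Dx; rewrite mule_ge0 ?rho0// lee_fin.
- by move=> x Dx a b ab; rewrite lee_wpmul2l ?rho0// gnd.
apply: eq_integral => x /[!inE] Dx; apply/cvg_lim => //.
have [fx0|fx0] := eqVneq (f x) 0%R.
  have gx n : g n x = 0%R.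
    apply/eqP; rewrite eq_le; apply/andP; split=> //.
    rewrite -fx0 -lee_fin -(cvg_lim _ (gf x))//.
    apply: lime_ge; first by apply/cvg_ex; exists (f x)%:E; exact: gf.
    by exists n => // k /= nk; exact: gnd.
  by under eq_cvg do rewrite gx; rewrite fx0; exact: cvg_cst.
apply: cvgeM; [|exact: cvg_cst|exact: gf].
by rewrite mule_defE !negb_or !negb_and/= orbT eqe fx0.
Qed.

End density.

(** The Markov property, stated for events at the later time, extends to
    expectations of functions of the later position. *)
Lemma markov_expectation (R : realType) (q : R -> R -> R -> R) (S : set R) (x : R)
    d (Omega : measurableType d) (P : probability Omega R) (X : R -> Omega -> R)
    (s t : R) (A : set (R -> R)) (f : R -> R) :
  markov_process q S x P X -> measurable S -> 0 <= s -> 0 < t ->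
  past_events s A -> measurable (path_event X A) ->
  measurable_fun (path_event X A `*` S) (fun wz => q t (X s wz.1) wz.2) ->
  (forall w z, path_event X A w -> S z -> 0 <= q t (X s w) z) ->
  measurable_fun setT f -> (forall z, 0 <= f z) ->
  (\int[P]_(w in path_event X A) (f (X (s + t) w))%:E =
   \int[P]_(w in path_event X A)
     \int[lebesgue_measure]_(z in S) (q t (X s w) z * f z)%:E)%E.
Proof.
move=> PX mS s0 t0 pA mA mq q0 mf f0.
set E := path_event X A in mA mq q0 *.
have mqE : measurable_fun (E `*` S) (fun wz => (q t (X s wz.1) wz.2)%:E).
  exact/measurable_EFinP.
have mqfE : measurable_fun (E `*` S) (fun wz => (q t (X s wz.1) wz.2 * f wz.2)%:E).
  apply/measurable_EFinP/measurable_funM => //; apply: measurable_funTS.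
  exact: measurableT_comp.
pose rho z := (\int[P]_(w in E) (q t (X s w) z)%:E)%E.
have mrho : measurable_fun S rho.
  apply: (measurable_integral_on P mA mS mqE) => w z Ew Sz.
  by rewrite lee_fin q0.
rewrite (@integral_density _ _ _ (measurableTypeR R) _ P E (X (s + t)) lebesgue_measure S rho)//.
- rewrite [RHS](@tonelli_on _ _ _ _ _ P lebesgue_measure E S (fun w z => (q t (X s w) z * f z)%:E))//.
  + apply: eq_integral => z /[!inE] Sz; rewrite muleC -ge0_integralZl_EFin//.
    * by apply: eq_integral => w _; rewrite -EFinM mulrC.
    * by move=> w Ew; rewrite lee_fin q0.
    * apply/measurable_EFinP.
      apply: (@measurable_comp _ _ _ _ _ _ (E `*` S)
        (fun wz => q t (X s wz.1) wz.2) E (fun w => (w, z))) => //.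
        exact: measurableX.
        by move=> _ [w Ew <-].
      by apply: measurable_funTS; exact: measurable_fun_pair.
  + by move=> w z Ew Sz; rewrite lee_fin mulr_ge0// q0.
- by apply: (markov_measurable PX); rewrite addr_ge0// ltW.
- by move=> z Sz; apply: integral_ge0 => w Ew; rewrite lee_fin q0.
- move=> B mB; apply: (etrans (markov_transition PX s0 t0 pA mB)); rewrite -/E.
  rewrite (@tonelli_on _ _ _ _ _ P lebesgue_measure E (S `&` B) (fun w z => (q t (X s w) z)%:E))//.
  + exact: measurableI.
  + apply: (measurable_funS _ _ mqE); first exact: measurableX.
    by move=> [w z] [] /= ? [].
  + by move=> w z Ew [Sz _]; rewrite lee_fin q0.
Qed.

(** * Comparison with a smaller kernel *)

Section heat_comparison.
Variable R : realType.
Local Notation mu := (@lebesgue_measure R).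
Local Notation p := (@brownian_density R).
Variables (d z : R) (G V : R -> R) (l e c : R).
Hypothesis d0 : 0 < d.
Hypothesis mG : measurable_fun setT G.
Hypothesis mV : measurable_fun setT V.
Hypothesis Gp : forall u, 0 <= G u <= p d z u.
Hypothesis Vl : gaussian_mean d z V l.
Hypothesis GV : forall u, `|(p d z u - G u) * V u| <=
  e * (p d z u - G u) + c * p (2 * d) z u.

Let intp t : 0 < t -> mu.-integrable setT (fun u => (p t z u)%:E).
Proof. exact: integrable_brownian_density. Qed.

Lemma integrable_subkernel : mu.-integrable setT (fun u => (G u)%:E).
Proof.
apply: (@le_integrable_real _ _ _ mu setT measurableT G (p d z)) => // [u _|].
  by have /andP[G0 G1] := Gp u; rewrite ger0_norm.
exact: intp.
Qed.

Lemma integrable_subkernelM : mu.-integrable setT (fun u => (G u * V u)%:E).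
Proof.
have [iV _] := Vl.
apply: (@le_integrable_real _ _ _ mu setT measurableT _ (fun u => `|p d z u * V u|)).
- exact: measurable_funM.
- move=> u _; have /andP[G0 G1] := Gp u.
  by rewrite !normrM ler_wpM2r// !ger0_norm// (le_trans G0).
- exact: integrable_real_norm iV.
Qed.

(** The mean of [V] under the Gaussian kernel and under [G] differ by the mass that
    [G] loses, weighted by [V]; the loss happens where [V] is at most [e], up to
    an error controlled by [c]. *)
Lemma subkernel_mean_approx :
  `|l - \int[mu]_u (G u * V u)| <= e * (1 - \int[mu]_u G u) + c.
Proof.
have [iV <-] := Vl; have iG := integrable_subkernel; have iGV := integrable_subkernelM.
have d20 : 0 < 2 * d by rewrite mulr_gt0.
rewrite -RintegralB//.
have -> : e * (1 - \int[mu]_u G u) + c =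
    \int[mu]_u (e * (p d z u - G u) + c * p (2 * d) z u).
  rewrite RintegralD//; last 2 first.
  - by apply: integrable_realZl => //; apply: integrable_realB => //; exact: intp.
  - by apply: integrable_realZl => //; exact: intp.
  rewrite [X in _ = X + _]RintegralZl//; last first.
    by apply: integrable_realB => //; exact: intp.
  rewrite [X in _ = _ + X]RintegralZl//; last exact: intp.
  rewrite RintegralB//; last exact: intp.
  by rewrite /Rintegral !integral_brownian_density//= mulr1.
apply: le_trans (le_normr_Rintegral _ _) _ => //.
  exact: integrable_realB.
apply: le_Rintegral => //.
- by apply: integrable_real_norm => //; exact: integrable_realB.
- apply: integrable_realD => //; apply: integrable_realZl => //.
    by apply: integrable_realB => //; exact: intp.
  exact: intp.
- by move=> u _; rewrite -mulrBl GV.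
Qed.

(** Adding the constant [e] makes [V] a supersolution for the smaller kernel
    [G], and subtracting it makes [V] a subsolution. *)
Lemma subkernel_supersolution (U : R -> R) : 0 <= e ->
  (forall u, G u * U u = G u * (V u + e)) -> (forall u, 0 <= G u * U u) ->
  (\int[mu]_u (G u * U u)%:E <= (l + e + c)%:E)%E.
Proof.
move=> e0 GU GU0.
have iG := integrable_subkernel; have iGV := integrable_subkernelM.
have -> : (\int[mu]_u (G u * U u)%:E = (\int[mu]_u (G u * V u + e * G u))%:E)%E.
  rewrite /Rintegral fineK; last first.
    by apply: integrable_fin_num => //; apply: integrable_realD => //;
      exact: integrable_realZl.
  by apply: eq_integral => u _; rewrite GU mulrDr (mulrC e).
rewrite RintegralD//; last exact: integrable_realZl.
rewrite RintegralZl// lee_fin.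
by have := subkernel_mean_approx; rewrite ler_norml; lra.
Qed.

Lemma subkernel_subsolution (U : R -> R) :
  measurable_fun setT U -> (forall u, 0 <= U u) ->
  (forall u, G u * (V u - e) <= G u * U u) ->
  ((l - e - c)%:E <= \int[mu]_u (G u * U u)%:E)%E.
Proof.
move=> mU U0 GU.
have iG := integrable_subkernel; have iGV := integrable_subkernelM.
have iGe : mu.-integrable setT (fun u => (G u * V u - e * G u)%:E).
  by apply: integrable_realB => //; exact: integrable_realZl.
apply: (@le_trans _ _ (\int[mu]_u (G u * V u - e * G u)%:E)%E).
  have -> : (\int[mu]_u (G u * V u - e * G u)%:E =
      (\int[mu]_u (G u * V u - e * G u))%:E)%E.
    by rewrite /Rintegral fineK//; exact: integrable_fin_num.
  rewrite RintegralB//; last exact: integrable_realZl.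
  rewrite RintegralZl// lee_fin.
  by have := subkernel_mean_approx; rewrite ler_norml; lra.
(* The positive part is inserted to stay with nonnegative integrands, as [U] is
   not known to be integrable. *)
have iU : mu.-integrable setT (fun u => (Order.max (G u * V u - e * G u) 0)%:E).
  apply: (@le_integrable_real _ _ _ mu setT measurableT _ (fun u => `|G u * V u - e * G u|)).
  - apply: measurable_maxr => //; apply: measurable_funB; exact: measurable_funM.
  - by move=> u _; rewrite maxElt; case: ifP => _; rewrite ?normr0.
  - exact: integrable_real_norm iGe.
apply: (@le_trans _ _ (\int[mu]_u (Order.max (G u * V u - e * G u) 0)%:E)%E).
  by apply: le_integral => // u _; rewrite lee_fin le_max lexx.
apply: ge0_le_integral => //.
- by move=> u _; rewrite lee_fin le_max lexx orbT.
- by case/integrableP: iU.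
- by apply/measurable_EFinP; exact: measurable_funM.
move=> u _; have /andP[G0 _] := Gp u.
rewrite lee_fin ge_max mulr_ge0// andbT.
by rewrite (le_trans _ (GU u))// mulrBr (mulrC e).
Qed.

End heat_comparison.

(** * Exit from an interval on a time mesh *)

Definition stays_near {R : realType} (x a d : R) (k : nat) : set (R -> R) :=
  [set f | forall j, (j <= k)%N -> `|f (j%:R * d) - x| <= a].

Section stays_near.
Variables (R : realType) (x a d : R).

Lemma stays_nearS k f : stays_near x a d k.+1 f <->
  stays_near x a d k f /\ `|f (k.+1%:R * d) - x| <= a.
Proof.
split=> [H|[H1 H2] j]; first by split=> [j jk|]; apply: H => //; exact: leqW.
by rewrite leq_eqVlt => /predU1P[->//|]; exact: H1.
Qed.

Lemma measurable_dist_le : measurable [set u : R | `|u - x| <= a].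
Proof.
have -> : [set u : R | `|u - x| <= a] = `[x - a, x + a]%classic.
  by apply/seteqP; split=> u /=; rewrite in_itv/= ler_norml; lra.
exact: measurable_itv.
Qed.

Lemma past_events_stays_near k : 0 <= d ->
  past_events (k%:R * d) (stays_near x a d k).
Proof.
move=> d0; have -> : stays_near x a d k = setT `\` \bigcup_j
    (if (j <= k)%N then setT `\` [set f | `|f (j%:R * d) - x| <= a] else set0).
  apply/seteqP; split=> f.
    by move=> H; split=> // -[j _]; case: ifPn => // jk [_]; apply; exact: H.
  move=> [_ H] j jk; apply: contrapT => Hj; apply: H; exists j => //.
  by rewrite jk; split.
apply: sigma_algebraCD; apply: sigma_algebra_bigcup => j.
case: ifPn => jk; last exact: sigma_algebra0.
apply: sigma_algebraCD; apply: sub_sigma_algebra.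
exists (j%:R * d), [set u | `|u - x| <= a]; split => //.
  by rewrite mulr_ge0//= ler_wpM2r// ler_nat.
exact: measurable_dist_le.
Qed.

Lemma measurable_stays_near e (Omega : measurableType e) (X : R -> Omega -> R) k :
  (forall j, (j <= k)%N -> measurable_fun setT (X (j%:R * d))) ->
  measurable (path_event X (stays_near x a d k)).
Proof.
move=> mX; have -> : path_event X (stays_near x a d k) = \bigcap_j
    (if (j <= k)%N then X (j%:R * d) @^-1` [set u | `|u - x| <= a] else setT).
  apply/seteqP; split=> w.
    by move=> H j _; case: ifPn => // jk; exact: H.
  by move=> H j jk; have := H j I; rewrite jk.
apply: bigcapT_measurable => j; case: ifPn => // jk.
rewrite -[X in measurable X]setTI; apply: mX => //.
exact: measurable_dist_le.
Qed.

End stays_near.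

(** * Super- and subsolutions of the discrete exit problem *)

Section discrete_exit.
Variables (R : realType) (q k : R -> R -> R -> R) (S : set R) (phi : R -> R).
Variables (x a : R).
Local Notation p := (@brownian_density R).
Local Notation near := [set u : R | `|u - x| <= a].
Hypothesis mS : measurable S.
Hypothesis phi0 : forall z, S z -> 0 < phi z.
Hypothesis mphi : measurable_fun setT phi.
Hypothesis mphiV : measurable_fun setT (fun z => (phi z)^-1).
Hypothesis qE : forall t z u, S z -> S u -> q t z u = phi u / phi z * k t z u.
Hypothesis kp : forall t z u, 0 < t -> S z -> S u -> 0 <= k t z u <= p t z u.
Hypothesis mk : forall t, measurable_fun setT (fun zu : R * R => k t zu.1 zu.2).
Hypothesis a0 : 0 <= a.
Hypothesis nearS : near `<=` S.

Variables (dd : measure_display) (Omega : measurableType dd).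
Variables (P : probability Omega R) (X : R -> Omega -> R).
Hypothesis PX : markov_process q S x P X.
Variable d : R.
Hypothesis d0 : 0 < d.

Local Notation E := (fun j => path_event X (stays_near x a d j)).
Local Notation Xd j := (X (j%:R * d)).

(** One step of the transformed chain, killed when it leaves the interval; the
    factors [phi] are kept outside. *)
Definition killed_kernel z u := \1_near u * k d z u.
Local Notation G := killed_kernel.

Let mX j : measurable_fun setT (Xd j).
Proof. by apply: (markov_measurable PX); rewrite mulr_ge0// ltW. Qed.

Let mE j : measurable (E j).
Proof. by apply: measurable_stays_near => i _; exact: mX. Qed.

Let mG z : measurable_fun setT (G z).
Proof.
apply: measurable_funM; first by apply: measurable_indic; exact: measurable_dist_le.
exact: (@measurable_fun_pair2 _ _ _ _ _ _ (fun zu => k d zu.1 zu.2) z (mk d)).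
Qed.

Let Enear j w : E j w -> near (Xd j w).
Proof. by move=> /(_ j (leqnn j)). Qed.

Lemma killed_kernelM_ge0 (U : R -> R) z u : (forall u, near u -> 0 <= U u) -> near z ->
  0 <= G z u * U u.
Proof.
move=> U0 nz; rewrite /G indicE; have [/[!inE] nu|_] := boolP (u \in near); last by rewrite !mul0r.
rewrite mul1r mulr_ge0 ?U0//.
by have /andP[] := kp d0 (nearS nz) (nearS nu).
Qed.

(** Dividing by [phi] turns the transition density [q] into the kernel [k]. *)
Lemma integral_stays_nearS (U : R -> R) j : measurable_fun setT U ->
  (forall u, near u -> 0 <= U u) ->
  (\int[P]_(w in E j.+1) ((phi (Xd j.+1 w))^-1 * U (Xd j.+1 w))%:E =
   \int[P]_(w in E j) ((phi (Xd j w))^-1%:E *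
      \int[lebesgue_measure]_u (G (Xd j w) u * U u)%:E))%E.
Proof.
move=> mU U0; pose f u := \1_near u * ((phi u)^-1 * U u).
have f0 u : 0 <= f u.
  rewrite /f indicE; have [/[!inE] nu|_] := boolP (u \in near); last by rewrite mul0r.
  by rewrite mul1r mulr_ge0 ?U0// invr_ge0 ltW// phi0//; exact: nearS.
have mf : measurable_fun setT f.
  apply: measurable_funM; first by apply: measurable_indic; exact: measurable_dist_le.
  exact: measurable_funM.
have jd : (j.+1%:R * d = j%:R * d + d) by rewrite -natr1 mulrDl mul1r.
transitivity (\int[P]_(w in E j) (f (X (j%:R * d + d) w))%:E)%E.
  rewrite -jd [LHS]integral_mkcond [RHS]integral_mkcond.
  apply: eq_integral => w _; rewrite !patchE.
  have [/[!inE] Ej|Ej] := boolP (w \in E j); last first.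
    rewrite ifF//; apply/negbTE; apply: contra Ej; rewrite !inE.
    by case/stays_nearS.
  rewrite /f indicE; have [/[!inE] nX|nX] := boolP (Xd j.+1 w \in near).
    by rewrite mem_set ?mul1r//; apply/stays_nearS.
  rewrite ifF ?mul0r//; apply/negbTE; apply: contra nX; rewrite !inE.
  by case/stays_nearS.
have jd0 : 0 <= j%:R * d by rewrite mulr_ge0// ltW.
rewrite (markov_expectation PX mS jd0 d0 _ (mE j))//.
- apply: eq_integral => w /[!inE] Ew; have nw := Enear Ew; have Sw := nearS nw.
  rewrite -ge0_integralZl_EFin//; last 3 first.
  + by move=> u _; rewrite lee_fin killed_kernelM_ge0.
  + by apply/measurable_EFinP; exact: (measurable_funM (mG _) mU).
  + by rewrite invr_ge0 ltW// phi0.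
  rewrite [LHS]integral_mkcond; apply: eq_integral => u _; rewrite patchE /f /G !indicE.
  case: ifPn => [/[!inE] Su|nSu].
    rewrite -EFinM; congr EFin; rewrite qE//; field.
    by rewrite !gt_eqF ?phi0.
  rewrite (_ : (u \in near) = false) ?mul0r ?mule0//.
  by apply: contraNF nSu; rewrite !inE; exact: nearS.
- by apply: past_events_stays_near; rewrite ltW.
- apply: (@eq_measurable_fun _ _ _ _ _
    (fun wu => phi wu.2 * (phi (Xd j wu.1))^-1 * k d (Xd j wu.1) wu.2)).
    by move=> [w u] /[!inE] -[/= Ew Su]; rewrite qE//; exact: nearS (Enear Ew).
  apply: measurable_funTS; apply: measurable_funM.
    apply: measurable_funM; first exact: measurableT_comp.
    apply: (measurableT_comp mphiV); exact: measurableT_comp.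
  apply: (measurableT_comp (mk d) (g := fun wu => (Xd j wu.1, wu.2))).
  by apply: measurable_fun_pair => //; exact: measurableT_comp.
- move=> w u Ew Su; have Sw := nearS (Enear Ew); rewrite qE// mulr_ge0//.
    by rewrite divr_ge0// ltW// phi0.
  by have /andP[] := kp d0 Sw Su.
Qed.

(** [expect j] is the law of the killed chain at step [j], and [step] is its
    transition operator. *)
Let expect j (g : R -> \bar R) : \bar R :=
  (\int[P]_(w in E j) ((phi (Xd j w))^-1%:E * g (Xd j w)))%E.
Let step (U : R -> R) z : \bar R := (\int[lebesgue_measure]_u (G z u * U u)%:E)%E.

Let phiX_ge0 j w : E j w -> (0 <= ((phi (Xd j w))^-1)%:E)%E.
Proof. by move=> Ew; rewrite lee_fin invr_ge0 ltW// phi0//; exact: nearS (Enear Ew). Qed.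

Let le_expect j (g h : R -> \bar R) :
  measurable_fun near g -> measurable_fun near h ->
  (forall z, near z -> 0 <= g z)%E -> (forall z, near z -> g z <= h z)%E ->
  (expect j g <= expect j h)%E.
Proof.
move=> mg mh g0 gh.
have mX' (f : R -> \bar R) : measurable_fun near f ->
    measurable_fun (E j) (fun w => (phi (Xd j w))^-1%:E * f (Xd j w))%E.
  move=> mf; apply: emeasurable_funM.
    apply/measurable_EFinP; apply: measurable_funTS.
    exact: (measurableT_comp mphiV (mX j)).
  apply: (measurable_comp (F := near)) mf _; first exact: measurable_dist_le.
    by move=> _ [w Ew <-]; exact: Enear Ew.
  by apply: measurable_funTS.
apply: ge0_le_integral => //.
- by move=> w Ew; rewrite mule_ge0 ?phiX_ge0// g0//; exact: Enear Ew.
- exact: mX'.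
- exact: mX'.
- by move=> w Ew; rewrite lee_wpmul2l ?phiX_ge0// gh//; exact: Enear Ew.
Qed.

Let measurable_step (U : R -> R) : measurable_fun setT U -> (forall u, near u -> 0 <= U u) ->
  measurable_fun near (step U).
Proof.
move=> mU U0.
apply: (@measurable_integral_on _ _ _ _ _ (@lebesgue_measure R) setT near
  (fun u z => (G z u * U u)%:E)) => //.
- exact: measurable_dist_le.
- apply: measurable_funTS; apply/measurable_EFinP/measurable_funM.
    apply: measurable_funM.
      have m1 : measurable_fun setT (\1_near : R -> R).
        by apply: measurable_indic; exact: measurable_dist_le.
      exact: (measurableT_comp m1 measurable_fst).
    by apply: (measurableT_comp (mk d) (g := fun uz => (uz.2, uz.1))); exact: measurable_swap.
  exact: measurableT_comp.
- by move=> u z _ nz; rewrite lee_fin killed_kernelM_ge0.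
Qed.

Let step_ge0 (U : R -> R) z : (forall u, near u -> 0 <= U u) -> near z -> (0 <= step U z)%E.
Proof. by move=> U0 nz; apply: integral_ge0 => u _; rewrite lee_fin killed_kernelM_ge0. Qed.

Let expectS (U : R -> R) j : measurable_fun setT U -> (forall u, near u -> 0 <= U u) ->
  expect j.+1 (EFin \o U) = expect j (step U).
Proof.
move=> mU U0; rewrite /expect -integral_stays_nearS//.
Qed.

Let expect0 (U : R -> R) : near x -> expect 0 (EFin \o U) = ((phi x)^-1 * U x)%:E.
Proof.
move=> nx; rewrite /expect; have -> : E 0 = setT.
  apply/seteqP; split=> w // _ j; rewrite leqn0 => /eqP ->.
  by rewrite mul0r (markov_start PX).
under eq_integral do rewrite mul0r (markov_start PX) /= -EFinM.
by rewrite integral_cst// [X in (_ * X)%E]probability_setT mule1.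
Qed.

Let expectD (g : R -> R) (h : R -> \bar R) j : measurable_fun setT g ->
  (forall u, near u -> 0 <= g u) -> measurable_fun near h ->
  (forall u, near u -> 0 <= h u)%E ->
  expect j (fun u => (g u)%:E + h u)%E = (expect j (EFin \o g) + expect j h)%E.
Proof.
move=> mg g0 mh h0; rewrite /expect -ge0_integralD//.
- apply: eq_integral => w /[!inE] /Enear nw.
  by rewrite ge0_muleDr// ?h0// lee_fin g0.
- by move=> w Ew; rewrite mule_ge0 ?phiX_ge0//= lee_fin g0//; exact: Enear Ew.
- apply: emeasurable_funM; apply/measurable_EFinP; apply: measurable_funTS.
    exact: (measurableT_comp mphiV (mX j)).
  exact: (measurableT_comp mg (mX j)).
- by move=> w Ew; rewrite mule_ge0 ?phiX_ge0//= h0//; exact: Enear Ew.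
- apply: emeasurable_funM.
    apply/measurable_EFinP; apply: measurable_funTS.
    exact: (measurableT_comp mphiV (mX j)).
  apply: (measurable_comp (F := near)) mh _; first exact: measurable_dist_le.
    by move=> _ [w Ew <-]; exact: Enear Ew.
  exact: measurable_funTS.
Qed.

Variables (g u : nat -> R -> R) (N : nat).
Hypothesis nx : near x.
Hypothesis mg : forall j, measurable_fun setT (g j).
Hypothesis mu : forall j, measurable_fun setT (u j).
Hypothesis g0 : forall j z, (j < N)%N -> near z -> 0 <= g j z.
Hypothesis u0 : forall j z, (j <= N)%N -> near z -> 0 <= u j z.

(** A supersolution loses at least the gain [g] in mean at each step, and stays
    nonnegative. *)
Lemma discrete_supersolution :
  (forall j z, (j < N)%N -> near z ->
    ((g j z)%:E + \int[lebesgue_measure]_v (G z v * u j.+1 v)%:E <= (u j z)%:E)%E) ->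
  (\sum_(j < N) \int[P]_(w in E j) ((phi (Xd j w))^-1 * g j (Xd j w))%:E <=
   ((phi x)^-1 * u 0%N x)%:E)%E.
Proof.
move=> super; rewrite -(expect0 (u 0%N) nx).
suff H n : (n <= N)%N ->
    (\sum_(j < n) expect j (EFin \o g j) + expect n (EFin \o u n) <=
     expect 0 (EFin \o u 0%N))%E.
  have := H N (leqnn N); apply: le_trans.
  apply: (@le_trans _ _ (\sum_(j < N) expect j (EFin \o g j))%E).
    rewrite le_eqVlt; apply/orP; left; apply/eqP; apply: eq_bigr => j _.
    by apply: eq_integral => w _; rewrite EFinM.
  rewrite leeDl// integral_ge0// => w Ew.
  by rewrite mule_ge0 ?phiX_ge0//= lee_fin u0//; exact: Enear Ew.
elim: n => [_|n IH nN]; first by rewrite big_ord0 add0e.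
apply: le_trans (IH (ltnW nN)); rewrite big_ord_recr/= -addeA.
have un0 z : near z -> 0 <= u n.+1 z by exact: u0.
have gn0 z : near z -> 0 <= g n z by exact: g0.
rewrite leeD2l// expectS// -expectD//.
- apply: le_expect.
  + apply: emeasurable_funD; last exact: measurable_step.
    by apply/measurable_EFinP; exact: measurable_funTS.
  + by apply/measurable_EFinP; exact: measurable_funTS.
  + by move=> z nz; rewrite adde_ge0 ?lee_fin ?gn0// step_ge0.
  + by move=> z nz; exact: super.
- exact: measurable_step.
- by move=> z nz; exact: step_ge0.
Qed.

Lemma discrete_subsolution :
  (forall z, near z -> u N z = 0) ->
  (forall j z, (j < N)%N -> near z ->
    ((u j z)%:E <= (g j z)%:E + \int[lebesgue_measure]_v (G z v * u j.+1 v)%:E)%E) ->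
  (((phi x)^-1 * u 0%N x)%:E <=
   \sum_(j < N) \int[P]_(w in E j) ((phi (Xd j w))^-1 * g j (Xd j w))%:E)%E.
Proof.
move=> uN super; rewrite -(expect0 (u 0%N) nx).
suff H n : (n <= N)%N -> (expect 0 (EFin \o u 0%N) <=
    \sum_(j < n) expect j (EFin \o g j) + expect n (EFin \o u n))%E.
  apply: le_trans (H N (leqnn N)) _.
  rewrite [X in (_ + X)%E](_ : _ = 0%E) ?adde0; last first.
    rewrite /expect integral0_eq// => w Ew /=; rewrite uN ?mule0//.
    exact: Enear Ew.
  rewrite le_eqVlt; apply/orP; left; apply/eqP; apply: eq_bigr => j _.
  by apply: eq_integral => w _; rewrite EFinM.
elim: n => [_|n IH nN]; first by rewrite big_ord0 add0e.
apply: le_trans (IH (ltnW nN)) _; rewrite big_ord_recr/= -addeA.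
have un0 z : near z -> 0 <= u n.+1 z by exact: u0.
have gn0 z : near z -> 0 <= g n z by exact: g0.
rewrite leeD2l// expectS// -expectD//.
- apply: le_expect.
  + by apply/measurable_EFinP; exact: measurable_funTS.
  + apply: emeasurable_funD; last exact: measurable_step.
    by apply/measurable_EFinP; exact: measurable_funTS.
  + by move=> z nz; rewrite lee_fin u0// ltnW.
  + by move=> z nz; exact: super.
- exact: measurable_step.
- by move=> z nz; exact: step_ge0.
Qed.

End discrete_exit.

(** * The discrete exit problem for an approximate solution of the heat equation *)

Section discrete_exit_estimate.
Variables (R : realType) (q k : R -> R -> R -> R) (S : set R) (phi : R -> R).
Variables (x y h T : R) (V : R -> R -> R) (C eps C0 : R).
Local Notation p := (@brownian_density R).
Hypothesis mS : measurable S.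
Hypothesis phi0 : forall z, S z -> 0 < phi z.
Hypothesis mphi : measurable_fun setT phi.
Hypothesis mphiV : measurable_fun setT (fun z => (phi z)^-1).
Hypothesis qE : forall t z u, S z -> S u -> q t z u = phi u / phi z * k t z u.
Hypothesis kp : forall t z u, 0 < t -> S z -> S u -> 0 <= k t z u <= p t z u.
Hypothesis mk : forall t, measurable_fun setT (fun zu : R * R => k t zu.1 zu.2).
Hypothesis hS : [set u : R | `|u - x| <= h] `<=` S.
Hypothesis Sy : S y.
Hypothesis hy : h <= `|y - x|.
Hypothesis T0 : 0 < T.
Hypothesis C0ge0 : 0 <= C0.
Hypothesis Cge0 : 0 <= C.
Hypothesis epsge0 : 0 <= eps.
Hypothesis pk : forall t z u, 0 < t -> `|z - x| <= h -> `|u - x| <= h ->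
  p t z u - k t z u <= C0 * t ^+ 2 * p (2 * t) z u.
Hypothesis mV : forall r, 0 < r -> measurable_fun setT (V r).
Hypothesis Vmean : forall t r z, 0 < t -> 0 < r ->
  gaussian_mean t z (V r) (V (r + t) z - t * k (r + t) z y).
Hypothesis Vboundary : forall r z, 0 < r <= T ->
  `|V r z| <= C * `| `|z - x| - h| + eps.
Hypothesis Vsmall : forall a, a < h -> exists K, forall r z, 0 < r ->
  `|z - x| <= a -> `|V r z| <= K * r ^+ 2.

(** A linear overshoot is traded for an arbitrarily small constant and a fourth
    power, which [brownian_density_pow4] makes negligible. *)
Let young (e t : R) : 0 < e -> 0 <= t -> C * t <= e + C ^+ 4 / e ^+ 3 * t ^+ 4.
Proof.
move=> e0 t0; have Ct : 0 <= C * t by rewrite mulr_ge0.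
have E : C ^+ 4 / e ^+ 3 * t ^+ 4 = (C * t) * (C * t / e) ^+ 3.
  by field; rewrite gt_eqF.
have Ct3 : 0 <= (C * t / e) ^+ 3 by rewrite exprn_ge0// divr_ge0// ltW.
have [H|H] := leP (C * t) e.
  by rewrite (le_trans H)// lerDl E mulr_ge0.
rewrite (@le_trans _ _ (C ^+ 4 / e ^+ 3 * t ^+ 4))//; last by rewrite lerDr ltW.
rewrite E ler_peMr// exprn_ege1// ler_pdivlMr// mul1r ltW//.
Qed.

Variables (dd : measure_display) (Omega : measurableType dd).
Variables (P : probability Omega R) (X : R -> Omega -> R).
Hypothesis PX : markov_process q S x P X.
Variables (a e0 : R).
Hypothesis a0 : 0 <= a.
Hypothesis ah : a < h.
Hypothesis ae0 : C * (h - a) + eps < e0.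

Local Notation near := [set u : R | `|u - x| <= a].
Let eta := e0 - (C * (h - a) + eps).
Let C1 := C ^+ 4 / eta ^+ 3.
Let c1 := (C * h + eps) * C0 + 32 * C1.

Let eta0 : 0 < eta. Proof. by rewrite /eta subr_gt0. Qed.
Let C1ge0 : 0 <= C1. Proof. by rewrite /C1 divr_ge0 ?exprn_ge0// ltW. Qed.
Let h0 : 0 < h. Proof. exact: le_lt_trans ah. Qed.
Let e0gt0 : 0 < e0.
Proof. by apply: le_lt_trans ae0; rewrite addr_ge0// mulr_ge0// subr_ge0 ltW. Qed.
Let c1ge0 : 0 <= c1.
Proof. by rewrite addr_ge0// mulr_ge0// addr_ge0// mulr_ge0// ltW. Qed.
Let nearh u : near u -> `|u - x| <= h.
Proof. by move=> /le_trans; apply; exact: ltW. Qed.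
Let nearS : near `<=` S. Proof. by move=> u /nearh; exact: hS. Qed.
Let xx : near x. Proof. by rewrite /= subrr normr0. Qed.

Local Notation G := (killed_kernel k x a).

Let Gp t z : 0 < t -> near z -> forall u, 0 <= G t z u <= p t z u.
Proof.
move=> t0 nz u; rewrite /killed_kernel indicE.
have [/[!inE] nu|_] := boolP (u \in near); last first.
  by rewrite mul0r lexx brownian_density_ge0.
by rewrite mul1r kp//; exact: nearS.
Qed.

(** The error of replacing the Gaussian kernel by the killed one: inside the
    interval both kernels are close, and outside it [V] is close to [0] except
    where a fourth moment of the overshoot takes over. *)
Let GV t r z e : 0 < t -> 0 < r <= T -> near z -> e0 <= e -> forall u,
  `|(p t z u - G t z u) * V r u| <=
    e * (p t z u - G t z u) + c1 * t ^+ 2 * p (2 * t) z u.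
Proof.
move=> t0 rT nz ee u; have /andP[G0 G1] := Gp t0 nz u.
have e1 : 0 <= e by rewrite (le_trans _ ee)// ltW.
have p0 := brownian_density_ge0 t z u.
have q0 := brownian_density_ge0 (2 * t) z u.
have t2 : 0 <= t ^+ 2 by rewrite exprn_ge0// ltW.
have Vu := Vboundary u rT.
have c1D : c1 * t ^+ 2 * p (2 * t) z u = (C * h + eps) * C0 * t ^+ 2 * p (2 * t) z u +
    32 * C1 * t ^+ 2 * p (2 * t) z u by rewrite /c1; ring.
rewrite normrM ger0_norm; last by rewrite subr_ge0.
move: G0 G1; rewrite /killed_kernel indicE.
have [/[!inE] nu|] := boolP (u \in near).
  rewrite mul1r => G0 G1.
  have {}Vu : `|V r u| <= C * h + eps.
    rewrite (le_trans Vu)// lerD2r ler_wpM2l//.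
    rewrite ler_norml; have := nearh nu; have := normr_ge0 (u - x); have := h0; lra.
  have H := pk t0 (nearh nz) (nearh nu).
  rewrite (@le_trans _ _ (C0 * t ^+ 2 * p (2 * t) z u * (C * h + eps)))//.
    by rewrite ler_pM// subr_ge0.
  have -> : C0 * t ^+ 2 * p (2 * t) z u * (C * h + eps) =
     (C * h + eps) * C0 * t ^+ 2 * p (2 * t) z u by ring.
  rewrite ler_wpDl ?mulr_ge0 ?subr_ge0//.
  by rewrite c1D lerDl; do 3 rewrite mulr_ge0//.
rewrite notin_setE /= => /negP; rewrite -ltNge mul0r subr0 => nu _ _.
set s := `|u - x| - a.
have s0 : 0 <= s by rewrite subr_ge0 ltW.
have su : s <= `|z - u|.
  have := ler_normD (u - z) (z - x); rewrite subrKA (distrC u z) => H.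
  by rewrite /s lerBlDr (le_trans H)// lerD2l.
have {}Vu : `|V r u| <= e0 + C1 * s ^+ 4.
  rewrite (le_trans Vu)//.
  have H : `| `|u - x| - h| <= s + (h - a).
    by rewrite /s ler_norml; move: nu ah; lra.
  have := ler_wpM2l Cge0 H; rewrite mulrDr.
  have Y : C * s <= eta + C1 * s ^+ 4 := young eta0 s0.
  have E : eta + C * (h - a) + eps = e0 by rewrite /eta; ring.
  by rewrite -E; lra.
have s4 : p t z u * s ^+ 4 <= 32 * t ^+ 2 * p (2 * t) z u.
  rewrite mulrC (le_trans _ (brownian_density_pow4 z u t0))// ler_wpM2r//.
  rewrite -[leRHS]ger0_norm; last by rewrite -[4%N]/(2 * 2)%N exprM sqr_ge0.
  by rewrite normrX ler_pXn2r// nnegrE.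
rewrite (le_trans (ler_wpM2l p0 Vu))// mulrDr lerD//.
  by rewrite mulrC ler_wpM2r.
rewrite mulrCA (le_trans (ler_wpM2l C1ge0 s4))//.
have -> : C1 * (32 * t ^+ 2 * p (2 * t) z u) = 32 * C1 * t ^+ 2 * p (2 * t) z u by ring.
by rewrite c1D lerDr; do 3 rewrite mulr_ge0//; rewrite addr_ge0// mulr_ge0// ltW.
Qed.

Section fixed_mesh.
Variables (n : nat) (d : R).
Hypothesis n0 : (0 < n)%N.
Hypothesis dn : n%:R * d = T.
Hypothesis Vd : forall z, near z -> `|V d z| + d / (h - a) <= e0.

Let d0 : 0 < d.
Proof. by have : 0 < n%:R * d by [rewrite dn]; rewrite pmulr_rgt0// ltr0n. Qed.

Let rem j : R := (n - j)%:R * d.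
Let err j : R := e0 + c1 * (n - j)%:R * d ^+ 2.
Let gain j z := d * k (rem j) z y.

Let remS j : (j < n)%N -> rem j.+1 + d = rem j.
Proof. by move=> jn; rewrite /rem -[X in _ + X]mul1r -mulrDl natr1 subnSK. Qed.

Let errS j : (j < n)%N -> err j.+1 + c1 * d ^+ 2 = err j.
Proof. by move=> jn; rewrite /err -(subnSK jn) -natr1; ring. Qed.

Let remT j : (j < n)%N -> 0 < rem j <= T.
Proof.
move=> jn; rewrite /rem mulr_gt0 ?ltr0n ?subn_gt0//= -dn ler_wpM2r ?(ltW d0)//.
by rewrite ler_nat leq_subr.
Qed.

Let err_ge j : e0 <= err j.
Proof. by rewrite /err lerDl; rewrite mulr_ge0 ?sqr_ge0//; rewrite mulr_ge0. Qed.

Let gain_ge0 j z : (j < n)%N -> near z -> 0 <= gain j z.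
Proof.
move=> jn nz; rewrite /gain mulr_ge0 ?(ltW d0)//.
by have /andP[r0 _] := remT jn; have /andP[] := kp r0 (nearS nz) Sy.
Qed.

Let measurable_gain j : measurable_fun setT (gain j).
Proof.
apply: measurable_funM => //.
exact: (@measurable_fun_pair1 _ _ _ _ _ _ (fun zu => k (rem j) zu.1 zu.2) y (mk (rem j))).
Qed.

Let remlast : rem n.-1 = d.
Proof. by rewrite /rem -{1}(prednK n0) subSnn mul1r. Qed.

Let gain_last z : near z -> gain n.-1 z <= d / (h - a).
Proof.
move=> nz; rewrite /gain remlast ler_wpM2l ?(ltW d0)//.
have /andP[_ kz] := kp d0 (nearS nz) Sy; rewrite (le_trans kz)//.
have ha0 : 0 < h - a by rewrite subr_gt0.
rewrite -[leRHS]mul1r ler_pdivlMr// mulrC.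
have H : h - a <= `|y - z|.
  have := ler_distD z y x; move: nz hy => /=; lra.
have -> : p d z y = p d 0 `|y - z|.
  by rewrite brownian_densityE; case: (ger0P (y - z)) => _ //; rewrite brownian_densityN.
apply: le_trans (ler_dist_brownian_density `|y - z| d0).
by rewrite ler_wpM2r// brownian_density_ge0.
Qed.

(** The time left at step [j] is [rem j] and [V (rem j)] is the candidate
    solution. After the last step both functions are cut off to [0], and
    [err] absorbs the cut-off together with the errors of the steps still to come;
    [lower] is also truncated at [0], as the gains are nonnegative. *)
Let upper j z := if (j < n)%N then V (rem j) z + err j else 0.
Let lower j z := if (j < n)%N then Order.max (V (rem j) z - err j) 0 else 0.

Let upper_step j z : (j.+1 < n)%N -> near z -> (forall u, near u -> 0 <= upper j.+1 u) ->
  ((gain j z)%:E + \int[lebesgue_measure]_u (G d z u * upper j.+1 u)%:E <= (upper j z)%:E)%E.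
Proof.
move=> j1n nz up0; have jn := ltnW j1n.
have /andP[r0 rT] := remT j1n.
have up1 u : upper j.+1 u = V (rem j.+1) u + err j.+1 by rewrite /upper j1n.
have GVj := GV d0 (remT j1n) nz (err_ge j.+1).
have := subkernel_supersolution d0 _ (mV r0) (Gp d0 nz) (Vmean z d0 r0) GVj.
move=> /(_ _ (upper j.+1)) H.
apply: (le_trans (leeD2l _ (H _ _ _ _))).
- apply: measurable_funM; first by apply: measurable_indic; exact: measurable_dist_le.
  exact: (@measurable_fun_pair2 _ _ _ _ _ _ (fun zu => k d zu.1 zu.2) z (mk d)).
- by rewrite (le_trans _ (err_ge _))// ltW.
- by move=> u; rewrite up1.
- by move=> u; apply: (killed_kernelM_ge0 kp nearS d0).
rewrite -EFinD lee_fin remS// /upper jn /gain -(errS jn).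
by rewrite le_eqVlt; apply/orP; left; apply/eqP; ring.
Qed.

Let Vlast j z : (j < n)%N -> ~~ (j.+1 < n)%N -> near z ->
  `|V (rem j) z| + gain j z <= e0.
Proof.
rewrite -leqNgt => jn nj nz; have -> : j = n.-1.
  by apply/eqP; rewrite -eqSS (prednK n0) eqn_leq jn nj.
by apply: le_trans (Vd nz); rewrite remlast lerD2l gain_last.
Qed.

(** Backward induction, since a supersolution dominates a nonnegative quantity. *)
Let upper_ge0 j z : (j <= n)%N -> near z -> 0 <= upper j z.
Proof.
move=> jn; rewrite -(subKn jn); move: (n - j)%N (leq_subr j n) => {jn}i.
elim: i z => [|i IH] z iN nz; first by rewrite subn0 /upper ltnn.
have jn : (n - i.+1 < n)%N by rewrite ltn_subrL n0.
have [j1n|j1n] := boolP ((n - i.+1).+1 < n)%N.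
  rewrite -lee_fin; apply: le_trans (upper_step j1n nz _).
    rewrite adde_ge0 ?lee_fin ?gain_ge0// integral_ge0// => u _.
    rewrite lee_fin (killed_kernelM_ge0 kp nearS d0)// => v nv.
    by rewrite subnSK//; apply: IH => //; exact: ltnW.
  by move=> u nu; rewrite subnSK//; apply: IH => //; exact: ltnW.
rewrite /upper jn; have := Vlast jn j1n nz; have := err_ge (n - i.+1).
have := gain_ge0 jn nz; have := ler_norm (- V (rem (n - i.+1)) z).
by rewrite normrN; lra.
Qed.

Let measurable_upper j : measurable_fun setT (upper j).
Proof.
rewrite /upper; have [jn|jn] := boolP (j < n)%N; last exact: measurable_cst.
apply: measurable_funD => //; by apply: mV; have /andP[] := remT jn.
Qed.

Let measurable_lower j : measurable_fun setT (lower j).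
Proof.
rewrite /lower; have [jn|jn] := boolP (j < n)%N; last exact: measurable_cst.
apply: measurable_maxr => //.
apply: measurable_funB => //; by apply: mV; have /andP[] := remT jn.
Qed.

Let lower_ge0 j z : 0 <= lower j z.
Proof. by rewrite /lower; case: ifP => // _; rewrite le_max lexx orbT. Qed.

Let lower_step j z : (j.+1 < n)%N -> near z ->
  ((lower j z)%:E <= (gain j z)%:E + \int[lebesgue_measure]_u (G d z u * lower j.+1 u)%:E)%E.
Proof.
move=> j1n nz; have jn := ltnW j1n.
have /andP[r0 rT] := remT j1n.
rewrite {1}/lower jn EFin_max ge_max; apply/andP; split; last first.
  rewrite adde_ge0 ?lee_fin ?gain_ge0// integral_ge0// => u _.
  by rewrite lee_fin (killed_kernelM_ge0 kp nearS d0).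
have GVj := GV d0 (remT j1n) nz (err_ge j.+1).
have := subkernel_subsolution d0 _ (mV r0) (Gp d0 nz) (Vmean z d0 r0) GVj.
move=> /(_ _ (lower j.+1)) H.
apply: (le_trans _ (leeD2l _ (H _ _ _ _))) => //.
- rewrite -EFinD lee_fin remS// /gain -(errS jn).
  by rewrite le_eqVlt; apply/orP; left; apply/eqP; ring.
- apply: measurable_funM; first by apply: measurable_indic; exact: measurable_dist_le.
  exact: (@measurable_fun_pair2 _ _ _ _ _ _ (fun zu => k d zu.1 zu.2) z (mk d)).
- move=> u; rewrite ler_wpM2l//; first by have /andP[] := Gp d0 nz u.
  by rewrite /lower j1n le_max lexx.
Qed.

Local Notation E := (fun j => path_event X (stays_near x a d j)).

Lemma fixed_mesh_upper :
  (\sum_(j < n) \int[P]_(w in E j) ((phi (X (j%:R * d) w))^-1 *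
      (d * k ((n - j)%:R * d) (X (j%:R * d) w) y))%:E <=
   ((phi x)^-1 * (V T x + (e0 + c1 * T * d)))%:E)%E.
Proof.
have E0 : upper 0 x = V T x + (e0 + c1 * T * d).
  by rewrite /upper n0 /rem /err subn0 dn -dn; congr (_ + (_ + _)); ring.
rewrite -E0.
apply: (discrete_supersolution mS phi0 mphi mphiV qE kp mk nearS PX d0 (u := upper) (g := gain)) => //.
move=> j z jn nz; have [j1n|j1n] := boolP (j.+1 < n)%N.
  by apply: upper_step => // u; exact: upper_ge0.
rewrite [X in (_ + X)%E](_ : _ = 0%E) ?adde0; last first.
  by rewrite integral0_eq// => u _; rewrite /upper (negbTE j1n) mulr0.
rewrite lee_fin /upper jn; have := Vlast jn j1n nz; have := err_ge j.
have := ler_norm (- V (rem j) z); rewrite normrN; lra.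
Qed.

Lemma fixed_mesh_lower :
  (((phi x)^-1 * (V T x - (e0 + c1 * T * d)))%:E <=
   \sum_(j < n) \int[P]_(w in E j) ((phi (X (j%:R * d) w))^-1 *
      (d * k ((n - j)%:R * d) (X (j%:R * d) w) y))%:E)%E.
Proof.
have E0 : V T x - (e0 + c1 * T * d) <= lower 0 x.
  rewrite /lower n0 le_max; apply/orP; left.
  rewrite /rem /err subn0 dn -dn le_eqVlt; apply/orP; left; apply/eqP.
  by congr (_ - (_ + _)); ring.
apply: (@le_trans _ _ ((phi x)^-1 * lower 0 x)%:E).
  by rewrite lee_fin ler_wpM2l// invr_ge0 ltW// phi0//; exact: nearS xx.
apply: (discrete_subsolution mS phi0 mphi mphiV qE kp mk nearS PX d0 (u := lower) (g := gain)) => //.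
  by move=> z _; rewrite /lower ltnn.
move=> j z jn nz; have [j1n|j1n] := boolP (j.+1 < n)%N; first exact: lower_step.
rewrite [X in (_ + X)%E](_ : _ = 0%E) ?adde0; last first.
  by rewrite integral0_eq// => u _; rewrite /lower (negbTE j1n) mulr0.
rewrite lee_fin /lower jn ge_max gain_ge0// andbT.
have := Vlast jn j1n nz; have := err_ge j; have := gain_ge0 jn nz.
have := ler_norm (V (rem j) z); lra.
Qed.

End fixed_mesh.

End discrete_exit_estimate.

(** * Exit times of continuous paths *)

Section integral_full_measure.
Local Open Scope ereal_scope.
Context d (T : measurableType d) (R : realType) (P : {measure set T -> \bar R}).

Lemma ge0_le_integralT (f g : T -> \bar R) : (forall w, 0 <= f w) ->
  (forall w, f w <= g w) -> \int[P]_w f w <= \int[P]_w g w.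
Proof.
move=> f0 fg; have g0 w : 0 <= g w by exact: le_trans (f0 w) (fg w).
rewrite !ge0_integralTE//; apply: le_ereal_sup => _ [h hf <-].
by exists h => // w; exact: le_trans (hf w) (fg w).
Qed.

(** For the exit time of a bridge: it is a limit of measurable functions on the
    event that the path starts at the right point, which has full measure. *)
Lemma integral_full_measure (D : set T) (f : T -> \bar R) : measurable D ->
  P (~` D) = 0 -> (forall w, 0 <= f w) -> measurable_fun D f ->
  \int[P]_w f w = \int[P]_(w in D) f w.
Proof.
move=> mD PD f0 mf; have mfD : measurable_fun setT (f \_ D).
  exact/(measurable_restrictT _ mD).
have fD0 w : 0 <= (f \_ D) w by rewrite patchE; case: ifP.
apply/eqP; rewrite eq_le; apply/andP; split; last first.
  by rewrite integral_mkcond; apply: ge0_le_integralT => // w; rewrite patchE; case: ifP.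
pose g w := (f \_ D) w + (cst +oo \_ (~` D)) w.
have c0 w : 0 <= ((cst +oo : T -> \bar R) \_ (~` D)) w.
  by rewrite patchE; case: ifP => // _; rewrite leey.
apply: (@le_trans _ _ (\int[P]_w g w)).
  apply: ge0_le_integralT => // w; rewrite /g !patchE.
  have [Dw|nDw] := pselect (D w).
    by rewrite mem_set// ifF ?adde0//; apply/negbTE; rewrite notin_setE => /(_ Dw).
  by rewrite memNset// mem_set// add0e leey.
rewrite ge0_integralD//; last first.
  by apply/(measurable_restrictT _ (measurableC mD)); exact: measurable_cst.
rewrite -(integral_mkcond (~` D)) integral_cst//; last exact: measurableC.
by rewrite [X in _ * X]PD mule0 adde0 -integral_mkcond.
Qed.

End integral_full_measure.

Section exit_path.
Variable R : realType.
Implicit Types (f : R -> R) (x a h T : R).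

(** The first time at which the path goes strictly farther than [a] from [x]. With
    a strict inequality the set is relatively open for a continuous path, and
    hence detected by fine meshes. *)
Definition overshoot_time x a T f : R :=
  inf [set t | 0 <= t <= T /\ a < `|f t - x|].

(** The first mesh point at which the path is farther than [a] from [x], written
    as the mesh size times the number of earlier mesh points, so that its mean is a
    sum of probabilities. *)
Definition mesh_exit_time x a T (n : nat) f : R :=
  T / n.+1%:R * \sum_(j < n.+1) \1_(stays_near x a (T / n.+1%:R) j) f.

Lemma sum_indic_stays_near x a d n f k : ~ stays_near x a d k f ->
  \sum_(j < n) \1_(stays_near x a d j) f <= k%:R :> R.
Proof.
move=> sk; apply: (@le_trans _ _ (\sum_(j < n) ((j < k)%N)%:R)).
  apply: ler_sum => j _; rewrite indicE.
  have [/[!inE] sj|//] := boolP (f \in _).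
  rewrite ltnNge; have [kj|//] := leqP k j; exfalso; apply: sk => i ik.
  by apply: sj; exact: leq_trans kj.
rewrite -natr_sum ler_nat; elim: n => [|n IH]; first by rewrite big_ord0.
rewrite big_ord_recr/=; case: ltnP => nk; last by rewrite addn0.
rewrite addn1; apply: leq_ltn_trans nk.
apply: (@leq_trans (\sum_(j < n) 1)%N); last by rewrite sum1_card card_ord.
by apply: leq_sum => j _; case: ltnP.
Qed.

Lemma le_sum_indic_stays_near x a d n f k : (k <= n)%N ->
  (forall j, (j < k)%N -> stays_near x a d j f) ->
  k%:R <= \sum_(j < n) \1_(stays_near x a d j) f :> R.
Proof.
move=> kn sk; apply: (@le_trans _ _ (\sum_(j < n) ((j < k)%N)%:R)).
  rewrite -natr_sum ler_nat; elim: n kn => [|n IH]; first by rewrite leqn0 => /eqP ->.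
  rewrite leq_eqVlt => /predU1P[->|/IH kn].
    rewrite (eq_bigr (fun=> 1%N)) ?sum1_card ?card_ord// => j _.
    by rewrite ltn_ord.
  by rewrite big_ord_recr/= (leq_trans kn)// leq_addr.
apply: ler_sum => j _; case: ltnP => jk; last by rewrite indicE.
by rewrite indicE mem_set//; exact: sk.
Qed.

Lemma within_itv_continuousP f T t e : {within `[0, T], continuous f} ->
  0 <= t <= T -> 0 < e ->
  exists2 r, 0 < r & forall s, 0 <= s <= T -> `|t - s| < r -> `|f t - f s| < e.
Proof.
move=> cf tT e0; have /cvgrPdist_lt/(_ e e0) := cf t.
move=> H; have {H} : nbhs_subspace (A := `[0, T]%classic) t (fun s => `|f t - f s| < e) by exact: H.
rewrite -nbhs_subspace_in; last by rewrite /= in_itv.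
move=> /nbhs_ballP[r/= r0 Hr]; exists r => // s sT ts.
by apply: Hr => //; rewrite /= in_itv.
Qed.

(** The path is seen outside at mesh points only, so the mesh time is never too
    early; and it is not late because a neighbourhood of any time outside
    contains a mesh point. *)
Lemma cvg_mesh_exit_time x a T f : 0 < T ->
  {within `[0, T], continuous f} -> a < `|f T - x| ->
  mesh_exit_time x a T n f @[n --> \oo] --> overshoot_time x a T f.
Proof.
move=> T0 cf fT; set A := [set t | 0 <= t <= T /\ a < `|f t - x|].
have AT : A T by split=> //; rewrite lexx ltW.
have lA : has_lbound A by exists 0 => t [/andP[]].
have iA : has_inf A by split; [exists T|].
have e0 : 0 <= overshoot_time x a T f.
  by apply: lb_le_inf; [exists T|move=> t [/andP[]]].
have dn n : 0 < T / n.+1%:R by rewrite divr_gt0.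
have lower n : overshoot_time x a T f <= mesh_exit_time x a T n f.
  rewrite /mesh_exit_time; set d := T / n.+1%:R.
  have nd : n.+1%:R * d = T by rewrite /d mulrC divfK.
  have exm : exists m, overshoot_time x a T f <= m%:R * d.
    by exists n.+1; rewrite nd; exact: ge_inf.
  have mn : (ex_minn exm <= n.+1)%N.
    by case: ex_minnP => m _; apply; rewrite nd; exact: ge_inf.
  have := @le_sum_indic_stays_near x a d n.+1 f _ mn.
  case: ex_minnP mn => m Hm mmin mn H.
  apply: (le_trans Hm); rewrite mulrC ler_wpM2l ?(ltW (dn n))//.
  apply: H => j jm i ij; rewrite leNgt; apply/negP => fi.
  have im : (i < m)%N by exact: leq_ltn_trans jm.
  have : overshoot_time x a T f <= i%:R * d.
    apply: ge_inf => //; split => //; rewrite mulr_ge0 ?(ltW (dn n))//= -nd.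
    by rewrite ler_wpM2r ?(ltW (dn n))// ler_nat ltnW// (leq_trans im).
  by move=> /mmin; rewrite leqNgt im.
have upper t : A t -> \forall n \near \oo, mesh_exit_time x a T n f <= t.
  move=> [tT ft]; have /andP[t0 _] := tT.
  have [|r r0 Hr] := within_itv_continuousP (e := `|f t - x| - a) cf tT.
    by rewrite subr_gt0.
  near=> n; rewrite /mesh_exit_time; set d := T / n.+1%:R.
  have d0 : 0 < d by exact: dn.
  have dr : d < r.
    rewrite /d ltr_pdivrMr// mulrC -ltr_pdivrMr// -natr1.
    rewrite (@le_lt_trans _ _ n%:R) ?ltrDl//.
    by near: n; exact: nbhs_infty_ger.
  pose k := Num.truncn (t / d).
  have /andP[kt tk] : k%:R <= t / d < k.+1%:R.
    by apply: truncn_itv; rewrite divr_ge0// ltW.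
  rewrite ler_pdivlMr// in kt; rewrite ltr_pdivrMr// -natr1 mulrDl mul1r in tk.
  have fk : a < `|f (k%:R * d) - x|.
    have := Hr (k%:R * d); rewrite mulr_ge0 ?(ltW d0)//=.
    have /andP[_ tT'] := tT; rewrite (le_trans kt tT') => /(_ isT).
    have -> : `|t - k%:R * d| < r by rewrite ger0_norm ?subr_ge0//; lra.
    move=> /(_ isT); have := ler_distD (f (k%:R * d)) (f t) x; lra.
  apply: le_trans kt; rewrite mulrC ler_wpM2r ?(ltW d0)//.
  by apply: sum_indic_stays_near => /(_ k (leqnn k)); rewrite leNgt fk.
apply/cvgrPdist_le => e e1.
have [t At te] := inf_adherent e1 iA.
near=> n; have H1 := lower n.
have H2 : mesh_exit_time x a T n f <= t by near: n; exact: upper.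
rewrite distrC ger0_norm ?subr_ge0//.
by move: te; rewrite -/(overshoot_time x a T f); lra.
Unshelve. all: by end_near. Qed.

Lemma overshoot_time_itv x a T f : 0 < T -> a < `|f T - x| ->
  0 <= overshoot_time x a T f <= T.
Proof.
move=> T0 fT; have AT : [set t | 0 <= t <= T /\ a < `|f t - x|] T.
  by split=> //; rewrite lexx ltW.
apply/andP; split; first by apply: lb_le_inf; [exists T|move=> t [/andP[]]].
by apply: ge_inf => //; exists 0 => t [/andP[]].
Qed.

Lemma exit_time_notin x h t : ~ (x - h < t < x + h) <-> h <= `|t - x|.
Proof.
have -> : (x - h < t < x + h) = (`|t - x| < h) by rewrite ltr_norml; lra.
by rewrite leNgt; split=> /negP.
Qed.

Lemma exit_timeE x h T f : 0 < T -> h <= `|f T - x| ->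
  exit_time `[0, T] (x - h) (x + h) f =
  (inf [set t | [/\ `[0, T]%classic t, 0 < t & ~ (x - h < f t < x + h)]])%:E.
Proof.
move=> T0 fT; rewrite /exit_time ereal_inf_EFin//.
  by exists 0 => t [_ /ltW].
by exists T; split; [rewrite /= in_itv/= lexx ltW| |apply/exit_time_notin].
Qed.

(** A path that stays in the open interval up to time [s] stays, by
    compactness, in a smaller closed one. *)
Lemma cvg_overshoot_time x h T f (a : R^nat) : 0 < T -> 0 < h ->
  {within `[0, T], continuous f} -> f 0 = x -> h <= `|f T - x| ->
  (forall m, a m < h) -> a @ \oo --> h ->
  (overshoot_time x (a m) T f)%:E @[m --> \oo] -->
    exit_time `[0, T] (x - h) (x + h) f.
Proof.
move=> T0 h0 cf fx fT ah cah.
pose B := [set t | [/\ `[0, T]%classic t, 0 < t & ~ (x - h < f t < x + h)]].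
have outE t := exit_time_notin x h (f t).
have BT : B T by split; [rewrite /= in_itv/= lexx ltW| |apply/outE].
have lB : has_lbound B by exists 0 => t [_ /ltW].
have iB : has_inf B by split; [exists T|].
rewrite (exit_timeE T0 fT) -/B.
apply: cvg_EFin; first exact: nearW.
apply/cvgrPdist_le => e e0.
have up m : overshoot_time x (a m) T f <= inf B.
  apply: lb_le_inf; first by exists T.
  move=> t [tT t0 /outE ft]; apply: ge_inf; first by exists 0 => s [/andP[]].
  by split; [move: tT; rewrite /= in_itv|exact: lt_le_trans ft].
have ge0 m : 0 <= overshoot_time x (a m) T f.
  by have /andP[] := overshoot_time_itv T0 (lt_le_trans (ah m) fT).
suff low : \forall m \near \oo, inf B - e <= overshoot_time x (a m) T f.
  near=> m; rewrite /= ger0_norm ?subr_ge0 ?up//.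
  have : inf B - e <= overshoot_time x (a m) T f by near: m; exact: low.
  lra.
have [se|se] := leP (inf B - e) 0.
  by apply: nearW => m; exact: le_trans se (ge0 m).
set s := inf B - e in se *; have sB : s < inf B by rewrite /s ltrBlDr ltrDl.
have BT' : inf B <= T by exact: ge_inf.
have sT : s < T by exact: lt_le_trans BT'.
have inside t : 0 <= t <= s -> `|f t - x| < h.
  move=> /andP[t0 ts]; rewrite ltNge; apply/negP => /outE ft.
  have [t00|tn0] := eqVneq t 0; first by move/outE: ft; rewrite t00 fx subrr normr0 leNgt h0.
  have : inf B <= t.
    apply: ge_inf => //; split => //; last by rewrite lt_neqAle eq_sym tn0.
    by rewrite /= in_itv/= t0 (le_trans ts)// ltW.
  by rewrite leNgt (le_lt_trans ts).
have cg : {within `[0, s], continuous (fun t => `|f t - x|)}.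
  apply: (@continuous_subspaceW _ _ _ `[0, T]%classic).
    by move=> t; rewrite /= !in_itv/= => /andP[-> ts]/=; rewrite (le_trans ts)// ltW.
  by move=> t; apply: cvg_norm; apply: cvgB; [exact: cf|exact: cvg_cst].
have [c] := EVT_max (ltW se) cg; rewrite in_itv/= => cs cmax.
near=> m; apply: lb_le_inf.
  by exists T; split; [rewrite lexx ltW|exact: lt_le_trans fT].
move=> t [/andP[t0 tT] ft]; rewrite leNgt; apply/negP => ts.
have := cmax t; rewrite in_itv/= t0 (ltW ts) => /(_ isT); rewrite leNgt => /negP; apply.
apply: le_lt_trans ft; near: m.
by apply: (cvgr_ge h cah); exact: inside.
Unshelve. all: by end_near. Qed.

End exit_path.

(** * Mean exit time of a bridge *)

Lemma bounded_convergence d (T : measurableType d) (R : realType)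
    (P : probability T R) (D : set T) (f_ : nat -> T -> R) (f : T -> R) (M : R) :
  measurable D -> (forall n, measurable_fun D (f_ n)) ->
  (forall n w, D w -> `|f_ n w| <= M) ->
  (forall w, D w -> f_ n w @[n --> \oo] --> f w) ->
  P.-integrable D (EFin \o f) /\
  \int[P]_(w in D) f_ n w @[n --> \oo] --> \int[P]_(w in D) f w.
Proof.
move=> mD mf_ fM ff.
have ff' w : D w -> (f_ n w)%:E @[n --> \oo] --> (f w)%:E.
  by move=> Dw; apply: cvg_EFin; [exact: nearW|exact: ff].
have mEf : measurable_fun D (EFin \o f).
  by apply: (@emeasurable_fun_cvg _ _ _ D (fun n w => (f_ n w)%:E)) => // n;
    exact/measurable_EFinP.
have iM : P.-integrable D (cst M%:E).
  apply: (integrableS measurableT) => //.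
  exact: finite_measure_integrable_cst.
have [|||||iff _ cvgf] := @dominated_convergence _ _ _ P D mD
  (fun n w => (f_ n w)%:E) (EFin \o f) (cst M%:E).
- by move=> n; exact/measurable_EFinP.
- by [].
- exact: aeW.
- exact: iM.
- by apply: aeW => w n Dw; rewrite lee_fin fM.
split=> //; apply: fine_cvg; rewrite fineK; first exact: cvgf.
exact: integrable_fin_num.
Qed.

Section bridge_exit.
Variables (R : realType) (q k : R -> R -> R -> R) (S : set R) (phi : R -> R).
Variables (x y h T : R) (V : R -> R -> R) (C eps C0 : R).
Local Notation p := (@brownian_density R).
Hypothesis mS : measurable S.
Hypothesis phi0 : forall z, S z -> 0 < phi z.
Hypothesis mphi : measurable_fun setT phi.
Hypothesis mphiV : measurable_fun setT (fun z => (phi z)^-1).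
Hypothesis qE : forall t z u, S z -> S u -> q t z u = phi u / phi z * k t z u.
Hypothesis kp : forall t z u, 0 < t -> S z -> S u -> 0 <= k t z u <= p t z u.
Hypothesis mk : forall t, measurable_fun setT (fun zu : R * R => k t zu.1 zu.2).
Hypothesis hS : [set u : R | `|u - x| <= h] `<=` S.
Hypothesis Sy : S y.
Hypothesis h0 : 0 < h.
Hypothesis hy : h <= `|y - x|.
Hypothesis T0 : 0 < T.
Hypothesis kT0 : 0 < k T x y.
Hypothesis C0ge0 : 0 <= C0.
Hypothesis Cge0 : 0 <= C.
Hypothesis epsge0 : 0 <= eps.
Hypothesis pk : forall t z u, 0 < t -> `|z - x| <= h -> `|u - x| <= h ->
  p t z u - k t z u <= C0 * t ^+ 2 * p (2 * t) z u.
Hypothesis mV : forall r, 0 < r -> measurable_fun setT (V r).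
Hypothesis Vmean : forall t r z, 0 < t -> 0 < r ->
  gaussian_mean t z (V r) (V (r + t) z - t * k (r + t) z y).
Hypothesis Vboundary : forall r z, 0 < r <= T ->
  `|V r z| <= C * `| `|z - x| - h| + eps.
Hypothesis Vsmall : forall a, a < h -> exists K, forall r z, 0 < r ->
  `|z - x| <= a -> `|V r z| <= K * r ^+ 2.

Variables (dd : measure_display) (Omega : measurableType dd).
Variables (P : probability Omega R) (X : R -> Omega -> R).
Hypothesis PX : markov_process q S x P X.
Variables (dd' : measure_display) (Omega' : measurableType dd').
Variables (Q : probability Omega' R) (Y : R -> Omega' -> R).
Hypothesis QY : bridge q x T y P X Q Y.

Let Sx : S x. Proof. by apply: hS; rewrite /= subrr normr0 ltW. Qed.

Let qT : q T x y = phi y / phi x * k T x y. Proof. exact: qE. Qed.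
Let qT0 : 0 < q T x y.
Proof. by rewrite qT mulr_gt0// divr_gt0// phi0. Qed.

Local Notation D := (Y 0 @^-1` [set x]).

Let mD : measurable D.
Proof.
rewrite -[X in measurable X]setTI; apply: (bridge_measurable QY) => //.
by rewrite lexx ltW.
Qed.

(** The bridge law at time [0]. *)
Let QD : Q (~` D) = 0%E.
Proof.
have pD : past_events (0 : R) [set f : R -> R | [set x] (f 0)].
  by apply: sub_sigma_algebra; exists 0, [set x]; split=> //; rewrite lexx.
have hT : 0 <= (0 : R) < T by rewrite lexx.
have E := bridge_law QY hT pD.
have QD1 : Q D = 1%E.
  rewrite -[LHS]/(Q (path_event Y [set f : R -> R | [set x] (f 0)])) E.
  have -> : path_event X [set f : R -> R | [set x] (f 0)] = setT.
    by apply/seteqP; split=> w //= _; exact: markov_start PX w.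
  under eq_integral do rewrite (markov_start PX) subr0 divff ?gt_eqF//.
  by rewrite integral_cst// mul1e; exact: probability_setT.
by rewrite probability_setC// QD1 subee.
Qed.

Section fixed_mesh.
Variables (a : R) (n : nat).
Hypothesis ah : a < h.
Let d := T / n.+1%:R.
Let d0 : 0 < d. Proof. by rewrite divr_gt0. Qed.
Let nd : n.+1%:R * d = T. Proof. by rewrite /d mulrC divfK. Qed.
Local Notation E Z j := (path_event Z (stays_near x a d j)).

Let jdT j : (j < n.+1)%N -> 0 <= j%:R * d < T.
Proof. by move=> jn; rewrite mulr_ge0 ?(ltW d0)//= -nd ltr_pM2r// ltr_nat. Qed.

Let mE j : (j < n.+1)%N -> measurable (E Y j).
Proof.
move=> jn; apply: measurable_stays_near => i ij; apply: (bridge_measurable QY).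
by have /andP[-> /ltW ->] := jdT (leq_ltn_trans ij jn).
Qed.

Let mesh w := mesh_exit_time x a T n (Y ^~ w).

Let indic_pathE j w : \1_(stays_near x a d j) (Y ^~ w) = \1_(E Y j) w :> R.
Proof. by rewrite !indicE; congr (nat_of_bool _)%:R; apply/idP/idP; rewrite !inE. Qed.

Lemma measurable_mesh_exit_time : measurable_fun setT mesh.
Proof.
apply: measurable_funM => //; apply: measurable_sum => j.
have : measurable_fun setT (\1_(E Y j) : Omega' -> R) by exact: measurable_indic (mE _).
by apply: eq_measurable_fun => w _; rewrite indic_pathE.
Qed.

Lemma mesh_exit_time_itv w : 0 <= mesh w <= T.
Proof.
have s0 : 0 <= \sum_(j < n.+1) \1_(stays_near x a d j) (Y ^~ w) :> R.
  by apply: sumr_ge0 => j _; rewrite indicE.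
rewrite /mesh /mesh_exit_time -/d mulr_ge0 ?(ltW d0)//= -nd mulrC.
rewrite ler_wpM2r ?(ltW d0)//.
apply: (@le_trans _ _ (\sum_(j < n.+1) 1)); last by rewrite sumr_const card_ord.
by apply: ler_sum => j _; rewrite indicE; case: (_ \in _).
Qed.

(** The bridge weights [q_(T-t)(z, y) / q_T(x, y)] are those of [k] up to the ratio
    [phi x / phi z]. *)
Lemma mesh_exit_time_mean :
  ((k T x y)%:E * \int[Q]_w (mesh w)%:E = (phi x)%:E *
    \sum_(j < n.+1) \int[P]_(w in E X j) ((phi (X (j%:R * d) w))^-1 *
      (d * k ((n.+1 - j)%:R * d) (X (j%:R * d) w) y))%:E)%E.
Proof.
pose F j w := (phi (X (j%:R * d) w))^-1 * (d * k ((n.+1 - j)%:R * d) (X (j%:R * d) w) y).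
have XS j w : E X j w -> S (X (j%:R * d) w).
  by move=> /(_ j (leqnn j)) H; apply: hS; exact: le_trans H (ltW ah).
have rem j : (j < n.+1)%N -> T - j%:R * d = (n.+1 - j)%:R * d.
  by move=> jn; rewrite natrB 1?ltnW// mulrBl nd.
have rem0 j : (j < n.+1)%N -> 0 < (n.+1 - j)%:R * d.
  by move=> jn; rewrite mulr_gt0// ltr0n subn_gt0.
have mF j : measurable_fun setT (F j).
  have mXj : measurable_fun setT (X (j%:R * d)).
    by apply: (markov_measurable PX); rewrite mulr_ge0// ltW.
  apply: measurable_funM; first exact: (measurableT_comp mphiV mXj).
  apply: measurable_funM => //.
  by apply: (measurableT_comp (mk _) (g := fun w => (X (j%:R * d) w, y)));
    exact: measurable_fun_pair.
have mEX j : measurable (E X j).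
  apply: measurable_stays_near => i _; apply: (markov_measurable PX).
  by rewrite mulr_ge0// ltW.
have F0 j w : (j < n.+1)%N -> E X j w -> 0 <= F j w.
  move=> jn /XS SX; rewrite /F mulr_ge0 ?invr_ge0 ?(ltW (phi0 SX))//.
  rewrite mulr_ge0 ?(ltW d0)//.
  by have /andP[] := kp (rem0 j jn) SX Sy.
have QE j : (j < n.+1)%N ->
    ((k T x y * d)%:E * Q (E Y j) = (phi x)%:E * \int[P]_(w in E X j) (F j w)%:E)%E.
  move=> jn; have /andP[jd0 jdT'] := jdT jn.
  have pE : past_events (j%:R * d) (stays_near x a d j).
    by apply: past_events_stays_near; exact: ltW.
  rewrite (bridge_law QY (jdT jn) pE).
  have -> : (\int[P]_(w in E X j) (q (T - j%:R * d) (X (j%:R * d) w) y / q T x y)%:E =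
      \int[P]_(w in E X j) ((phi x / (k T x y * d))%:E * (F j w)%:E))%E.
    apply: eq_integral => w /[!inE] /XS SX; rewrite -EFinM; congr EFin.
    rewrite qT qE// rem// /F; field.
    by rewrite !gt_eqF// ?phi0.
  rewrite ge0_integralZl_EFin//; last 3 first.
  - by move=> w Ew; rewrite lee_fin F0.
  - by apply/measurable_EFinP; exact: measurable_funTS.
  - by rewrite divr_ge0 ?ltW ?mulr_gt0// phi0.
  rewrite muleA -EFinM; congr (_%:E * _)%E; field.
  by rewrite !gt_eqF.
have -> : (\int[Q]_w (mesh w)%:E = d%:E * \sum_(j < n.+1) Q (E Y j))%E.
  transitivity (\int[Q]_w (d%:E * \sum_(j < n.+1) (\1_(E Y j) w)%:E))%E.
    apply: eq_integral => w _; rewrite /mesh /mesh_exit_time EFinM -/d; congr (_ * _)%E.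
    by rewrite -sumEFin; apply: eq_bigr => j _; rewrite indic_pathE.
  have mI (j : 'I_n.+1) : measurable_fun setT (fun w => (\1_(E Y j) w)%:E : \bar R).
    by apply/measurable_EFinP; exact: measurable_indic (mE _).
  rewrite ge0_integralZl_EFin//; last 3 first.
  - by move=> w _; apply: sume_ge0 => j _; rewrite lee_fin.
  - exact: emeasurable_sum.
  - exact: ltW.
  congr (_ * _)%E; rewrite ge0_integral_sum//.
  by apply: eq_bigr => j _; rewrite integral_indic// ?setIT//; exact: mE.
rewrite muleA -EFinM ge0_sume_distrr//.
rewrite [RHS]ge0_sume_distrr//; last first.
  by move=> j _; apply: integral_ge0 => w Ew; rewrite lee_fin F0.
by apply: eq_bigr => j _; rewrite QE.
Qed.

End fixed_mesh.

(** As the mesh is refined, the errors [O(d^2)] of the [T / d] steps disappear; the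
    values of [V] on the boundary of the smaller interval remain. *)
Lemma overshoot_time_mean a : 0 <= a -> a < h ->
  measurable_fun D (fun w => overshoot_time x a T (Y ^~ w)) /\
  `|k T x y * \int[Q]_(w in D) overshoot_time x a T (Y ^~ w) - V T x| <=
     C * (h - a) + eps.
Proof.
move=> a0 ah; have [|||io cvgo] := @bounded_convergence _ _ _ Q D
  (fun n w => mesh_exit_time x a T n (Y ^~ w))
  (fun w => overshoot_time x a T (Y ^~ w)) T mD.
- by move=> n; apply: measurable_funTS; exact: measurable_mesh_exit_time.
- move=> n w _; have /andP[m0 mT] := mesh_exit_time_itv a n w.
  by rewrite ger0_norm.
- move=> w _; apply: cvg_mesh_exit_time => //; first exact: (bridge_continuous QY).
  by rewrite (bridge_end QY) (lt_le_trans ah).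
split; first by have /integrableP[/measurable_EFinP] := io.
apply/ler_addgt0Pr => e e0.
set e1 := C * (h - a) + eps + e / 3.
have e30 : 0 < e / 3 by rewrite divr_gt0.
have ha0 : 0 < h - a by rewrite subr_gt0.
have e1C : C * (h - a) + eps < e1 by rewrite ltrDl.
have e10 : 0 < e1 by apply: le_lt_trans e1C; rewrite addr_ge0// mulr_ge0// ltW.
have [K HK] := Vsmall ah.
pose I n := \int[Q]_(w in D) mesh_exit_time x a T n (Y ^~ w).
have IE n : (I n)%:E = (\int[Q]_w (mesh_exit_time x a T n (Y ^~ w))%:E)%E.
  rewrite (integral_full_measure mD)//.
  - rewrite /I /Rintegral fineK//; apply: integrable_fin_num => //.
    apply: (@le_integrable_real _ _ _ Q D mD _ (cst T)).
    + by apply: measurable_funTS; exact: measurable_mesh_exit_time.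
    + move=> w _; have /andP[m0 mT] := mesh_exit_time_itv a n w.
      by rewrite ger0_norm.
    + apply: (integrableS measurableT) => //.
      exact: finite_measure_integrable_cst.
  - by move=> w; rewrite lee_fin; have /andP[] := mesh_exit_time_itv a n w.
  - apply/measurable_EFinP; apply: measurable_funTS; exact: measurable_mesh_exit_time.
have Sphix := phi0 Sx.
have dist_le (u v b : R) : u - b <= v -> v <= u + b -> `|v - u| <= b.
  by rewrite ler_norml; lra.
have [c Hc] : exists c, forall n, (forall z, `|z - x| <= a ->
    `|V (T / n.+1%:R) z| + (T / n.+1%:R) / (h - a) <= e1) ->
    `|k T x y * I n - V T x| <= e1 + c * T * (T / n.+1%:R).
  eexists => n Hn; have nT : n.+1%:R * (T / n.+1%:R) = T by rewrite mulrC divfK.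
  have U := fixed_mesh_upper mS phi0 mphi mphiV qE kp mk hS Sy hy T0 C0ge0 Cge0
    epsge0 pk mV Vmean Vboundary PX a0 ah e1C (ltn0Sn n) nT Hn.
  have L := fixed_mesh_lower mS phi0 mphi mphiV qE kp mk hS Sy hy T0 C0ge0 Cge0
    epsge0 pk mV Vmean Vboundary PX a0 ah e1C (ltn0Sn n) nT Hn.
  have M := mesh_exit_time_mean n ah; rewrite -IE -EFinM in M.
  have cancel r : ((phi x)%:E * ((phi x)^-1 * r)%:E = r%:E)%E.
    by rewrite -EFinM mulrA divff ?mul1r// gt_eqF.
  have {}U := lee_wpmul2l (ltW (Sphix : (0%:E < (phi x)%:E)%E)) U.
  have {}L := lee_wpmul2l (ltW (Sphix : (0%:E < (phi x)%:E)%E)) L.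
  move: U L; rewrite -M !cancel !lee_fin => U L.
  exact: dist_le L U.
have cI : I n @[n --> \oo] --> \int[Q]_(w in D) overshoot_time x a T (Y ^~ w) by [].
set L := (X in k T x y * X - _).
have {}cI : k T x y * I n @[n --> \oo] --> k T x y * L by apply: cvgMr.
have small b e2 : 0 < e2 -> \forall n \near \oo, b * (T / n.+1%:R) <= e2.
  move=> e20; near=> n; rewrite mulrA ler_pdivrMr// -ler_pdivrMl// -natr1.
  rewrite (@le_trans _ _ n%:R)// ?lerDl//.
  by near: n; exact: nbhs_infty_ger.
near \oo => n.
have H1 : `|k T x y * L - k T x y * I n| <= e / 3.
  by near: n; move/cvgrPdist_le : cI; apply.
have H2 : c * T * (T / n.+1%:R) <= e / 3 by near: n; exact: small.
have H3 : (`|K| * T + (h - a)^-1) * (T / n.+1%:R) <= e1 by near: n; exact: small.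
have H4 : `|k T x y * I n - V T x| <= e1 + c * T * (T / n.+1%:R).
  apply: Hc => z nz; have dn : 0 < T / n.+1%:R by rewrite divr_gt0.
  rewrite (le_trans _ H3)// mulrDl [X in _ <= _ + X]mulrC lerD2r.
  rewrite (le_trans (HK _ _ dn nz))//.
  rewrite (@le_trans _ _ (`|K| * (T / n.+1%:R) ^+ 2))//.
    by rewrite ler_wpM2r ?ler_norm// sqr_ge0.
  rewrite -mulrA ler_wpM2l// expr2 ler_wpM2r ?(ltW dn)//.
  by rewrite ler_pdivrMr// ler_peMr ?(ltW T0)// ler1n.
have := ler_distD (k T x y * I n) (k T x y * L) (V T x).
move: H1 H2 H4; move: (c * T * _) => b; rewrite /e1.
move: (`|k T x y * L - V T x|) (`|k T x y * L - k T x y * I n|) (`|k T x y * I n - V T x|).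
by move: (C * (h - a)) => *; lra.
Unshelve. all: by end_near. Qed.

Lemma bridge_exit_time_approx : exists I : R,
  (\int[Q]_w exit_time `[0%R, T] (x - h) (x + h) (Y ^~ w) = I%:E)%E /\
  `|k T x y * I - V T x| <= eps.
Proof.
pose a (m : nat) := h - h / m.+2%:R.
have ah m : a m < h by rewrite /a ltrBlDr ltrDl divr_gt0.
have a0 m : 0 <= a m.
  by rewrite subr_ge0 ler_pdivrMr// ler_peMr ?(ltW h0)// ler1n.
have ca : a @ \oo --> h.
  rewrite -[X in _ --> X]subr0; apply: cvgB; first exact: cvg_cst.
  rewrite -[X in _ --> X](mulr0 h); apply: cvgMr.
  by have := @cvg_harmonic R; rewrite -cvg_shiftS.
have hT w : h <= `|Y T w - x| by rewrite (bridge_end QY).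
have cY w : {within `[0, T], continuous (Y ^~ w)} by exact: (bridge_continuous QY).
have co w : D w -> (overshoot_time x (a m) T (Y ^~ w))%:E @[m --> \oo] -->
    exit_time `[0, T] (x - h) (x + h) (Y ^~ w).
  by move=> Dw; exact: cvg_overshoot_time.
pose f w := fine (exit_time `[0, T] (x - h) (x + h) (Y ^~ w)).
have fE w : exit_time `[0, T] (x - h) (x + h) (Y ^~ w) = (f w)%:E.
  by rewrite /f (@exit_timeE _ x h T (Y ^~ w) T0).
have [|||iF cvgf] := @bounded_convergence _ _ _ Q D
  (fun m w => overshoot_time x (a m) T (Y ^~ w)) f T mD.
- by move=> m; have [] := overshoot_time_mean (a0 m) (ah m).
- move=> m w _.
  have /andP[? ?] := @overshoot_time_itv _ x (a m) T (Y ^~ w) T0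
    (lt_le_trans (ah m) (hT w)).
  by rewrite ger0_norm.
- by move=> w /co; rewrite fE => /fine_cvgP[_].
exists (\int[Q]_(w in D) f w); split.
  rewrite (integral_full_measure mD)//.
  - rewrite /Rintegral fineK; last exact: integrable_fin_num.
    by apply: eq_integral => w _; rewrite fE.
  - move=> w; apply: le_ereal_inf_tmp => _ [t [_ t0 _] <-].
    by rewrite lee_fin ltW.
  - by under eq_fun do rewrite fE; have /integrableP[] := iF.
have c1 : (fun m => `|k T x y * \int[Q]_(w in D) overshoot_time x (a m) T (Y ^~ w) - V T x|)
    @ \oo --> `|k T x y * \int[Q]_(w in D) f w - V T x|.
  by apply: cvg_norm; apply: cvgB; [exact: cvgMr|exact: cvg_cst].
have c2 : (fun m => C * (h - a m) + eps) @ \oo --> eps.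
  rewrite -[X in _ --> X]add0r; apply: cvgD; last exact: cvg_cst.
  rewrite -[X in _ --> X](mulr0 C); apply: cvgMr.
  by rewrite -[X in _ --> X](subrr h); apply: cvgB => //; exact: cvg_cst.
apply: (ler_cvg_to c1 c2); apply: nearW => m.
by have [] := overshoot_time_mean (a0 m) (ah m).
Qed.

End bridge_exit.

(** * Convolution in time of two heat kernels *)

Section ftc_open.
Variable R : realType.
Local Notation mu := (@lebesgue_measure R).

(** The fundamental theorem of calculus for a function that is only defined inside
    the interval, with limits at the endpoints. *)
Lemma ge0_integral_derive_itvoo (F f : R -> R) (a b la lb : R) : a < b ->
  (forall t, a < t < b -> is_derive t 1 F (f t)) ->
  (forall t, a < t < b -> {for t, continuous f}) ->
  (forall t, a < t < b -> 0 <= f t) ->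
  F t @[t --> a^'+] --> la -> F t @[t --> b^'-] --> lb ->
  (\int[mu]_(t in `]a, b[) (f t)%:E = (lb - la)%:E)%E.
Proof.
move=> ab dF cf f0 Fa Fb.
pose e n : R := (b - a) / n.+3%:R.
have e0 n : 0 < e n by rewrite divr_gt0// subr_gt0.
have e2 n : e n < (b - a) / 2.
  by rewrite ltr_pM2l ?subr_gt0// ltf_pV2 ?posrE// ltr_nat.
have ce : e n @[n --> \oo] --> 0.
  rewrite -[X in _ --> X](mulr0 (b - a)); apply: cvgMr.
  by have := @cvg_harmonic R; rewrite -2!cvg_shiftS.
pose A n := `[a + e n, b - e n]%classic.
have Aab n t : A n t -> a < t < b.
  rewrite /A /= in_itv/= => /andP[at_ tb]; have en := e0 n.
  by apply/andP; split; lra.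
have AU : `]a, b[%classic = \bigcup_n A n.
  apply/seteqP; split=> t /=; last by move=> [n _ /Aab]; rewrite in_itv.
  rewrite in_itv/= => /andP[at_ tb].
  have m0 : 0 < Num.min (t - a) (b - t) by rewrite lt_min !subr_gt0 at_.
  have [n _ Hn] := cvgr_lt 0 ce _ m0.
  have : e n < Num.min (t - a) (b - t) by exact: Hn (leqnn n).
  rewrite lt_min => /andP[H1 H2]; exists n => //.
  by rewrite /A /= in_itv/=; apply/andP; split; lra.
have IA n : (\int[mu]_(t in A n) (f t)%:E = (F (b - e n) - F (a + e n))%:E)%E.
  have lr : a + e n < b - e n by have := e2 n; lra.
  rewrite EFinB; apply: continuous_FTC2 => //.
  - by apply: continuous_in_subspaceT => t /[!inE] /Aab; exact: cf.
  - have cF t : a < t < b -> {for t, continuous F}.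
      move=> /dF/@ex_derive dt.
      by apply: differentiable_continuous; exact/derivable1_diffP.
    have := e0 n => en.
    split.
    + move=> t; rewrite in_itv/= => /andP[t1 t2].
      by apply/@ex_derive/dF/andP; split; lra.
    + by apply: cvg_at_right_filter; apply: cF; apply/andP; split; lra.
    + by apply: cvg_at_left_filter; apply: cF; apply/andP; split; lra.
  - move=> t; rewrite in_itv/= => /andP[t1 t2]; rewrite derive1E.
    have := e0 n => en; have : a < t < b by apply/andP; split; lra.
    by move=> /dF/@derive_val.
have mf n : measurable_fun (A n) (EFin \o f).
  apply/measurable_EFinP; apply: (@measurable_funS _ _ _ _ `]a, b[%classic) => //.
    by move=> t /Aab; rewrite /= in_itv.
  apply: open_continuous_measurable_fun; first exact: interval_open.
  by move=> t; rewrite inE/= in_itv/=; exact: cf.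
have ndA : nondecreasing_seq A.
  move=> m n mn; apply/subsetPset => t; rewrite /A /= !in_itv/=.
  have : e n <= e m by rewrite ler_pM2l ?subr_gt0// lef_pV2 ?posrE// ler_nat.
  by move=> ? /andP[? ?]; apply/andP; split; lra.
have mA n : measurable (A n) by exact: measurable_itv.
have := @ge0_nondecreasing_set_cvg_integral _ (measurableTypeR R) R A (EFin \o f) mu ndA mA mf.
rewrite -AU => cI.
have cI1 : (\int[mu]_(t in A n) (f t)%:E)%E @[n --> \oo] -->
    (\int[mu]_(t in `]a, b[) (f t)%:E)%E.
  by apply: cI => n t At; rewrite lee_fin f0//; exact: Aab At.
have cI2 : (\int[mu]_(t in A n) (f t)%:E)%E @[n --> \oo] --> (lb - la)%:E.
  under eq_cvg do rewrite IA.
  apply: cvg_EFin; first exact: nearW.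
  apply: cvgB.
    move/cvg_at_leftP : Fb; apply; split.
      by move=> n; rewrite ltrBlDr ltrDl.
    by rewrite -[X in _ --> X]subr0; apply: cvgB => //; exact: cvg_cst.
  move/cvg_at_rightP : Fa; apply; split.
    by move=> n; rewrite ltrDl.
  by rewrite -[X in _ --> X]addr0; apply: cvgD => //; exact: cvg_cst.
exact: cvg_unique cI1 cI2.
Qed.

End ftc_open.

Section time_convolution.
Variable R : realType.
Local Notation mu := (@lebesgue_measure R).
Local Notation p := (@brownian_density R).
Local Notation tail := (@gaussian_tail R).
Implicit Types (t r s T a b c : R).

Lemma brownian_density_scale s c : 0 < s ->
  p s 0 c = (Num.sqrt s)^-1 * p 1 0 (c / Num.sqrt s).
Proof.
move=> s0; rewrite /brownian_density mulrA -invfM -sqrtrM ?(ltW s0)//.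
rewrite !sub0r !sqrrN mulr1; congr ((Num.sqrt _)^-1 * expR (- _)).
  by ring.
by rewrite exprMn exprVn sqr_sqrtr ?(ltW s0)//; field; rewrite gt_eqF.
Qed.

Lemma continuous_brownian_density_time t c : 0 < t ->
  {for t, continuous (fun s => p s 0 c)}.
Proof.
move=> t0; have t1 : 2 * t != 0 by rewrite gt_eqF// mulr_gt0.
apply: cvgM.
  apply: cvgV; first by rewrite gt_eqF// sqrtr_gt0 !mulr_gt0// pi_gt0.
  apply: (cvg_comp (fun s => 2 * pi * s) Num.sqrt); last exact: sqrt_continuous.
  by apply: cvgMr; exact: cvg_id.
apply: (cvg_comp (fun s => - ((0 - c) ^+ 2 / (2 * s))) expR); last exact: continuous_expR.
apply: cvgN; apply: cvgMr; apply: cvgV => //; apply: cvgMr; exact: cvg_id.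
Qed.

Lemma cvg_gaussian_tail0 (F : set_system R) (FF : Filter F) (N x : R -> R) (n0 : R) :
  0 < n0 -> N t @[t --> F] --> n0 -> x t @[t --> F] --> 0 ->
  (\forall t \near F, 0 < x t) ->
  tail 1 (N t / Num.sqrt (x t)) @[t --> F] --> 0.
Proof.
move=> n00 cN cx x0.
have cb : 32 * (x t) ^+ 2 / (n0 / 2) ^+ 4 @[t --> F] --> 0.
  have -> : 0 = 32 * (0 * 0) / (n0 / 2) ^+ 4 by rewrite !mul0r mulr0 mul0r.
  by apply: cvgMl; apply: cvgMr; under eq_cvg do rewrite expr2; exact: cvgM.
apply: (@squeeze_cvgr _ _ _ _ (cst 0)); [|exact: cvg_cst|exact: cb].
near=> t.
have xt : 0 < x t by near: t.
have Nt : n0 / 2 < N t.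
  by near: t; apply: (cvgr_gt n0) => //; rewrite ltr_pdivrMr// ltr_pMr// ltr1n.
have n20 : 0 < n0 / 2 by rewrite divr_gt0.
have N0 : 0 < N t by exact: lt_trans Nt.
rewrite gaussian_tail_ge0/=.
have w0 : 0 < Num.sqrt (x t) by rewrite sqrtr_gt0.
rewrite (le_trans (gaussian_tail_le ltr01 (divr_gt0 N0 w0)))// expr1n mulr1.
have -> : (N t / Num.sqrt (x t)) ^+ 4 = N t ^+ 4 / x t ^+ 2.
  rewrite exprMn exprVn; congr (_ / _).
  by rewrite -[4%N]/(2 * 2)%N exprM sqr_sqrtr// ltW.
rewrite invf_div mulrA ler_pM2l ?mulr_gt0 ?exprn_gt0//.
by rewrite lef_pV2 ?posrE ?exprn_gt0// ler_pXn2r// ?nnegrE ltW.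
Unshelve. all: by end_near. Qed.

(** The joint density of a Brownian path at [a] at time [t] and at [a + b] at time
    [T] is its density at time [T] times that of the bridge, which is standardized
    here; [T * t * (T - t)] is [T ^+ 2] times the variance of the bridge. *)
Lemma brownian_density_bridge t T a b : 0 < t < T ->
  p T 0 (a + b) * p 1 0 ((a * (T - t) - b * t) / Num.sqrt (T * t * (T - t))) =
  Num.sqrt (T * t * (T - t)) / T * (p t 0 a * p (T - t) 0 b).
Proof.
move=> /andP[t0 tT]; have Tt0 : 0 < T - t by rewrite subr_gt0.
have T0 : 0 < T by exact: lt_trans tT.
have := brownian_density_mul 0 (a + b) a t0 Tt0.
rewrite [p (T - t) a _]brownian_densityE (addrC a) addrK => ->.
rewrite [p (_ / _) _ _]brownian_densityE (addrC t) subrK.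
set w := Num.sqrt _.
have xx0 : 0 < T * t * (T - t) by rewrite !mulr_gt0.
have w0 : 0 < w by rewrite sqrtr_gt0.
have v0 : 0 < t * (T - t) / T by rewrite divr_gt0// mulr_gt0.
rewrite (brownian_density_scale _ v0).
have -> : Num.sqrt (t * (T - t) / T) = w / T.
  have -> : t * (T - t) / T = T * t * (T - t) * T^-1 ^+ 2 by field; rewrite gt_eqF.
  by rewrite sqrtrM ?(ltW xx0)// sqrtr_sqr ger0_norm// invr_ge0 ltW.
have -> : (a - ((T - t) * 0 + t * (b + a)) / T) / (w / T) = (a * (T - t) - b * t) / w.
  by field; rewrite !gt_eqF.
by field; rewrite !gt_eqF.
Qed.

(** [a / t * p t 0 a] is the density of the first passage time at [a], and a path
    from [0] to [a + b] crosses [a]. The proof uses the antiderivative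
    [p T 0 (a + b) * tail 1 (xi b t) + p T 0 (a - b) * tail 1 (xi (- b) t)], the
    probability density of having passed [a] before time [t] and being at
    distance [b] beyond it at time [T], by the reflection principle. *)
Lemma first_passage_convolution T a b : 0 < T -> 0 < a -> 0 < b ->
  (\int[mu]_(t in `]0%R, T[) (a / t * p t 0 a * p (T - t) 0 b)%:E = (p T 0 (a + b))%:E)%E.
Proof.
move=> T0 a0 b0.
pose x t := T * t * (T - t).
pose xi c t := (a * (T - t) - c * t) / Num.sqrt (x t).
pose F t := p T 0 (a + b) * tail 1 (xi b t) + p T 0 (a - b) * tail 1 (xi (- b) t).
have x0 t : 0 < t < T -> 0 < x t.
  by move=> /andP[t0 tT]; rewrite /x mulr_gt0 ?subr_gt0// mulr_gt0.
have dx (t : R) : is_derive t 1 x (T * (T - t) - T * t).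
  rewrite /x; apply: is_derive_eq; rewrite /GRing.scale/=; ring.
have dw (t : R) : 0 < t < T ->
    is_derive t 1 (fun t => Num.sqrt (x t)) ((2 * Num.sqrt (x t))^-1 * (T * (T - t) - T * t)).
  move=> tT; have ? := dx t; have ? := is_derive1_sqrt (x0 t tT).
  exact: (@is_derive1_comp R Num.sqrt x).
have dxi c (t : R) : 0 < t < T -> is_derive t 1 (xi c)
    ((- a - c) / Num.sqrt (x t) - (a * (T - t) - c * t) *
     (T * (T - t) - T * t) / (2 * Num.sqrt (x t) * x t)).
  move=> tT; have w0 : 0 < Num.sqrt (x t) by rewrite sqrtr_gt0 x0.
  have := dw t tT; rewrite /xi; set w := fun t => Num.sqrt (x t) => dwt.
  have dV := @is_deriveV R w t _ 1 (lt0r_neq0 w0) dwt.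
  have dN : is_derive t 1 (fun t : R => a * (T - t) - c * t) (- a - c).
    by apply: is_derive_eq; rewrite /GRing.scale/=; ring.
  have -> : (fun t => (a * (T - t) - c * t) / Num.sqrt (x t)) =
     (fun t : R => a * (T - t) - c * t) * (fun t => (w t)^-1) by [].
  apply: is_derive_eq; rewrite /GRing.scale/=.
  have xE : x t = w t ^+ 2 by rewrite /w sqr_sqrtr// ltW// x0.
  have w1 : w t != 0 by rewrite gt_eqF.
  by rewrite -/(w t); move: (w t) w1 xE => v v0 ->; field.
have dF (t : R) : 0 < t < T -> is_derive t 1 F (a / t * p t 0 a * p (T - t) 0 b).
  move=> tT; have /andP[t0 tT'] := tT.
  have d1 := @is_derive1_comp R (tail 1) (xi b) t _ _
    (is_derive_gaussian_tail _ ltr01) (dxi b t tT).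
  have d2 := @is_derive1_comp R (tail 1) (xi (- b)) t _ _
    (is_derive_gaussian_tail _ ltr01) (dxi (- b) t tT).
  have -> : F = p T 0 (a + b) \*: (tail 1 \o xi b) +
     p T 0 (a - b) \*: (tail 1 \o xi (- b)) by [].
  apply: is_derive_eq; rewrite /GRing.scale/=.
  have B1 := brownian_density_bridge a b tT.
  have B2 := brownian_density_bridge a (- b) tT; rewrite brownian_densityN in B2.
  rewrite -/(x t) -/(xi b t) in B1; rewrite -/(x t) -/(xi (- b) t) in B2.
  move: B1 B2; move: (p 1 0 _) (p 1 0 _) (p T 0 _) (p T 0 _) => k1 k2 k3 k4.
  have : 0 < Num.sqrt (x t) by rewrite sqrtr_gt0 x0.
  move: (Num.sqrt (x t)) (p t 0 a) (p (T - t) 0 b) => w u v w0 B1 B2.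
  rewrite !mulNr !mulrN !mulrA B1 B2.
  field.
  by rewrite !gt_eqF// subr_gt0.
have cx (F' : set_system R) (FF : Filter F') (t0 : R) : t @[t --> F'] --> t0 ->
    x t @[t --> F'] --> T * t0 * (T - t0).
  move=> ct; apply: cvgM; first by apply: cvgM => //; exact: cvg_cst.
  by apply: cvgB => //; exact: cvg_cst.
have cN (F' : set_system R) (FF : Filter F') (t0 c : R) : t @[t --> F'] --> t0 ->
    a * (T - t) - c * t @[t --> F'] --> a * (T - t0) - c * t0.
  move=> ct; apply: cvgB; apply: cvgM => //; try exact: cvg_cst.
  by apply: cvgB => //; exact: cvg_cst.
have c0 : t @[t --> (0 : R)^'+] --> (0 : R) by apply: cvg_at_right_filter; exact: cvg_id.
have cT : t @[t --> T^'-] --> T by apply: cvg_at_left_filter; exact: cvg_id.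
rewrite (@ge0_integral_derive_itvoo R F (fun t => a / t * p t 0 a * p (T - t) 0 b)
  0 T 0 (p T 0 (a + b))) ?subr0//.
- move=> t tT; have /andP[t0 tT'] := tT.
  have cTt : p (T - s) 0 b @[s --> t] --> p (T - t) 0 b.
    apply: (cvg_comp (fun s => T - s) (fun s => p s 0 b)).
      by apply: cvgB; [exact: cvg_cst|exact: cvg_id].
    by apply: continuous_brownian_density_time; rewrite subr_gt0.
  apply: cvgM cTt; apply: cvgM; last exact: continuous_brownian_density_time.
  by apply: cvgMr; apply: cvgV; [rewrite gt_eqF|exact: cvg_id].
- move=> t /andP[t0 tT]; rewrite !mulr_ge0 ?brownian_density_ge0// ?invr_ge0 ltW//.
- have lim0 c : tail 1 (xi c t) @[t --> 0^'+] --> 0.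
    apply: (@cvg_gaussian_tail0 _ _ (fun t => a * (T - t) - c * t) x (a * T)).
    + by rewrite mulr_gt0.
    + by have H := cN _ _ _ c c0; rewrite subr0 mulr0 subr0 in H; exact: H.
    + by have H := cx _ _ _ c0; rewrite mulr0 mul0r in H; exact: H.
    + near=> t; apply: x0; apply/andP; split; near: t; first exact: nbhs_right_gt.
      exact: nbhs_right_lt.
  have H : F t @[t --> 0^'+] --> p T 0 (a + b) * 0 + p T 0 (a - b) * 0.
    by apply: cvgD; apply: cvgMr; exact: lim0.
  by rewrite !mulr0 addr0 in H; exact: H.
- have xT : \forall t \near T^'-, 0 < x t.
    near=> t; apply: x0; apply/andP; split; near: t; last exact: nbhs_left_lt.
    exact: nbhs_left_gt.
  have xT0 : x t @[t --> T^'-] --> 0 by have H := cx _ _ _ cT; rewrite subrr mulr0 in H; exact: H.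
  suff H : F t @[t --> T^'-] --> p T 0 (a + b) * 1 + p T 0 (a - b) * 0.
    by rewrite mulr1 mulr0 addr0 in H; exact: H.
  apply: cvgD; apply: cvgMr.
    have E t : tail 1 (xi b t) = 1 - tail 1 ((b * t - a * (T - t)) / Num.sqrt (x t)).
      by rewrite -gaussian_tailN// /xi -(mulNr (b * t - _)) opprB.
    suff H : 1 - tail 1 ((b * t - a * (T - t)) / Num.sqrt (x t)) @[t --> T^'-] --> (1 - 0 : R).
      rewrite subr0 in H; apply: cvg_trans H; apply: near_eq_cvg.
      by apply: nearW => t; rewrite /= E.
    apply: cvgB; first exact: cvg_cst.
    apply: (@cvg_gaussian_tail0 _ _ (fun t => b * t - a * (T - t)) x (b * T)) => //.
      by rewrite mulr_gt0.
    have H := cvgN (cN _ _ _ b cT); rewrite subrr mulr0 sub0r opprK in H.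
    by under eq_cvg do rewrite -opprB; exact: H.
  apply: (@cvg_gaussian_tail0 _ _ (fun t => a * (T - t) - - b * t) x (b * T)) => //.
    by rewrite mulr_gt0.
  by have H := cN _ _ _ (- b) cT; rewrite subrr mulr0 sub0r mulNr opprK in H; exact: H.
Unshelve. all: by end_near. Qed.

Lemma measurable_invr : measurable_fun setT (fun u : R => u^-1).
Proof.
rewrite -(setUv [set (0 : R)]); apply/measurable_funU; [by []|exact: measurableC|split].
  apply: (@eq_measurable_fun _ _ _ _ _ (cst (0 : R))); last exact: measurable_cst.
  by move=> u; rewrite inE/= => ->; rewrite invr0.
apply: open_continuous_measurable_fun.
  by rewrite openC; apply: accessible_closed_set1; exact: hausdorff_accessible.
move=> u; rewrite inE/= => /eqP u0.
by apply: cvgV => //; exact: cvg_id.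
Qed.

Lemma measurable_brownian_density_time :
  measurable_fun setT (fun ta : R * R => p ta.1 0 ta.2).
Proof.
have mc (k : R) : measurable_fun setT (fun ta : R * R => k * ta.1).
  by apply: measurable_funM => //.
apply: measurable_funM.
  apply: (measurableT_comp measurable_invr).
  have ms : measurable_fun setT (Num.sqrt : R -> R).
    by apply: continuous_measurable_fun; exact: sqrt_continuous.
  exact: (measurableT_comp ms (mc (2 * pi))).
apply: measurableT_comp => //; apply: measurableT_comp => //.
apply: measurable_funM.
  by apply: measurable_funX; exact: measurable_funB.
exact: (measurableT_comp measurable_invr (mc 2)).
Qed.

Lemma brownian_density_integral t a : 0 < t -> 0 <= a ->
  ((p t 0 a)%:E = \int[mu]_(c in `]a, +oo[) (c / t * p t 0 c)%:E)%E.
Proof.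
move=> t0 a0.
have dF (c : R) : is_derive c 1 (fun c => - p t 0 c) (c / t * p t 0 c).
  have ? := is_derive_brownian_density c t0.
  by apply: is_derive_eq; rewrite mulNr opprK.
have cf : continuous (fun c => c / t * p t 0 c).
  move=> c; apply: cvgM; last exact: continuous_brownian_density.
  by apply: cvgM; [exact: cvg_id|exact: cvg_cst].
rewrite integral_itv_obnd_cbnd; last first.
  by apply/measurable_EFinP; apply: measurable_funTS; exact: continuous_measurable_fun.
rewrite (@ge0_continuous_FTC2y R _ (fun c => - p t 0 c) a 0).
- by rewrite -EFinB sub0r opprK.
- move=> c ac; rewrite mulr_ge0 ?brownian_density_ge0// divr_ge0 ?(ltW t0)//.
  exact: le_trans ac.
- exact: continuous_subspaceT.
- apply: (@cvgy0_le_inv R _ 1) => u u1; have u0 : 0 < u by exact: lt_le_trans u1.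
  rewrite normrN ger0_norm ?brownian_density_ge0// ler_pdivlMr// mulrC.
  exact: ler_dist_brownian_density.
- by move=> c _; have /@ex_derive := dF c.
- apply: cvg_at_right_filter; apply: cvgN; exact: continuous_brownian_density.
- by move=> c _; rewrite derive1E; have /@derive_val := dF c.
Qed.

(** Writing the first kernel as an integral of first passage densities over the
    levels [c >= a] reduces the claim to [first_passage_convolution], integrated
    over [c]. *)
Lemma brownian_density_convolution T a b : 0 < T -> 0 <= a -> 0 < b ->
  (\int[mu]_(t in `]0%R, T[) (p t 0 a * p (T - t) 0 b)%:E = (tail T (a + b))%:E)%E.
Proof.
move=> T0 a0 b0.
transitivity (\int[mu]_(t in `]0%R, T[)
    \int[mu]_(c in `]a, +oo[) (c / t * p t 0 c * p (T - t) 0 b)%:E)%E.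
  apply: eq_integral => t /[!inE]/=; rewrite in_itv/= => /andP[t0 tT].
  rewrite mulrC EFinM (brownian_density_integral t0 a0) -ge0_integralZl_EFin//.
  - by apply: eq_integral => c _; rewrite -EFinM mulrC.
  - move=> c; rewrite /= in_itv/= andbT => ac.
    by rewrite lee_fin mulr_ge0 ?brownian_density_ge0// divr_ge0 ?ltW// (le_lt_trans a0).
  - apply/measurable_EFinP; apply: measurable_funTS; apply: measurable_funM.
      exact: measurable_funM.
    exact: measurable_brownian_density.
  - exact: brownian_density_ge0.
rewrite (@tonelli_on _ _ _ _ _ mu mu _ _
  (fun t c => (c / t * p t 0 c * p (T - t) 0 b)%:E))//.
- rewrite -{1}[b in a + b]opprK gaussian_tail_shift//.
  rewrite -[RHS]integral_itv_obnd_cbnd; last first.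
    by apply/measurable_EFinP; apply: measurable_funTS; exact: measurable_brownian_density.
  apply: eq_integral => c /[!inE]/=; rewrite in_itv/= andbT => ac.
  rewrite first_passage_convolution// ?(le_lt_trans a0)//.
  by rewrite [in RHS]brownian_densityE opprK.
- apply: measurable_funTS; apply/measurable_EFinP; apply: measurable_funM.
    apply: measurable_funM; last exact: measurable_brownian_density_time.
    by apply: measurable_funM => //; exact: (measurableT_comp measurable_invr).
  apply: (measurableT_comp measurable_brownian_density_time
    (g := fun tc : R * R => (T - tc.1, b))).
  by apply: measurable_fun_pair => //; exact: measurable_funB.
- move=> t c; rewrite /= !in_itv/= andbT => /andP[t0 tT] ac.
  by rewrite lee_fin !mulr_ge0 ?brownian_density_ge0// ?invr_ge0 ltW// (le_lt_trans a0).
Qed.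

End time_convolution.

(** * The theta series and its convolution *)

Section theta.
Variable R : realType.
Local Notation mu := (@lebesgue_measure R).
Local Notation p := (@brownian_density R).
Local Notation tail := (@gaussian_tail R).
Implicit Types (t T b h : R).

Lemma sum_int_symmetric (G : int -> R) N : (forall m, G (- m) = G m) ->
  \sum_(k < N.*2.+1) G ((k : nat)%:Z - N%:Z) =
  G 0 + 2 * \sum_(m < N) G (m.+1)%:Z.
Proof.
move=> Geven; elim: N => [|N IH].
  by rewrite big_ord_recl !big_ord0 mulr0 subrr.
rewrite doubleS big_ord_recl big_ord_recr/=.
have -> : \sum_(i < N.*2.+1) G ((bump 0 i)%:Z - N.+1%:Z) =
    \sum_(i < N.*2.+1) G ((i : nat)%:Z - N%:Z).
  by apply: eq_bigr => i _; congr G; rewrite /bump/=; lia.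
rewrite IH big_ord_recr/= -(Geven N.+1%:Z).
have -> : (bump 0 N.*2.+1)%:Z - N.+1%:Z = N.+1%:Z by rewrite /bump/= -addnn; lia.
rewrite sub0r Geven; ring.
Qed.

Lemma alternating_sum_bound (u : nat -> R) N :
  (forall m, 0 <= u m.+1 <= u m) ->
  0 <= \sum_(m < N) (-1) ^+ m * u m <= u 0%N.
Proof.
elim: N u => [|N IH] u Hu; have /andP[u1 u0] := Hu 0%N.
  by rewrite big_ord0 lexx (le_trans u1).
rewrite big_ord_recl expr0 mul1r.
have -> : \sum_(i < N) (-1) ^+ lift ord0 i * u (lift ord0 i) =
    - \sum_(i < N) (-1) ^+ i * u i.+1.
  by rewrite -sumrN; apply: eq_bigr => i _; rewrite exprS mulN1r mulNr.
have /andP[s0 s1] := IH (fun m => u m.+1) (fun m => Hu m.+1).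
by rewrite subr_ge0 (le_trans s1)//= gerBl.
Qed.

(** The value at its centre of the heat kernel killed outside an interval, by
    the method of images, cut off after [N] images on each side. *)
Definition image_kernel h N t : R :=
  p t 0 0 + 2 * \sum_(m < N) (-1) ^+ m.+1 * p t 0 (2 * m.+1%:R * h).

Let u h t m := p t 0 (2 * m.+1%:R * h).

Let u_decr h t m : 0 < h -> 0 < t -> 0 <= u h t m.+1 <= u h t m.
Proof.
move=> h0 t0; rewrite /u brownian_density_ge0/= /brownian_density.
rewrite ler_wpM2l ?invr_ge0 ?sqrtr_ge0// ler_expR lerN2 ler_wpM2r//.
  by rewrite invr_ge0 mulr_ge0// ltW.
rewrite !sub0r !sqrrN ler_pXn2r// ?nnegrE ?mulr_ge0 ?(ltW h0)//.
by rewrite ler_wpM2r ?(ltW h0)// ler_wpM2l// ler_nat.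
Qed.

Let u_le h t m : 0 < t -> u h t m <= p t 0 0.
Proof.
move=> t0; rewrite /u /brownian_density ler_wpM2l ?invr_ge0 ?sqrtr_ge0//.
rewrite ler_expR subrr expr0n/= mul0r oppr0 oppr_le0.
by rewrite divr_ge0 ?sqr_ge0// mulr_ge0// ltW.
Qed.

Lemma image_kernel_bound h N t : 0 < h -> 0 < t ->
  `|image_kernel h N t| <= 3 * p t 0 0.
Proof.
move=> h0 t0; have p0 := brownian_density_ge0 t 0 (0 : R).
have /andP[s0 s1] := alternating_sum_bound N (fun m => u_decr m h0 t0).
have := u_le h 0 t0; move: s0 s1; rewrite /image_kernel.
have -> : \sum_(m < N) (-1) ^+ m.+1 * p t 0 (2 * m.+1%:R * h) =
    - \sum_(m < N) (-1) ^+ m * u h t m.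
  by rewrite -sumrN; apply: eq_bigr => i _; rewrite exprS mulN1r mulNr.
by rewrite ler_norml; move: (\sum_(_ < N) _) => s s0 s1 s2; lra.
Qed.

(** Geometric domination, as [m <= m.+1 ^ 2]. *)
Lemma is_cvg_image_kernel h t : 0 < h -> 0 < t ->
  cvgn (fun N => image_kernel h N t).
Proof.
move=> h0 t0; apply: is_cvgD; first exact: is_cvg_cst.
apply: is_cvgMr.
pose v m := (-1) ^+ m.+1 * u h t m.
have -> : (fun N => \sum_(m < N) (-1) ^+ m.+1 * p t 0 (2 * m.+1%:R * h)) = series v.
  by apply/funext => N; rewrite /series/= big_mkord.
pose s := (2 * h) ^+ 2 / (2 * t).
have s0 : 0 < s by rewrite divr_gt0 ?exprn_gt0 ?mulr_gt0.
apply: normed_cvg.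
apply: (@series_le_cvg _ _ (geometric (p t 0 0) (expR (- s)))).
- by move=> m; rewrite /= normr_ge0.
- by move=> m; rewrite /= mulr_ge0 ?brownian_density_ge0// exprn_ge0// expR_ge0.
- move=> m; rewrite /= /v normrM normrX normrN1 expr1n mul1r.
  rewrite ger0_norm ?brownian_density_ge0// /u.
  have -> : p t 0 (2 * m.+1%:R * h) =
      p t 0 0 * expR (- ((2 * m.+1%:R * h) ^+ 2 / (2 * t))).
    by rewrite /brownian_density subrr expr0n/= mul0r oppr0 expR0 mulr1 sub0r sqrrN.
  rewrite ler_wpM2l ?brownian_density_ge0// -expRM_natl ler_expR mulrN lerN2.
  have -> : (2 * m.+1%:R * h) ^+ 2 / (2 * t) = m.+1%:R ^+ 2 * s.
    by rewrite /s; field; rewrite gt_eqF.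
  rewrite ler_wpM2r ?(ltW s0)// -natrX ler_nat.
  by rewrite (leq_trans (leqnSn m))// -mulnn leq_pmulr.
- apply: is_cvg_geometric_series; rewrite ger0_norm ?expR_ge0//.
  by rewrite expR_lt1 oppr_lt0.
Qed.

(** Since [p t 0 (2 m h)] is [expR (- 2 m^2 (h / sqrt t)^2) / sqrt (2 pi t)], the
    two series agree term by term. *)
Lemma kolmogorov_cdfE h t : 0 < h -> 0 < t ->
  kolmogorov_cdf (h / Num.sqrt t) / Num.sqrt (2 * pi * t) =
  limn (fun N => image_kernel h N t).
Proof.
move=> h0 t0; have w0 : 0 < Num.sqrt (2 * pi * t).
  by rewrite sqrtr_gt0 !mulr_gt0// pi_gt0.
have E N : \sum_(k < N.*2.+1)
    (let m := (k : nat)%:Z - N%:Z in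
     (-1) ^ m * expR (- (2 * m%:~R ^+ 2 * (h / Num.sqrt t) ^+ 2))) =
    Num.sqrt (2 * pi * t) * image_kernel h N t.
  pose G (m : int) := (-1) ^ m * expR (- (2 * m%:~R ^+ 2 * (h / Num.sqrt t) ^+ 2)) : R.
  have GE m : G m%:Z = Num.sqrt (2 * pi * t) * ((-1) ^+ m * p t 0 (2 * m%:R * h)).
    rewrite /G /brownian_density [RHS]mulrCA mulVKf ?gt_eqF//.
    congr (_ * expR (- _)); rewrite exprMn exprVn sqr_sqrtr ?ltW//.
    by rewrite sub0r sqrrN -pmulrn; field; rewrite gt_eqF.
  rewrite (sum_int_symmetric (G := G)); last first.
    by move=> m; rewrite /G !expN1r abszN intrN sqrrN.
  rewrite (GE 0%N) expr0 mul1r mulr0 mul0r /image_kernel [RHS]mulrDr; congr (_ + _).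
  rewrite [RHS]mulrCA; congr (_ * _); rewrite [RHS]mulr_sumr.
  by apply: eq_bigr => m _; rewrite GE.
have cim := is_cvg_image_kernel h0 t0.
have -> : kolmogorov_cdf (h / Num.sqrt t) =
    Num.sqrt (2 * pi * t) * limn (fun N => image_kernel h N t).
  rewrite /kolmogorov_cdf; apply/cvg_lim => //.
  under eq_cvg do rewrite E.
  by apply: cvgMr; exact: cim.
by rewrite mulrAC divff ?mul1r// gt_eqF.
Qed.

End theta.

Section theta_integral.
Variable R : realType.
Local Notation mu := (@lebesgue_measure R).
Local Notation p := (@brownian_density R).
Local Notation tail := (@gaussian_tail R).
Variables (T b h : R).
Hypotheses (T0 : 0 < T) (b0 : 0 < b) (h0 : 0 < h).
Local Notation I := ([set` `]0, T[%R] : set (measurableTypeR R)).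

(** Integration of a kernel in [t] against the kernel of the remaining time
    [T - t], which carries the path over the distance [b]. *)
Let last_leg (f : R -> R) (l : R) := mu.-integrable I (fun t => (f t * p (T - t) 0 b)%:E) /\
  \int[mu]_(t in I) (f t * p (T - t) 0 b) = l.

Let mI : measurable I. Proof. exact: measurable_itv. Qed.

Let measurable_density c : measurable_fun setT (fun t : R => p t 0 c).
Proof.
apply: (measurableT_comp (@measurable_brownian_density_time R) (g := fun t : R => (t, c))).
exact: measurable_fun_pair.
Qed.

Let measurable_last_leg : measurable_fun setT (fun t : R => p (T - t) 0 b).
Proof.
apply: (measurableT_comp (measurable_density b) (g := fun t : R => T - t)).
exact: measurable_funB.
Qed.

Let last_leg_density a : 0 <= a -> last_leg (fun t => p t 0 a) (tail T (a + b)).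
Proof.
move=> a0; have E := brownian_density_convolution T0 a0 b0.
split; last by rewrite /Rintegral E.
apply/integrableP; split.
  apply/measurable_EFinP; apply: measurable_funTS.
  by apply: measurable_funM; [exact: measurable_density|exact: measurable_last_leg].
under eq_integral do rewrite /= ger0_norm ?mulr_ge0 ?brownian_density_ge0//.
by rewrite E ltry.
Qed.

Let last_legZ k f l : last_leg f l -> last_leg (fun t => k * f t) (k * l).
Proof.
case=> intf <-; split.
  have := integrable_realZl mI k intf.
  by apply: eq_integrable => // t _; rewrite mulrA.
by rewrite -RintegralZl//; apply: eq_Rintegral => t _; rewrite -mulrA.
Qed.

Let last_legD f g l m : last_leg f l -> last_leg g m ->
  last_leg (fun t => f t + g t) (l + m).
Proof.
case=> intf <- [intg <-]; split.
  have := integrable_realD mI intf intg.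
  by apply: eq_integrable => // t _; rewrite mulrDl.
by rewrite -RintegralD//; apply: eq_Rintegral => t _; rewrite mulrDl.
Qed.

Let last_leg_image_kernel N : last_leg (image_kernel h N)
  (tail T b + 2 * \sum_(m < N) (-1) ^+ m.+1 * tail T (b + 2 * m.+1%:R * h)).
Proof.
elim: N => [|N IH].
  have := last_leg_density (lexx 0); rewrite big_ord0 mulr0 addr0 add0r.
  congr last_leg; apply/funext => t.
  by rewrite /image_kernel big_ord0 mulr0 addr0.
have a0 : 0 <= 2 * N.+1%:R * h by rewrite !mulr_ge0// ltW.
have := last_legD IH (last_legZ (2 * (-1) ^+ N.+1) (last_leg_density a0)).
congr last_leg.
  by apply/funext => t; rewrite /image_kernel [in RHS]big_ord_recr/=; ring.
by rewrite [in RHS]big_ord_recr/= (addrC (_ * h) b); ring.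
Qed.

(** At the centre the [j]-th pair of images is the pair of terms [2 j + 1] and
    [2 j + 2] of an alternating sum. *)
Let barrier_center J : barrier h J b T 0 = h * (tail T b +
  2 * \sum_(m < J.*2) (-1) ^+ m.+1 * tail T (b + 2 * m.+1%:R * h)).
Proof.
rewrite /barrier !subr0 mulrDr mulrA (mulrC h 2); congr (_ + _).
rewrite -mulrN; congr (_ * _); elim: J => [|J IH].
  by rewrite double0 !big_ord0 oppr0.
rewrite doubleS 2!big_ord_recr [in RHS]big_ord_recr/= opprD IH -addrA; congr (_ + _).
have E k : (-1) ^+ (J.*2 + k) = (-1) ^+ k :> R.
  by rewrite exprD -mul2n exprM sqrrN expr1n expr1n mul1r.
rewrite -[J.*2.+1]addn1 -[(J.*2 + 1).+1]addn1 -addnA !E expr1 sqrrN expr1n.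
rewrite addr0 subr0 mulN1r mul1r opprB addrC -addnn !natrD.
by congr (tail T _ - tail T _); ring.
Qed.

(** The convolution identity holds for each truncation of the theta series; the
    bound of [image_kernel_bound] dominates them all. *)
Lemma barrier_center_cvg :
  let g t := p (T - t) 0 b * (kolmogorov_cdf (h / Num.sqrt t) / Num.sqrt (2 * pi * t)) in
  mu.-integrable I (fun t => (g t)%:E) /\
  barrier h J b T 0 @[J --> \oo] --> h * \int[mu]_(t in I) g t.
Proof.
move=> g; pose gn N t := image_kernel h N t * p (T - t) 0 b.
have gE t : I t -> gn N t @[N --> \oo] --> g t.
  rewrite /= in_itv/= => /andP[t0 _]; rewrite /g kolmogorov_cdfE// mulrC.
  apply: cvgMl; exact: is_cvg_image_kernel.
have gE' t : I t -> (gn N t)%:E @[N --> \oo] --> (g t)%:E.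
  by move=> It; apply: cvg_EFin; [exact: nearW|exact: gE].
have mgn N : measurable_fun I (fun t => (gn N t)%:E).
  by have [/integrableP[]] := last_leg_image_kernel N.
have [|||||ig _ cvgg] := @dominated_convergence _ _ _ mu I mI
  (fun N t => (gn N t)%:E) (EFin \o g) (fun t => (3 * (p t 0 0 * p (T - t) 0 b))%:E).
- exact: mgn.
- exact: (@emeasurable_fun_cvg _ _ _ I (fun N t => (gn N t)%:E)).
- exact: aeW.
- by have [+ _] := last_leg_density (lexx 0); exact: integrable_realZl.
- apply: aeW => t N; rewrite /= in_itv/= => /andP[t0 _].
  rewrite lee_fin normrM (ger0_norm (brownian_density_ge0 _ _ _)) mulrA.
  by rewrite ler_wpM2r ?brownian_density_ge0// image_kernel_bound.
split => //.
under eq_cvg do rewrite barrier_center.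
apply: cvgMr.
have c : (fun N => tail T b + 2 * \sum_(m < N) (-1) ^+ m.+1 * tail T (b + 2 * m.+1%:R * h))
    @ \oo --> \int[mu]_(t in I) g t.
  have -> : (fun N => tail T b +
      2 * \sum_(m < N) (-1) ^+ m.+1 * tail T (b + 2 * m.+1%:R * h)) =
      (fun N => \int[mu]_(t in I) gn N t).
    by apply/funext => N; have [_ <-] := last_leg_image_kernel N.
  apply: fine_cvg; rewrite fineK; first exact: cvgg.
  exact: integrable_fin_num.
apply: (cvg_comp _ _ _ c); apply/cvgnyPge => A; exists A => // J /= AJ.
by rewrite (leq_trans AJ)// -addnn leq_addr.
Qed.

End theta_integral.

(** * Exit time of a bridge with a reflected target *)

Section exit_time_formula.
Variables (R : realType) (kap : R).
Hypothesis kap01 : 0 <= kap <= 1.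
Local Notation mu := (@lebesgue_measure R).
Local Notation p := (@brownian_density R).
Let k t z u := p t z u - kap * p t z (- u).
Variables (q : R -> R -> R -> R) (S : set R) (phi : R -> R) (x y h T C0 : R).
Hypothesis mS : measurable S.
Hypothesis phi0 : forall z, S z -> 0 < phi z.
Hypothesis mphi : measurable_fun setT phi.
Hypothesis mphiV : measurable_fun setT (fun z => (phi z)^-1).
Hypothesis qE : forall t z u, S z -> S u -> q t z u = phi u / phi z * k t z u.
Hypothesis k_ge0 : forall t z u, 0 < t -> S z -> S u -> 0 <= k t z u.
Hypothesis hS : [set u : R | `|u - x| <= h] `<=` S.
Hypothesis Sy : S y.
Hypothesis h0 : 0 < h.
Hypothesis hy : h <= `|y - x|.
Hypothesis hNy : h <= `|- y - x|.
Hypothesis T0 : 0 < T.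
Hypothesis kT0 : 0 < k T x y.
Hypothesis C0ge0 : 0 <= C0.
Hypothesis k_near : forall t z u, 0 < t -> `|z - x| <= h -> `|u - x| <= h ->
  kap * p t z (- u) <= C0 * t ^+ 2 * p (2 * t) z u.

Let direction c : exists e : R, (e = 1 \/ e = -1) /\ x + e * `|c - x| = c.
Proof.
have [xc|cx] := leP x c.
  by exists 1; split; [left|rewrite mul1r ger0_norm ?subr_ge0// addrC subrK].
exists (-1); split; first by right.
by rewrite ltr0_norm ?subr_lt0// mulrNN mul1r addrC subrK.
Qed.

Variables (dd : measure_display) (Omega : measurableType dd) (P : probability Omega R).
Variable X : R -> Omega -> R.
Hypothesis PX : markov_process q S x P X.
Variables (dd' : measure_display) (Omega' : measurableType dd') (Q : probability Omega' R).
Variable Y : R -> Omega' -> R.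
Hypothesis QY : bridge q x T y P X Q Y.

Local Notation b1 := `|y - x|.
Local Notation b2 := `|- y - x|.

(** The candidate solution is the barrier with target [y] minus [kap] times the
    barrier with target [- y]; the right-hand side bounds the last tail of both
    truncated sums. *)
Let approx J : exists I : R,
  (\int[Q]_w exit_time `[0%R, T] (x - h) (x + h) (Y ^~ w) = I%:E)%E /\
  `|k T x y * I - (barrier h J `|y - x| T 0 - kap * barrier h J `|- y - x| T 0)| <=
  128 * T ^+ 2 / h ^+ 3 * J.+1%:R^-1.
Proof.
have [e1 [e1E xy]] := direction y; have [e2 [e2E xNy]] := direction (- y).
have /andP[kap0 kap1] := kap01.
pose V r z := barrier h J b1 r (e1 * (z - x)) - kap * barrier h J b2 r (e2 * (z - x)).
have eN e (z : R) : e = 1 \/ e = -1 -> `|e * z| = `|z|.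
  by case=> ->; rewrite ?mul1r// mulN1r normrN.
have VE r z : `|V r z| <= `|barrier h J b1 r (e1 * (z - x))| +
    `|barrier h J b2 r (e2 * (z - x))|.
  rewrite /V (le_trans (ler_normB _ _))// lerD2l normrM ger0_norm//.
  by rewrite ler_piMl.
(* One of the four powers of [J.+1] is kept, for a bound that still vanishes. *)
have tailJ b r : h <= b -> 0 < r <= T ->
    gaussian_tail r (b + (4 * J%:R + 1) * h) <= 32 * T ^+ 2 / h ^+ 4 * J.+1%:R^-1.
  move=> hb /andP[r0 rT].
  have J0 : 0 <= J%:R :> R by [].
  have J1 : 0 < J.+1%:R :> R by [].
  have c0 : J.+1%:R * h <= b + (4 * J%:R + 1) * h.
    rewrite (le_trans _ (lerD hb (lexx _)))// -natr1 mulrDl mul1r addrC lerD2l.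
    by rewrite ler_wpM2r ?(ltW h0)//; move: (J%:R) J0 => j J0; lra.
  have c1 : 0 < b + (4 * J%:R + 1) * h by rewrite (lt_le_trans _ c0) ?mulr_gt0.
  rewrite (le_trans (gaussian_tail_le r0 c1))//.
  rewrite -[leRHS]mulrA ler_pM//.
  - by rewrite mulr_ge0// sqr_ge0.
  - by rewrite invr_ge0 exprn_ge0// ltW.
  - by rewrite ler_wpM2l// ler_pXn2r// nnegrE ltW.
  rewrite -invfM lef_pV2 ?posrE ?mulr_gt0 ?exprn_gt0//.
  apply: le_trans (_ : (J.+1%:R * h) ^+ 4 <= _); last first.
    by rewrite ler_pXn2r// nnegrE ltW// mulr_gt0.
  rewrite exprMn mulrC ler_wpM2r ?exprn_ge0 ?(ltW h0)//.
  by rewrite -natrX ler_nat -[leqLHS]expn1 leq_pexp2l.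
have boundary : forall r z, 0 < r <= T ->
    `|V r z| <= (9 + 8 * J%:R) *+ 2 * `| `|z - x| - h| + 128 * T ^+ 2 / h ^+ 3 * J.+1%:R^-1.
  move=> r z rT; have /andP[r0 _] := rT.
  have B1 := barrier_near_boundary J (e1 * (z - x)) h0 hy r0.
  have B2 := barrier_near_boundary J (e2 * (z - x)) h0 hNy r0.
  rewrite (eN _ _ e1E) in B1; rewrite (eN _ _ e2E) in B2.
  have t1 := ler_wpM2l (ltW (mulr_gt0 (ltr0Sn R 1) h0)) (tailJ b1 r hy rT).
  have t2 := ler_wpM2l (ltW (mulr_gt0 (ltr0Sn R 1) h0)) (tailJ b2 r hNy rT).
  have E : 128 * T ^+ 2 / h ^+ 3 * J.+1%:R^-1 =
      2 * h * (32 * T ^+ 2 / h ^+ 4 * J.+1%:R^-1) *+ 2.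
    by move: (J.+1%:R^-1 : R) => w; field; rewrite gt_eqF.
  rewrite E (le_trans (VE r z))// (le_trans (lerD B1 B2))//.
  have add_le c a u v w : u <= w -> v <= w ->
      (c * a + u) + (c * a + v) <= c *+ 2 * a + w *+ 2 :> R.
    by move=> uw vw; rewrite addrACA mulrnAl -mulr2n lerD2l mulr2n lerD.
  exact: add_le.
have small a : a < h -> exists K, forall r z, 0 < r -> `|z - x| <= a ->
    `|V r z| <= K * r ^+ 2.
  move=> ah; pose c := 2 * h * (1 + 2 * J%:R) * (32 / (h - a) ^+ 4).
  exists (c + c) => r z r0 za.
  have B1 := @barrier_small_time _ h J b1 r (e1 * (z - x)) a r0 ah hy.
  have B2 := @barrier_small_time _ h J b2 r (e2 * (z - x)) a r0 ah hNy.
  rewrite (eN _ _ e1E) in B1; rewrite (eN _ _ e2E) in B2.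
  by rewrite (le_trans (VE r z))// mulrDl lerD ?B1 ?B2.
have -> : barrier h J b1 T 0 - kap * barrier h J b2 T 0 = V T x.
  by rewrite /V subrr !mulr0.
apply: (@bridge_exit_time_approx _ q k S phi x y h T V ((9 + 8 * J%:R) *+ 2)
  (128 * T ^+ 2 / h ^+ 3 * J.+1%:R^-1) C0) PX _ _ _ _ QY => //.
- move=> t z u t0 Sz Su; rewrite k_ge0//= /k gerBl mulr_ge0//.
  exact: brownian_density_ge0.
- move=> t; apply: measurable_funB; first exact: measurable_brownian_density2.
  apply: measurable_funM => //.
  apply: (measurableT_comp (@measurable_brownian_density2 R t)
    (g := fun zu : R * R => (zu.1, - zu.2))).
  by apply: measurable_fun_pair => //; exact: measurable_funN.
- by rewrite mulr_ge0// divr_ge0 ?mulr_ge0 ?exprn_ge0 ?(ltW h0) ?(ltW T0).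
- by move=> t z u t0 zx ux; rewrite /k opprB addrC subrK; exact: k_near.
- move=> r r0; apply: measurable_funB.
    by apply: (measurableT_comp (measurable_barrier h J b1 r0));
      apply: measurable_funM => //; exact: measurable_funB.
  apply: measurable_funM => //.
  by apply: (measurableT_comp (measurable_barrier h J b2 r0));
    apply: measurable_funM => //; exact: measurable_funB.
- move=> t r z t0 r0.
  have := gaussian_meanB (gaussian_mean_barrier h J b1 x z t0 r0 e1E)
    (gaussian_meanZ kap (gaussian_mean_barrier h J b2 x z t0 r0 e2E)).
  by rewrite xy xNy; congr gaussian_mean; rewrite /V /k; ring.
Qed.

Lemma bridge_exit_time_formula :
  (\int[Q]_w exit_time `[0%R, T] (x - h) (x + h) (Y ^~ w) =
   h%:E * \int[mu]_(t in `]0%R, T[) (q (T - t) x y / q T x y *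
     (kolmogorov_cdf (h / Num.sqrt t) / Num.sqrt (2 * pi * t)))%:E)%E.
Proof.
have b1gt0 : 0 < b1 by exact: lt_le_trans hy.
have b2gt0 : 0 < b2 by exact: lt_le_trans hNy.
pose theta t := kolmogorov_cdf (h / Num.sqrt t) / Num.sqrt (2 * pi * t).
pose g b t := p (T - t) 0 b * theta t.
have [ig1 c1] : mu.-integrable [set` `]0, T[%R] (fun t => (g b1 t)%:E) /\ _ :=
  barrier_center_cvg T0 b1gt0 h0.
have [ig2 c2] : mu.-integrable [set` `]0, T[%R] (fun t => (g b2 t)%:E) /\ _ :=
  barrier_center_cvg T0 b2gt0 h0.
set L1 := Rintegral _ _ _ in c1; set L2 := Rintegral _ _ _ in c2.
have mI : measurable ([set` `]0, T[%R] : set (measurableTypeR R)) by exact: measurable_itv.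
have Sx : S x by apply: hS; rewrite /= subrr normr0 ltW.
have kE t : k t x y = p t 0 `|y - x| - kap * p t 0 `|- y - x|.
  have pn c : p t 0 `|c| = p t 0 c.
    have [c0|c0] := leP 0 c; first by rewrite ger0_norm.
    by rewrite ltr0_norm// brownian_densityN.
  by rewrite /k brownian_densityE (brownian_densityE _ _ (- y)) !pn.
have phixy : phi y / phi x != 0 by rewrite gt_eqF// divr_gt0// phi0.
have [I [IE _]] := approx 0; rewrite IE.
have {}IE : k T x y * I = h * (L1 - kap * L2).
  pose eps (J : nat) := 128 * T ^+ 2 / h ^+ 3 * J.+1%:R^-1.
  have ceps : eps @ \oo --> (0 : R).
    rewrite -[X in _ --> X](mulr0 (128 * T ^+ 2 / h ^+ 3)).
    by apply: cvgMr; exact: cvg_harmonic.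
  have cV : (fun J => `|k T x y * I - (barrier h J b1 T 0 - kap * barrier h J b2 T 0)|)
      @ \oo --> `|k T x y * I - (h * L1 - kap * (h * L2))|.
    apply: cvg_norm; apply: cvgB; first exact: cvg_cst.
    by apply: cvgB; [exact: c1|apply: cvgMr; exact: c2].
  have : `|k T x y * I - (h * L1 - kap * (h * L2))| <= 0.
    apply: (ler_cvg_to cV ceps); apply: nearW => J.
    by have [I' [+ +]] := approx J; rewrite IE => -[<-].
  by rewrite normr_le0 subr_eq0 => /eqP ->; ring.
have -> : (\int[mu]_(t in `]0%R, T[) (q (T - t) x y / q T x y *
     (kolmogorov_cdf (h / Num.sqrt t) / Num.sqrt (2 * pi * t)))%:E =
  ((k T x y)^-1 * (L1 - kap * L2))%:E)%E.
  have ig := integrable_realZl mI (k T x y)^-1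
    (integrable_realB mI ig1 (integrable_realZl mI kap ig2)).
  transitivity (\int[mu]_(t in `]0%R, T[) ((k T x y)^-1 * (g b1 t - kap * g b2 t))%:E)%E.
    apply: eq_integral => t _; congr EFin.
    by rewrite !qE// -mulf_div divff// mul1r kE /g -/(theta t); ring.
  rewrite -[LHS]fineK; last exact: integrable_fin_num.
  congr EFin; rewrite -[LHS]/(Rintegral _ _ _) RintegralZl//.
  - congr (_ * _); rewrite RintegralB//; last exact: integrable_realZl.
    by rewrite RintegralZl.
  - by apply: integrable_realB => //; exact: integrable_realZl.
rewrite -EFinM; congr EFin.
by rewrite mulrCA -IE mulKf// gt_eqF.
Qed.
End exit_time_formula.

(** * Brownian and Bessel bridges *)

Theorem theorem2p6 (R : realType) (T h : R) (hT : 0 < T) (hh : 0 < h) :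
  (forall (d : measure_display) (Omega : measurableType d)
     (P : probability Omega R) (X : R -> Omega -> R)
     (d' : measure_display) (Omega' : measurableType d')
     (Q : probability Omega' R) (Y : R -> Omega' -> R) (y : R),
     brownian_motion 0 P X ->
     bridge brownian_density 0 T y P X Q Y ->
     h <= `|y| ->
     (\int[Q]_w exit_time `[0%R, T] (- h) h (Y ^~ w) =
      h%:E * \int[lebesgue_measure]_(t in `]0%R, T[)
        (brownian_density (T - t) 0 y / brownian_density T 0 y *
         (kolmogorov_cdf (h / Num.sqrt t) / Num.sqrt (2 * pi * t)))%:E)%E)
  /\
  (forall (d : measure_display) (Omega : measurableType d)
     (P : probability Omega R) (X : R -> Omega -> R)
     (d' : measure_display) (Omega' : measurableType d')
     (Q : probability Omega' R) (Y : R -> Omega' -> R) (x y : R),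
     bessel3_process x P X ->
     bridge bessel3_density x T y P X Q Y ->
     h < x -> 0 < y -> ~ (x - h < y < x + h) ->
     (\int[Q]_w exit_time `[0%R, T] (x - h) (x + h) (Y ^~ w) =
      h%:E * \int[lebesgue_measure]_(t in `]0%R, T[)
        (bessel3_density (T - t) x y / bessel3_density T x y *
         (kolmogorov_cdf (h / Num.sqrt t) / Num.sqrt (2 * pi * t)))%:E)%E).
Proof.
have mid : measurable_fun setT (fun z : R => z) by [].
split=> [d Om P X d' Om' Q Y y PX QY hy|d Om P X d' Om' Q Y x y PX QY hx y0 yh].
(* Brownian motion: [kap = 0] and [phi = 1]. *)
- have kE t (z u : R) : brownian_density t z u - 0 * brownian_density t z (- u) =
    brownian_density t z u by rewrite mul0r subr0.
  suff : (\int[Q]_w exit_time `[0%R, T] (0 - h) (0 + h) (Y ^~ w) =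
      h%:E * \int[lebesgue_measure]_(t in `]0%R, T[)
        (brownian_density (T - t) 0 y / brownian_density T 0 y *
         (kolmogorov_cdf (h / Num.sqrt t) / Num.sqrt (2 * pi * t)))%:E)%E.
    by rewrite sub0r add0r.
  apply: (@bridge_exit_time_formula R 0 _ brownian_density setT (fun=> 1) 0 y h T 0
    _ _ _ _ _ _ _ _ _ _ _ _ _ _ _ _ _ _ _ PX) => //.
  + by rewrite lexx ler01.
  + by move=> t z u _ _; rewrite kE divr1 mul1r.
  + by move=> t z u _ _ _; rewrite kE brownian_density_ge0.
  + by rewrite subr0.
  + by rewrite subr0 normrN.
  + by rewrite kE brownian_density_gt0.
  + by move=> t z u _ _ _; rewrite !mul0r.
(* Bessel process: [kap = 1] and [phi z = z]. The reflected kernel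
   [p t z (- u)] is negligible on the interval because [z + u >= 2 * (x - h)]. *)
have x0 : 0 < x by exact: lt_trans hx.
have refl_le t (z u : R) : 0 < t -> 0 < z -> 0 < u ->
    brownian_density t z (- u) <= brownian_density t z u.
  move=> t0 z0 u0; rewrite /brownian_density ler_wpM2l ?invr_ge0 ?sqrtr_ge0//.
  rewrite ler_expR lerN2 ler_wpM2r ?invr_ge0 ?mulr_ge0 ?(ltW t0)//.
  nra.
have near z : `|z - x| <= h -> x - h <= z.
  by rewrite ler_norml => /andP[+ _]; lra.
have xh : 0 < x - h by rewrite subr_gt0.
apply: (@bridge_exit_time_formula R 1 _ bessel3_density `]0, +oo[ (fun z => z) x y h T
  (32 / (2 * (x - h)) ^+ 4) _ _ _ _ _ _ _ _ _ _ _ _ _ _ _ _ _ _ _ PX) => //.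
- by rewrite lexx ler01.
- by move=> z; rewrite /= in_itv/= andbT.
- exact: measurable_invr.
- by move=> t z u _ _; rewrite /bessel3_density mul1r.
- move=> t z u t0; rewrite /= !in_itv/= !andbT => z0 u0.
  by rewrite mul1r subr_ge0 refl_le.
- by move=> z /near xz; rewrite /= in_itv/= andbT (lt_le_trans xh).
- by rewrite /= in_itv/= andbT.
- by rewrite leNgt ltr_norml; apply/negP => /andP[? ?]; apply: yh; apply/andP; split; lra.
- by rewrite -opprD normrN ger0_norm; lra.
- rewrite mul1r subr_gt0 /brownian_density ltr_pM2l; last first.
    by rewrite invr_gt0 sqrtr_gt0 !mulr_gt0// pi_gt0.
  rewrite ltr_expR ltrN2 ltr_pM2r ?invr_gt0 ?mulr_gt0//; nra.
- by rewrite divr_ge0// exprn_ge0// mulr_ge0// ltW.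
- move=> t z u t0 /near xz /near xu; rewrite mul1r.
  have z0 : 0 < z by exact: lt_le_trans xz.
  have u0 : 0 < u by exact: lt_le_trans xu.
  have c0 : 0 < (2 * (x - h)) ^+ 4 by rewrite exprn_gt0// mulr_gt0.
  have -> : 32 / (2 * (x - h)) ^+ 4 * t ^+ 2 * brownian_density (2 * t) z u =
      32 * t ^+ 2 * brownian_density (2 * t) z u / (2 * (x - h)) ^+ 4.
    by move: ((2 * (x - h)) ^- 4) => w; ring.
  rewrite ler_pdivlMr// mulrC.
  apply: le_trans (_ : (z - (- u)) ^+ 4 * brownian_density t z (- u) <= _).
    rewrite ler_wpM2r ?brownian_density_ge0// ler_pXn2r// ?nnegrE; lra.
  rewrite (le_trans (brownian_density_pow4 _ _ t0))//.
  apply: ler_wpM2l; first by rewrite mulr_ge0// sqr_ge0.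
  by apply: refl_le => //; exact: mulr_gt0.
Qed.
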